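(* Let $N,M\ge1$ be integers and let $\mathcal{H}$, $\boldsymbol{\pi}$ and $\boldsymbol{\tau}$ be as defined in the context. For any operator $\mathcal{A}=\mathbf{A}_0\cdot+\mathbf{A}_1\langle\mathbf{B}_1\cdot\rangle_1+\dots+\mathbf{A}_N\langle\mathbf{B}_N\cdot\rangle_N\in\mathcal{H}$, $$\boldsymbol{\tau}(\mathcal{A})=\big(\mathrm{Tr}\,\mathbf{A}_0,\ \langle\mathrm{Tr}\,\mathbf{B}_1\mathbf{A}_1\rangle_1,\ \dots,\ \langle\mathrm{Tr}\,\mathbf{B}_N\mathbf{A}_N\rangle_N\big),$$ where $\mathrm{Tr}$ is the standard trace of square matrices. Moreover, for any $\mathcal{A},\mathcal{B}\in\mathcal{H}$ and any $\alpha,\beta\in\mathbb{C}$, $$\boldsymbol{\tau}(\alpha\mathcal{A}+\beta\mathcal{B})=\alpha\boldsymbol{\tau}(\mathcal{A})+\beta\boldsymbol{\tau}(\mathcal{B}),\qquad \boldsymbol{\tau}(\mathcal{A}\circ\mathcal{B})=\boldsymbol{\tau}(\mathcal{B}\circ\mathcal{A}).$$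
   Context: For $1\le j\le N$, $\langle\cdot\rangle_j:=\int_{[0,1]^j}\cdot\;dk_1\cdots dk_j$ (applied entrywise to scalar-, vector- or matrix-valued functions of $\mathbf{k}=(k_1,\dots,k_N)\in[0,1]^N$); the result depends only on $(k_{j+1},\dots,k_N)$ and is regarded also as a function on $[0,1]^N$ that is constant in $k_1,\dots,k_j$. $\mathcal{H}$ is the algebra of all operators on $L^2([0,1]^N,\mathbb{C}^M)$ of the form $$\mathcal{A}=\mathbf{A}_0\cdot+\mathbf{A}_1\langle\mathbf{B}_1\cdot\rangle_1+\dots+\mathbf{A}_N\langle\mathbf{B}_N\cdot\rangle_N,\qquad( * )$$ with continuous matrix-valued functions on $[0,1]^N$: $\mathbf{A}_0$ of size $M\times M$, $\mathbf{A}_j$ of size $M\times M_j$, $\mathbf{B}_j$ of size $M_j\times M$, $M_j$ positive integers; here $\mathbf{A}\cdot$ is multiplication by $\mathbf{A}$ and $\mathbf{A}\langle\mathbf{B}\cdot\rangle_j$ is the operator $\mathbf{u}\mapsto\mathbf{A}\langle\mathbf{B}\mathbf{u}\rangle_j$. $\mathrm{Inv}(\mathcal{H})$ is the set of elements of $\mathcal{H}$ invertible as bounded operators. For $\mathcal{A}\in\mathrm{Inv}(\mathcal{H})$ written as $( * )$, set $\pi_0(\mathcal{A})=\det\mathbf{A}_0$, $\mathbf{A}_{i,0}=\mathbf{A}_0^{-1}\mathbf{A}_i$ ($1\le i\le N$), and for $j=1,\dots,N$: $\mathbf{E}_j=\mathbf{I}+\langle\mathbf{B}_j\mathbf{A}_{j,j-1}\rangle_j$,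 $\pi_j(\mathcal{A})=\det\mathbf{E}_j$, $\mathbf{A}_{i,j}=\mathbf{A}_{i,j-1}-\mathbf{A}_{j,j-1}\mathbf{E}_j^{-1}\langle\mathbf{B}_j\mathbf{A}_{i,j-1}\rangle_j$ ($j<i\le N$). For invertible $\mathcal{A}$ all these determinants are nowhere zero, and $\boldsymbol{\pi}(\mathcal{A})=(\pi_0(\mathcal{A}),\dots,\pi_N(\mathcal{A}))$ does not depend on the chosen representation $( * )$; it takes values in $\mathcal{C}=\mathcal{C}_0\times\dots\times\mathcal{C}_N$, where $\mathcal{C}_j$ is the space of continuous functions $[0,1]^{N-j}\to\mathbb{C}$ of $(k_{j+1},\dots,k_N)$ for $j<N$ and $\mathcal{C}_N=\mathbb{C}$. For $\mathcal{A}\in\mathcal{H}$ (invertible or not), with $\mathcal{I}$ the identity operator, $$\boldsymbol{\tau}(\mathcal{A}):=\lim_{t\to0}\frac{\boldsymbol{\pi}(\mathcal{I}+t\mathcal{A})-\boldsymbol{\pi}(\mathcal{I})}{t},$$ where $t\in\mathbb{C}\setminus\{0\}$ is small (so that $\mathcal{I}+t\mathcal{A}$ is invertible) and the limit is taken in $\mathcal{C}$ with respect to the norm $\|\mathbf{f}\|_{\rm c}=\max_j\max_{\mathbf{k}_j\in[0,1]^{N-j}}|f_j(\mathbf{k}_j)|$. *)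

(* Defs.v *)
From HB Require Import structures.
From mathcomp Require Import all_boot all_order all_algebra.
From mathcomp Require Import all_classical all_reals all_analysis.
From mathcomp Require Import complex.

Set Implicit Arguments.
Unset Strict Implicit.
Unset Printing Implicit Defensive.

Import Order.TTheory GRing.Theory Num.Theory.
Import numFieldTopology.Exports numFieldNormedType.Exports.

Local Open Scope classical_set_scope.
Local Open Scope ring_scope.

(* R[i] packed as a numClosedFieldType, so that the topology which
   MathComp-Analysis puts on number fields is found by unification. *)
Definition Cplx (R : realType) : numClosedFieldType := R[i].

Definition cabs (R : realType) (z : Cplx R) : R := Normc.normc z.

(* Points of R^n; coordinates are 0-based: [tnth k i] is k_{i+1}. *)
Notation pt R n := (n.-tuple (measurableTypeR R)).

Definition cube (R : realType) (n : nat) : set (pt R n) :=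
  [set x | forall i : 'I_n, 0 <= (tnth x i : R) <= 1].
Arguments cube : clear implicits.

Section cons_measure.
Context d (T : measurableType d) (R : realType) (n : nat)
  (m : {sigma_finite_measure set T -> \bar R})
  (nu : {sigma_finite_measure set (n.-tuple T) -> \bar R}).

Definition cons_pt (p : T * n.-tuple T) : n.+1.-tuple T :=
  [tuple of p.1 :: p.2].

Let measurable_cons_pt : measurable_fun setT cons_pt.
Proof. exact: measurable_cons. Qed.

HB.instance Definition _ :=
  isMeasurableFun.Build _ _ _ _ cons_pt measurable_cons_pt.

Definition cons_measure : set (n.+1.-tuple T) -> \bar R :=
  pushforward (m \x nu)%E cons_pt.

Let cons_measure0 : cons_measure set0 = 0%E.
Proof. exact: measure0. Qed.

Let cons_measure_ge0 A : (0 <= cons_measure A)%E.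
Proof. exact: measure_ge0. Qed.

Let cons_measure_sigma_additive : semi_sigma_additive cons_measure.
Proof. exact: measure_semi_sigma_additive. Qed.

HB.instance Definition _ := isMeasure.Build _ _ _ cons_measure
  cons_measure0 cons_measure_ge0 cons_measure_sigma_additive.

Let cons_measure_sigma_finite : sigma_finite setT cons_measure.
Proof.
have /sigma_finiteP[F [FT ndF Ffin]] := sigma_finiteT m.
have /sigma_finiteP[G [GT ndG Gfin]] := sigma_finiteT nu.
pose uncons (x : n.+1.-tuple T) : T * n.-tuple T :=
  (thead x, [tuple of behead x]).
have unconsK p : uncons (cons_pt p) = p.
  by case: p => a t; rewrite /uncons /cons_pt theadE; congr pair; exact/val_inj.
have muncons : measurable_fun setT uncons.
  apply: measurable_fun_pair; first exact: measurable_tnth.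
  exact: measurable_behead.
exists (fun i => uncons @^-1` (F i `*` G i)).
  apply/esym; rewrite -subTset => x _.
  have [i _ Fi] : (\bigcup_i F i) (thead x) by rewrite -FT.
  have [j _ Gj] : (\bigcup_i G i) [tuple of behead x] by rewrite -GT.
  exists (maxn i j) => //; split => /=.
    by move: Fi; exact/subsetPset/ndF/leq_maxl.
  by move: Gj; exact/subsetPset/ndG/leq_maxr.
move=> i; have [mF Foo] := Ffin i; have [mG Goo] := Gfin i; split.
  rewrite -[X in measurable X]setTI; apply: muncons => //.
  exact: measurableX.
rewrite /cons_measure /pushforward -comp_preimage.
rewrite (_ : uncons \o cons_pt = id) ?preimage_id; last exact/funext.
by rewrite product_measure1E// lte_mul_pinfty// ge0_fin_numE.
Qed.

HB.instance Definition _ := Measure_isSigmaFinite.Build _ _ _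
  cons_measure cons_measure_sigma_finite.

End cons_measure.

(* Lebesgue measure on R^n. *)
Fixpoint leb (R : realType) (n : nat) :
    {sigma_finite_measure set (pt R n) -> \bar R} :=
  match n with
  | 0 => \d_([tuple] : pt R 0)
  | n'.+1 => cons_measure (@lebesgue_measure R) (leb R n')
  end.

Section setup.
Context (R : realType) (N M : nat).
Local Notation C := (Cplx R).
Local Notation K := (pt R N).
Local Notation mu := (leb R N).
Local Notation Q := (cube R N).

(* Continuity on [0,1]^N; values outside the cube are irrelevant.  Points are
   transported to row vectors, which carry the product topology. *)
Definition cont_cube (f : K -> C) : Prop :=
  {within [set x : 'rV[R]_N | Q [tuple x ord0 i | i < N]],
    continuous (fun x : 'rV[R]_N => f [tuple x ord0 i | i < N])}.

Definition cont_cube_mx m n (F : K -> 'M[C]_(m, n)) : Prop :=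
  forall a b, cont_cube (fun k => F k a b).

(* (y_1, ..., y_j, k_{j+1}, ..., k_N) *)
Definition splice j (y : pt R j) (k : K) : K :=
  [tuple nth (tnth k i) y i | i < N].

Definition avg j (f : K -> C) (k : K) : C :=
  Complex (\int[leb R j]_(y in cube R j) complex.Re (f (splice y k)))
          (\int[leb R j]_(y in cube R j) complex.Im (f (splice y k))).

Definition avgmx j m n (F : K -> 'M[C]_(m, n)) (k : K) : 'M[C]_(m, n) :=
  \matrix_(a, b) avg j (fun x => F x a b) k.

(* L^2([0,1]^N, C^M) is handled through representatives: functions on R^N, of
   which only the restriction to the cube, up to null sets, matters. *)
Definition vfun : Type := K -> 'cV[C]_M.

Definition sqnorm (u : vfun) (k : K) : R := \sum_i cabs (u k i ord0) ^+ 2.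

Definition L2 : set vfun := [set u : vfun |
  (forall i, measurable_fun Q (fun k => complex.Re (u k i ord0)) /\
             measurable_fun Q (fun k => complex.Im (u k i ord0))) /\
  (\int[mu]_(k in Q) (sqnorm u k)%:E < +oo)%E].

Definition L2norm (u : vfun) : R := Num.sqrt (\int[mu]_(k in Q) sqnorm u k).

Definition L2eq (u v : vfun) : Prop := ae_eq mu Q u v.

(* Operators on L^2, again through representatives. *)
Definition oper : Type := vfun -> vfun.

Definition L2_oper (F : oper) : Prop :=
  (forall u, L2 u -> L2 (F u)) /\
  (forall u v, L2 u -> L2 v -> L2eq u v -> L2eq (F u) (F v)).

Definition oper_eq (F G : oper) : Prop := forall u, L2 u -> L2eq (F u) (G u).

Definition oper_lin (a : C) (F : oper) (b : C) (G : oper) : oper :=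
  fun u k => a *: F u k + b *: G u k.

Definition bounded_oper (F : oper) : Prop :=
  [/\ L2_oper F,
      forall (a b : C) u v, L2 u -> L2 v ->
        L2eq (F (fun k => a *: u k + b *: v k))
             (fun k => a *: F u k + b *: F v k)
    & exists c : R, forall u, L2 u -> L2norm (F u) <= c * L2norm u].

(* Coefficients of a representation
     A_0 . + A_1 <B_1 .>_1 + ... + A_N <B_N .>_N;
   [rdim j] is M_j, and indices j outside 1..N are never used. *)
Record hrep := Hrep {
  rdim : nat -> nat;
  rA0 : K -> 'M[C]_M;
  rA : forall j, K -> 'M[C]_(M, rdim j);
  rB : forall j, K -> 'M[C]_(rdim j, M);
  rdim_gt0 : forall j, (1 <= j <= N)%N -> (0 < rdim j)%N;
  rA0_cont : cont_cube_mx rA0;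
  rA_cont : forall j, (1 <= j <= N)%N -> cont_cube_mx (rA j);
  rB_cont : forall j, (1 <= j <= N)%N -> cont_cube_mx (rB j) }.

Definition oper_of (r : hrep) : oper := fun u k =>
  rA0 r k *m u k +
  \sum_(1 <= j < N.+1) rA r j k *m avgmx j (fun x => rB r j x *m u x) k.

Definition represents (r : hrep) (F : oper) : Prop := oper_eq F (oper_of r).

Definition calH (F : oper) : Prop := L2_oper F /\ exists r, represents r F.

Definition InvH (F : oper) : Prop :=
  calH F /\
  exists G, [/\ bounded_oper G, oper_eq (F \o G) id & oper_eq (G \o F) id].

Definition Emx_of (r : hrep) j (X : K -> 'M[C]_(M, rdim r j)) (k : K) :
    'M[C]_(rdim r j) :=
  1%:M + avgmx j (fun x => rB r j x *m X x) k.

(* [Ared r j i] is A_{i,j}. *)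
Fixpoint Ared (r : hrep) (j i : nat) : K -> 'M[C]_(M, rdim r i) :=
  match j with
  | 0 => fun k => invmx (rA0 r k) *m rA r i k
  | j'.+1 => fun k =>
      Ared r j' i k -
      Ared r j' j k *m invmx (Emx_of (Ared r j' j) k) *m
        avgmx j (fun x => rB r j x *m Ared r j' i x) k
  end.

Definition Emx (r : hrep) (j : nat) : K -> 'M[C]_(rdim r j) :=
  Emx_of (Ared r j.-1 j).

(* Elements of the space \mathcal C = C_0 x ... x C_N: the j-th component is a
   function on [0,1]^N which does not depend on k_1, ..., k_j. *)
Definition cfam : Type := 'I_N.+1 -> K -> C.

Definition calC (f : cfam) : Prop := forall j : 'I_N.+1,
  cont_cube (f j) /\
  forall k k', Q k -> Q k' ->
    (forall i : 'I_N, (j <= i)%N -> tnth k i = tnth k' i) -> f j k = f j k'.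

Definition calC_eq (f g : cfam) : Prop := forall j k, Q k -> f j k = g j k.

(* Extended-real valued, so that an unbounded family has norm +oo. *)
Definition cnorm (f : cfam) : \bar R :=
  \big[maxe/0%E]_(j < N.+1) ereal_sup [set (cabs (f j k))%:E | k in Q].

Definition pi_repr (r : hrep) : cfam := fun j k =>
  if j == 0%N :> nat then \det (rA0 r k) else \det (Emx r j k).

(* The value of pi_repr at some representation if F is invertible (any two
   representations give the same values on the cube), 0 otherwise. *)
Definition bpi (F : oper) : cfam :=
  xget (fun _ _ => 0)
    [set p | InvH F /\ exists2 r, represents r F & p = pi_repr r].

Definition tau_lim (F : oper) (f : cfam) : Prop :=
  calC f /\
  cnorm (fun j k =>
    (bpi (oper_lin 1 id t F) j k - bpi id j k) / t - f j k)
    @[t --> (0 : C)^'] --> 0%E.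

Definition tau (F : oper) : cfam := xget (fun _ _ => 0) [set f | tau_lim F f].

Definition trace_repr (r : hrep) : cfam := fun j k =>
  if j == 0%N :> nat then \tr (rA0 r k)
  else avg j (fun x => \tr (rB r j x *m rA r j x)) k.

End setup.

(* Main.v *)
Require Import Defs.
From mathcomp Require Import all_boot all_order all_algebra.
From mathcomp Require Import fingroup perm.
From mathcomp Require Import all_classical all_reals all_analysis.
From mathcomp Require Import measurable_realfun.
From mathcomp Require Import complex.
From mathcomp Require Import ring lra.

Set Implicit Arguments.
Unset Strict Implicit.
Unset Printing Implicit Defensive.

Import Order.TTheory GRing.Theory Num.Theory.
Import numFieldTopology.Exports numFieldNormedType.Exports.

Local Open Scope classical_set_scope.
Local Open Scope ring_scope.

(* Write A_t = I + tA; a representation of A with coefficients A_i, B_i gives one of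
   A_t with coefficients I + t A_0, t A_i and B_i.  The elimination
   (A_0, A_i) -> A_{i,j} keeps A_{i,j} = t A_i + O(t^2) uniformly on the cube, so
   that E_j = I + t <B_j A_j>_j + O(t^2), and det(I + X) = 1 + Tr X + O(X^2) gives
   the formula for tau.

   The limit is about the operators A_t and not about one chosen representation
   of them, so two further facts are needed.  First, A_t is invertible for small t,
   because it factors as A_0 (I + A_{1,0} <B_1 .>_1) ... (I + A_{N,N-1} <B_N .>_N),
   each factor having the inverse I - A_{j,j-1} E_j^{-1} <B_j .>_j.  Second, pi does
   not depend on the representation.  Indeed the operator determines A_0 and the
   kernels A_j(k) B_j(k') on the cube, and if A B = A' B' are two factorizations of
   one kernel, then D = <B A>, G = <B A'>, G' = <B' A>, D' = <B' A'> satisfy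
   D D = G G', D G = G D', G' D = D' G', D' D' = G' G.  These identities imply
   det(I + D) = det(I + D') and A (I + D)^{-1} B = A' (I + D')^{-1} B', which
   propagates the equality of the kernels through the elimination.

   Linearity and the trace property follow from the formula for tau, applied to
   explicit representations of a A + b B and of A o B. *)

(** * Linear algebra *)

(** Two representations may have different inner dimensions, so [E_j] and [E_j'] have different
    sizes and only their determinants can be compared; the mixed averages [G] and [G'] are what
    links them. A lower bound on the determinants is known for the explicit representation of [A_t];
    it passes to the other one, an arbitrary choice, level by level together with the equality of
    the determinants.

    That the operator determines its kernels rests on slices: [<.>_j] integrates over the slice of
    dimension [j] of the cube through [k], these slices are nested, and each one is null in the
    next. A continuous test function can therefore vanish on the smaller slices and still detect the
    kernel on the next one.

    Operators act on representatives, and the section of a square integrable function through [k] is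
    integrable for almost every [k] only. Operator identities thus hold almost everywhere, whereas
    those between continuous functions are upgraded to every point of the cube. *)

Section linear_algebra.
Variable F : fieldType.

(** Over [{poly F}] the determinants of [1 - 'X W] and [1 + 'X W] have product
    [\det (1 - 'X^2 W^2) = 1]. The first one is thus a unit of [{poly F}], that is a constant, and
    its values at 1 and at 0 coincide. *)
Lemma det_1sub_sqr0 n (W : 'M[F]_n) : W *m W = 0 -> \det (1%:M - W) = 1.
Proof.
move=> WW.
pose V : 'M[{poly F}]_n := 'X *: map_mx polyC W.
have VV : V *m V = 0.
  by rewrite /V -scalemxAl -scalemxAr -map_mxM WW map_mx0 !scaler0.
have dd : \det (1%:M - V) * \det (1%:M + V) = 1.
  rewrite -det_mulmx mulmxDr mulmx1 mulmxBl mul1mx VV subr0 subrK.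
  exact: det1.
have /size_poly1P[c c0 dc] : size (\det (1%:M - V)) == 1.
  have d0 : \det (1%:M - V) * \det (1%:M + V) != 0 by rewrite dd oner_neq0.
  have := congr1 (size \o val) dd; rewrite /= size_poly1 size_mul; last 2 first.
  - by apply: contraNneq d0 => ->; rewrite mul0r.
  - by apply: contraNneq d0 => ->; rewrite mulr0.
  move: d0; rewrite mulf_eq0 negb_or -!size_poly_gt0 => /andP[].
  by case: (size _) => [//|[|m]] _; case: (size _) => [//|k] _; rewrite ?addSn ?addnS.
have ev x : (\det (1%:M - V)).[x] = \det (1%:M - x *: W).
  rewrite -[LHS]/(horner_eval x _) -det_map_mx map_mxB map_mx1.
  congr (\det (_ - _)); apply/matrixP => i j.
  by rewrite !mxE [LHS]hornerM hornerX hornerC.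
by rewrite -[W in LHS]scale1r -ev dc hornerC -[c](hornerC c 0) -dc ev scale0r subr0 det1.
Qed.

(* With [X = [[1 + D, G], [0, 1]]] and [W = [[D, G], [-G', -D']]] one has
   [X - W = [[1, 0], [G', 1 + D']]], [X *m W = W] and [W *m W = 0]. *)
Lemma det_1add_intertwined m m' (D : 'M[F]_m) (G : 'M[F]_(m, m'))
    (G' : 'M[F]_(m', m)) (D' : 'M[F]_m') :
  D *m D = G *m G' -> D *m G = G *m D' -> G' *m D = D' *m G' ->
  D' *m D' = G' *m G -> \det (1%:M + D) = \det (1%:M + D').
Proof.
move=> DD DG GD DD'.
pose X := block_mx (1%:M + D) G 0 1%:M.
pose W := block_mx D G (- G') (- D').
have XW : X *m W = W.
  by rewrite mulmx_block !mul1mx !mul0mx !add0r !mulmxDl !mul1mx !mulmxN DD DG !addrK.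
have WW : W *m W = 0.
  rewrite mulmx_block !mulNmx !mulmxN !opprK DD DG GD DD' !subrr [- _ + _]addrC.
  by rewrite [- _ + _]addrC !subrr block_mx0.
have XB : X - W = block_mx 1%:M 0 G' (1%:M + D').
  by rewrite opp_block_mx add_block_mx !opprK !addrK subrr add0r.
have <- : \det X = \det (1%:M + D) by rewrite det_ublock det1 mulr1.
have <- : \det (X - W) = \det (1%:M + D') by rewrite XB det_lblock det1 mul1r.
by rewrite (_ : X - W = X *m (1%:M - W)) ?det_mulmx ?det_1sub_sqr0 ?mulr1// mulmxBr mulmx1 XW.
Qed.

(** Write [E = 1 + D] and [E' = 1 + D']. From [G' D = D' G'] comes [G' E^-1 = E'^-1 G']. Expanding
    [E^-1 = 1 - D E^-1] turns [A E^-1 B] into [A B - A' E'^-1 G' B]; then [G' B = D' B'] and the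
    mirrored expansion of [E'^-1] close the computation. *)
Lemma resolvent_intertwined p q m m' (D : 'M[F]_m)
    (G' : 'M[F]_(m', m)) (D' : 'M[F]_m')
    (A : 'M[F]_(p, m)) (B : 'M[F]_(m, q)) (A' : 'M[F]_(p, m')) (B' : 'M[F]_(m', q)) :
  1%:M + D \in unitmx -> 1%:M + D' \in unitmx ->
  G' *m D = D' *m G' -> A *m D = A' *m G' -> G' *m B = D' *m B' ->
  A *m B = A' *m B' ->
  A *m invmx (1%:M + D) *m B = A' *m invmx (1%:M + D') *m B'.
Proof.
set E := 1%:M + D; set E' := 1%:M + D' => Eu Eu' GD AD GB AB.
have GE : G' *m invmx E = invmx E' *m G'.
  have e : E' *m G' = G' *m E by rewrite mulmxDl mulmxDr mul1mx mulmx1 GD.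
  by rewrite -{1}[G'](mulKmx Eu') e mulmxA mulmxK.
have invE n (Z : 'M[F]_n) : 1%:M + Z \in unitmx ->
    invmx (1%:M + Z) = 1%:M - Z *m invmx (1%:M + Z).
  by move=> u; have := mulmxV u; rewrite {1}mulmxDl mul1mx => /(canRL (addrK _)).
have invE' n (Z : 'M[F]_n) : 1%:M + Z \in unitmx ->
    invmx (1%:M + Z) = 1%:M - invmx (1%:M + Z) *m Z.
  by move=> u; have := mulVmx u; rewrite mulmxDr mulmx1 => /(canRL (addrK _)).
rewrite (invE _ D Eu) -/E mulmxBr mulmx1 mulmxBl mulmxA AD -[A' *m G' *m _]mulmxA GE.
rewrite -!mulmxA GB [in RHS](invE' _ D' Eu') -/E' mulmxBl mul1mx mulmxBr AB.
by rewrite -!mulmxA.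
Qed.

End linear_algebra.

(** * Uniformly continuous functions on the cube *)

Section complex_modulus.
Variable R : realType.
Implicit Types z w : Cplx R.

Lemma normr_cabs z : `|z| = (cabs z)%:C%C :> Cplx R. Proof. by []. Qed.

Lemma cabs_ge0 z : 0 <= cabs z.
Proof. by case: z => a b; exact: sqrtr_ge0. Qed.

Lemma cabsM z w : cabs (z * w) = cabs z * cabs w.
Proof. exact: Normc.normcM. Qed.

Lemma cabsD z w : cabs (z + w) <= cabs z + cabs w.
Proof. exact: le_normcD. Qed.

Lemma cabsN z : cabs (- z) = cabs z.
Proof. exact: normcN. Qed.

Lemma cabsC z w : cabs (z - w) = cabs (w - z).
Proof. by rewrite -cabsN opprB. Qed.

Lemma cabs0 : cabs (0 : Cplx R) = 0.
Proof. exact: Normc.normc0. Qed.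

Lemma cabs1 : cabs (1 : Cplx R) = 1.
Proof. exact: Normc.normc1. Qed.

Lemma cabs0_eq0 z : cabs z = 0 -> z = 0.
Proof. exact: Normc.eq0_normc. Qed.

Lemma cabsV z : cabs z^-1 = (cabs z)^-1.
Proof. exact: Normc.normcV. Qed.

Lemma cabs_gt0 z : (0 < cabs z) = (z != 0).
Proof.
rewrite lt_neqAle cabs_ge0 andbT eq_sym.
by apply/idP/idP; apply: contraNN => /eqP; [move=> ->; rewrite cabs0|move/cabs0_eq0/eqP].
Qed.

Lemma cabs_sqr z : cabs z ^+ 2 = complex.Re z ^+ 2 + complex.Im z ^+ 2.
Proof. by case: z => a b; rewrite /cabs /= sqr_sqrtr// addr_ge0// sqr_ge0. Qed.

Lemma normr_Re_le z : `|complex.Re z| <= cabs z.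
Proof.
rewrite -(@ler_pXn2r _ 2)// ?nnegrE ?cabs_ge0// cabs_sqr real_normK ?num_real//.
by rewrite lerDl sqr_ge0.
Qed.

Lemma normr_Im_le z : `|complex.Im z| <= cabs z.
Proof.
rewrite -(@ler_pXn2r _ 2)// ?nnegrE ?cabs_ge0// cabs_sqr real_normK ?num_real//.
by rewrite lerDr sqr_ge0.
Qed.

Lemma cabs_leD z : cabs z <= `|complex.Re z| + `|complex.Im z|.
Proof.
rewrite -(@ler_pXn2r _ 2)// ?nnegrE ?cabs_ge0 ?addr_ge0//.
rewrite cabs_sqr sqrrD !real_normK ?num_real// addrAC lerDl.
by rewrite mulrn_wge0 ?mulr_ge0.
Qed.

Lemma cabs_sum I (r : seq I) (P : pred I) (F : I -> Cplx R) :
  cabs (\sum_(i <- r | P i) F i) <= \sum_(i <- r | P i) cabs (F i).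
Proof.
elim/big_rec2: _ => [|i x z _ h]; first by rewrite cabs0.
by apply: le_trans (cabsD _ _) _; rewrite lerD2l.
Qed.

Lemma cReD z w : complex.Re (z + w) = complex.Re z + complex.Re w.
Proof. by case: z w => a b []. Qed.

Lemma cImD z w : complex.Im (z + w) = complex.Im z + complex.Im w.
Proof. by case: z w => a b []. Qed.

Lemma cReN z : complex.Re (- z) = - complex.Re z.
Proof. by case: z. Qed.

Lemma cImN z : complex.Im (- z) = - complex.Im z.
Proof. by case: z. Qed.

Lemma cReM z w : complex.Re (z * w) =
  complex.Re z * complex.Re w - complex.Im z * complex.Im w.
Proof. by case: z w => a b []. Qed.

Lemma cImM z w : complex.Im (z * w) =
  complex.Re z * complex.Im w + complex.Im z * complex.Re w.
Proof. by case: z w => a b []. Qed.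

End complex_modulus.

Section uniform_continuity.
Variable R : realType.
Local Notation C := (Cplx R).

Definition near_pt n (d : R) (x y : pt R n) :=
  forall i, `|(tnth x i : R) - tnth y i| < d.

(** Continuity on the cube with one radius, measured coordinatewise. The same radius then serves
    every slice, which is why averages of continuous functions are continuous. *)
Definition ucont n (f : pt R n -> C) := forall e : R, 0 < e ->
  exists2 d : R, 0 < d &
    forall x y, cube R n x -> cube R n y -> near_pt d x y -> cabs (f x - f y) < e.

Lemma compact_cube_rV n :
  compact [set x : 'rV[R]_n | cube R n [tuple x ord0 i | i < n]].
Proof.
rewrite (_ : mkset _ = [set v : 'rV[R]_n | forall i, `[0, 1]%classic (v ord0 i)]).
  by apply: (@rV_compact R n (fun=> `[0, 1]%classic)) => i; exact: segment_compact.
apply/seteqP; split => x /= h i; have := h i; rewrite tnth_mktuple /= in_itv//=.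
Qed.

Lemma tuple_of_row n (x : pt R n) :
  [tuple (\row_i (tnth x i : R)) ord0 i | i < n] = x.
Proof. by apply: eq_from_tnth => i; rewrite tnth_mktuple mxE. Qed.

Lemma ballC_cabs (z w : C) (e : R) : 0 < e -> (`|z - w| < (e%:C)%C) = (cabs (z - w) < e).
Proof. by move=> e0; rewrite normr_cabs ltcR. Qed.

(** From left to right this is Heine's theorem: compactness in its near-covering form replaces the
    radii that depend on the point by a single one. *)
Lemma cont_cubeP n (f : pt R n -> C) : cont_cube f <-> ucont f.
Proof.
split.
  move=> cf e e0.
  pose A := [set x : 'rV[R]_n | cube R n [tuple x ord0 i | i < n]] : set 'rV[R]_n.
  pose g (x : 'rV[R]_n) := f [tuple x ord0 i | i < n].
  have /compact_near_coveringP cA : compact A := @compact_cube_rV n.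
  have := cA R (0^'+) (fun d x => A x -> forall y, A y -> (forall i, `|x ord0 i - y ord0 i| < d) ->
     cabs (g x - g y) < e) _.
  have h : forall x, A x -> \forall x' \near x & d \near 0^'+, A x' ->
      forall y, A y -> (forall i, `|x' ord0 i - y ord0 i| < d) -> cabs (g x' - g y) < e.
    move=> x Ax.
    have /subspace_continuousP/(_ x Ax) := cf.
    have e2 : 0 < ((e / 2)%:C)%C :> C by rewrite ltcR divr_gt0.
    move=> /cvgrPdist_lt/(_ _ e2); rewrite /within /=.
    move=> /nbhs_ballP[d /= d0 hd].
    (* Half of the radius [d] is spent between [x] and [x'], half between [x'] and [y]; both points
       then lie in the ball around [x] where [g] stays within [e / 2] of [g x]. *)
    exists (ball x (d / 2), [set r | r < d / 2]).
      split => /=; first by apply: nbhsx_ballx; rewrite divr_gt0.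
      by apply: nbhs_right_lt; rewrite divr_gt0.
    move=> [x' r] /= [xx' rd] Ax' y Ay xy.
    have h1 := hd x' _ Ax'; have h2 := hd y _ Ay.
    have {h1} : cabs (g x - g x') < e / 2.
      rewrite -ballC_cabs ?divr_gt0//; apply: h1.
      by apply: le_ball xx'; rewrite ler_pdivrMr// ler_peMr// ?ler1n// ltW.
    have {h2} : cabs (g x - g y) < e / 2.
      rewrite -ballC_cabs ?divr_gt0//; apply: h2.
      case: xx' => _ xx'; split => // i j; rewrite (ord1 i).
      rewrite -ball_normE /ball_ /=; have := xx' ord0 j; have := xy j.
      rewrite -ball_normE /ball_ /= => a b.
      rewrite -(subrKA (x' ord0 j)) (splitr d).
      by apply: le_lt_trans (ler_normD _ _) _; apply: ltrD => //; apply: lt_trans a rd.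
    move=> b a; rewrite -(subrKA (g x)) (splitr e).
    by apply: le_lt_trans (cabsD _ _) _; apply: ltrD => //; rewrite cabsC.
  move=> /(_ _ h) [d /= d0 hd].
  exists (d / 2); first by rewrite divr_gt0.
  move=> x y Qx Qy xy.
  have := hd (d / 2) _ _ (\row_i (tnth x i : R)) _ _ (\row_i (tnth y i : R)) _ _.
  rewrite /g /A /= !tuple_of_row; apply => //.
  - by rewrite /= sub0r normrN gtr0_norm ?divr_gt0// ltr_pdivrMr// ltr_pMr// ltr1n.
  - by rewrite divr_gt0.
  - by move=> i; rewrite !mxE.
move=> uf; apply/subspace_continuousP => x /= Qx.
apply: (@cvgrPdist_lt _ C _ _ _ _ _).2 => e e0.
(* Radii of balls in [C] are themselves elements of [C]; a positive one is real. *)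
have /complex_realP[r re] : e \is Num.real by rewrite realE ltW.
have r0 : 0 < r by move: e0; rewrite re ltcR.
have [d d0 hd] := uf r r0.
rewrite /within /=; apply/nbhs_ballP; exists d => //= y [_ xy] Qy.
rewrite re ballC_cabs//; apply: hd => // i; rewrite !tnth_mktuple.
by have := xy ord0 i; rewrite -ball_normE.
Qed.

End uniform_continuity.

Section ucont_theory.
Variables (R : realType) (n : nat).
Local Notation C := (Cplx R).
Implicit Types f g : pt R n -> C.

Lemma ucont_eq f g : (forall x, cube R n x -> f x = g x) -> ucont f -> ucont g.
Proof.
move=> fg uf e /uf[d d0 h]; exists d => // x y Qx Qy xy.
by rewrite -!fg//; exact: h.
Qed.

Lemma ucont_cst (c : C) : ucont (fun _ : pt R n => c).
Proof. by move=> e e0; exists 1 => // x y _ _ _; rewrite subrr cabs0. Qed.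

Lemma near_pt_min (d d' : R) x y : near_pt (n := n) (Num.min d d') x y ->
  near_pt d x y /\ near_pt d' x y.
Proof.
by move=> h; split=> i; apply: lt_le_trans (h i) _; rewrite ge_min lexx ?orbT.
Qed.

Lemma ucontD f g : ucont f -> ucont g -> ucont (fun x => f x + g x).
Proof.
move=> uf ug e e0.
have e2 : 0 < e / 2 by rewrite divr_gt0.
have [d d0 hd] := uf _ e2; have [d' d'0 hd'] := ug _ e2.
exists (Num.min d d'); first by rewrite lt_min d0.
move=> x y Qx Qy /near_pt_min[xy xy'].
rewrite opprD addrACA (splitr e).
by apply: le_lt_trans (cabsD _ _) _; apply: ltrD; [exact: hd|exact: hd'].
Qed.

Lemma ucontN f : ucont f -> ucont (fun x => - f x).
Proof.
move=> uf e /uf[d d0 h]; exists d => // x y Qx Qy xy.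
by rewrite -opprD cabsN; exact: h.
Qed.

Lemma ucontB f g : ucont f -> ucont g -> ucont (fun x => f x - g x).
Proof. by move=> uf /ucontN; exact: ucontD. Qed.

(** The cube is star-shaped about the origin: [x] is reached from 0 in [m] steps along a segment.
    With [m > d^-1] each step moves every coordinate by less than [d], hence changes [f] by less
    than 1. *)
Lemma ucont_bounded f : ucont f ->
  exists2 c : R, 0 < c & forall x, cube R n x -> cabs (f x) <= c.
Proof.
move=> uf; have [d d0 hd] := uf 1 ltr01.
pose m := (Num.truncn d^-1).+1.
have m0 : 0 < m%:R :> R by rewrite ltr0n.
have md : m%:R^-1 < d.
  by rewrite -[d]invrK ltf_pV2 ?posrE ?invr_gt0//; exact: truncnS_gt.
pose p (x : pt R n) (i : nat) : pt R n := [tuple (tnth x j : R) * (i%:R / m%:R) | j < n].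
have Qp x i : cube R n x -> (i <= m)%N -> cube R n (p x i).
  move=> Qx im j; rewrite tnth_mktuple; have /andP[x0 x1] := Qx j.
  have i1 : i%:R / m%:R <= 1 :> R by rewrite ler_pdivrMr// mul1r ler_nat.
  have i0 : 0 <= i%:R / m%:R :> R by rewrite divr_ge0.
  by rewrite mulr_ge0//= mulr_ile1.
have step x i : cube R n x -> (i <= m)%N -> cabs (f (p x i) - f (p x 0%N)) <= i%:R.
  move=> Qx; elim: i => [|i ih im]; first by rewrite subrr cabs0.
  rewrite -(subrKA (f (p x i))) -natr1 addrC.
  apply: le_trans (cabsD _ _) _; apply: lerD; last first.
    apply/ltW/hd; [exact: Qp|by apply: Qp => //; exact: ltnW|].
    move=> j; rewrite !tnth_mktuple -mulrBr -mulrBl -natr1 [_ + 1 - _]addrAC subrr add0r div1r.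
    have /andP[x0 x1] := Qx j.
    rewrite normrM (ger0_norm x0) ger0_norm ?invr_ge0 ?ler0n//.
    by apply: le_lt_trans md; rewrite ler_piMl// invr_ge0 ler0n.
  by apply: ih; exact: ltnW.
exists (m%:R + cabs (f [tuple 0 | j < n])); first by rewrite ltr_pwDl// cabs_ge0.
move=> x Qx; have := step x m Qx (leqnn _).
have -> : p x m = x.
  by apply: eq_from_tnth => i; rewrite tnth_mktuple divff ?mulr1// gt_eqF.
have -> : p x 0%N = [tuple 0 | j < n].
  by apply: eq_from_tnth => i; rewrite !tnth_mktuple mul0r mulr0.
move=> h; rewrite -[f x](subrK (f [tuple 0 | j < n])).
by apply: le_trans (cabsD _ _) _; rewrite lerD2r.
Qed.

Lemma ucontM f g : ucont f -> ucont g -> ucont (fun x => f x * g x).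
Proof.
move=> uf ug e e0.
have [b b0 hb] := ucont_bounded uf; have [c c0 hc] := ucont_bounded ug.
have [d d0 hd] := uf (e / 2 / c) (divr_gt0 (divr_gt0 e0 (ltr0Sn R 1)) c0).
have [d' d'0 hd'] := ug (e / 2 / b) (divr_gt0 (divr_gt0 e0 (ltr0Sn R 1)) b0).
exists (Num.min d d'); first by rewrite lt_min d0.
move=> x y Qx Qy /near_pt_min[xy xy'].
have -> : f x * g x - f y * g y = f x * (g x - g y) + g y * (f x - f y) by ring.
rewrite (splitr e); apply: le_lt_trans (cabsD _ _) _; rewrite !cabsM.
apply: ltrD.
  apply: le_lt_trans (ler_wpM2r (cabs_ge0 _) (hb x Qx)) _.
  by rewrite mulrC -ltr_pdivlMr//; exact: hd'.
apply: le_lt_trans (ler_wpM2r (cabs_ge0 _) (hc y Qy)) _.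
by rewrite mulrC -ltr_pdivlMr//; exact: hd.
Qed.

Lemma ucontZ (c : C) f : ucont f -> ucont (fun x => c * f x).
Proof. by apply: ucontM; exact: ucont_cst. Qed.

Lemma ucontV f (c : R) : 0 < c -> (forall x, cube R n x -> c <= cabs (f x)) ->
  ucont f -> ucont (fun x => (f x)^-1).
Proof.
move=> c0 hc uf e e0.
have [d d0 hd] := uf (e * c ^+ 2) (mulr_gt0 e0 (exprn_gt0 _ c0)).
exists d => // x y Qx Qy xy.
have fx0 : 0 < cabs (f x) by exact: lt_le_trans (hc x Qx).
have fy0 : 0 < cabs (f y) by exact: lt_le_trans (hc y Qy).
have fx : f x != 0 by rewrite -cabs_gt0.
have fy : f y != 0 by rewrite -cabs_gt0.
have -> : (f x)^-1 - (f y)^-1 = (f y - f x) / (f x * f y) by field; rewrite fx fy.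
rewrite cabsM cabsV cabsM ltr_pdivrMr ?mulr_gt0// cabsC.
apply: lt_le_trans (hd x y Qx Qy xy) _.
rewrite ler_pM2l// expr2.
by apply: ler_pM; rewrite ?(ltW c0)//; exact: hc.
Qed.

Lemma ucont_conj f : ucont f -> ucont (fun x => (f x)^*%C).
Proof.
move=> uf e /uf[d d0 h]; exists d => // x y Qx Qy xy.
have := h x y Qx Qy xy.
case: (f x) (f y) => a b [a' b'] /=; rewrite /cabs /=.
by rewrite -opprD sqrrN.
Qed.

Lemma ucont_tnth (i : 'I_n) : ucont (fun x => ((tnth x i : R)%:C)%C).
Proof.
move=> e e0; exists e => // x y _ _ /(_ i) xy.
by rewrite -rmorphB /cabs /= expr0n addr0 sqrtr_sqr.
Qed.

Lemma ucont_sum I (r : seq I) (P : pred I) (F : I -> pt R n -> C) :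
  (forall i, P i -> ucont (F i)) -> ucont (fun x => \sum_(i <- r | P i) F i x).
Proof.
move=> uF; elim: r => [|i r ih].
  by apply: ucont_eq (ucont_cst 0) => x _; rewrite big_nil.
case Pi : (P i).
  by apply: ucont_eq (ucontD (uF i Pi) ih) => x _; rewrite big_cons Pi.
by apply: ucont_eq ih => x _; rewrite big_cons Pi.
Qed.

Lemma ucont_prod I (r : seq I) (P : pred I) (F : I -> pt R n -> C) :
  (forall i, P i -> ucont (F i)) -> ucont (fun x => \prod_(i <- r | P i) F i x).
Proof.
move=> uF; elim: r => [|i r ih].
  by apply: ucont_eq (ucont_cst 1) => x _; rewrite big_nil.
case Pi : (P i).
  by apply: ucont_eq (ucontM (uF i Pi) ih) => x _; rewrite big_cons Pi.
by apply: ucont_eq ih => x _; rewrite big_cons Pi.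
Qed.

Definition ucmx p q (F : pt R n -> 'M[C]_(p, q)) :=
  forall a b, ucont (fun x => F x a b).

Lemma ucmxD p q (F G : pt R n -> 'M[C]_(p, q)) :
  ucmx F -> ucmx G -> ucmx (fun x => F x + G x).
Proof. by move=> uF uG a b; apply: ucont_eq (ucontD (uF a b) (uG a b)) => x _; rewrite mxE. Qed.

Lemma ucmxN p q (F : pt R n -> 'M[C]_(p, q)) : ucmx F -> ucmx (fun x => - F x).
Proof. by move=> uF a b; apply: ucont_eq (ucontN (uF a b)) => x _; rewrite mxE. Qed.

Lemma ucmxZ p q (c : C) (F : pt R n -> 'M[C]_(p, q)) : ucmx F -> ucmx (fun x => c *: F x).
Proof. by move=> uF a b; apply: ucont_eq (ucontZ c (uF a b)) => x _; rewrite mxE. Qed.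

Lemma ucmx_cst p q (A : 'M[C]_(p, q)) : ucmx (fun=> A).
Proof. by move=> a b; exact: ucont_cst. Qed.

Lemma ucmx_sum p q I (r : seq I) (P : pred I) (F : I -> pt R n -> 'M[C]_(p, q)) :
  (forall i, P i -> ucmx (F i)) -> ucmx (fun x => \sum_(i <- r | P i) F i x).
Proof.
move=> uF a b.
apply: (ucont_eq (f := fun x => \sum_(i <- r | P i) F i x a b)) => [x _|].
  by rewrite summxE.
by apply: ucont_sum => i Pi; exact: uF.
Qed.

Lemma ucmxM p q r (F : pt R n -> 'M[C]_(p, q)) (G : pt R n -> 'M[C]_(q, r)) :
  ucmx F -> ucmx G -> ucmx (fun x => F x *m G x).
Proof.
move=> uF uG a b.
apply: (ucont_eq (f := fun x => \sum_j F x a j * G x j b)) => [x _|].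
  by rewrite mxE.
by apply: ucont_sum => i _; apply: ucontM; [exact: uF|exact: uG].
Qed.

Lemma ucont_det p (F : pt R n -> 'M[C]_p) : ucmx F -> ucont (fun x => \det (F x)).
Proof.
move=> uF; apply: ucont_sum => s _; apply: ucontZ.
by apply: ucont_prod => i _; exact: uF.
Qed.

Lemma ucont_tr p (F : pt R n -> 'M[C]_p) : ucmx F -> ucont (fun x => \tr (F x)).
Proof. by move=> uF; apply: ucont_sum => i _; exact: uF. Qed.

(** Cramer's rule; the bound on the determinant rules out the default value [invmx A = A] of a
    singular matrix. *)
Lemma ucmx_inv p (F : pt R n -> 'M[C]_p) (c : R) : 0 < c ->
  (forall x, cube R n x -> c <= cabs (\det (F x))) ->
  ucmx F -> ucmx (fun x => invmx (F x)).
Proof.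
move=> c0 hc uF a b.
apply: (ucont_eq (f := fun x => (\det (F x))^-1 * \adj (F x) a b)) => [x Qx|].
  rewrite /invmx unitmxE unitfE -cabs_gt0 (lt_le_trans c0 (hc x Qx)).
  by rewrite !mxE.
apply: ucontM; first exact: (ucontV c0 hc (ucont_det uF)).
apply: (ucont_eq (f := fun x => cofactor (F x) b a)) => [x _|]; first by rewrite mxE.
apply: ucontZ; apply: ucont_det => i j.
by apply: ucont_eq (uF (lift b i) (lift a j)) => x _; rewrite !mxE.
Qed.

End ucont_theory.

(** * Measurability of uniformly continuous functions *)

Section measurability.
Variables (R : realType) (n : nat).

Lemma measurable_cube : measurable (cube R n).
Proof.
rewrite (_ : cube R n = \bigcap_(i in [set: 'I_n])
    ((fun x : pt R n => tnth x i) @^-1` `[0, 1]%classic)).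
  apply: fin_bigcap_measurable => // i _.
  rewrite -[X in measurable X]setTI; apply: measurable_tnth => //.
apply/seteqP; split => x /= h; first by move=> i _ /=; have := h i; rewrite in_itv.
by move=> i; have := h i Logic.I; rewrite /= in_itv.
Qed.

(** Rounding every coordinate down to a multiple of [m.+1%:R^-1] turns [g] into a function with
    finitely many values, constant on boxes that are measurable for the product sigma-algebra. These
    functions converge to [g] pointwise. *)
Lemma measurable_unif_continuous (g : pt R n -> R) :
  (forall e : R, 0 < e -> exists2 d : R, 0 < d &
    forall x y, cube R n x -> cube R n y -> near_pt d x y -> `|g x - g y| < e) ->
  measurable_fun (cube R n) g.
Proof.
move=> ug.
pose disc (m : nat) (x : pt R n) : pt R n :=
  [tuple (Num.truncn ((tnth x i : R) * m.+1%:R))%:R / m.+1%:R | i < n].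
have Qdisc m x : cube R n x -> cube R n (disc m x).
  move=> Qx i; rewrite tnth_mktuple; have /andP[x0 x1] := Qx i.
  rewrite divr_ge0//= ler_pdivrMr// mul1r ler_nat.
  by rewrite -ltnS truncn_lt_nat ?mulr_ge0// -[m.+2%:R]natr1 ltr_pwDr// ler_piMl.
have xdisc m x : cube R n x -> near_pt (m.+1%:R^-1) x (disc m x).
  move=> Qx i; rewrite tnth_mktuple; have /andP[x0 x1] := Qx i.
  have := truncn_itv (mulr_ge0 x0 (ler0n R m.+1)).
  set k := Num.truncn _ => /andP[kx xk].
  have m0 : 0 < m.+1%:R :> R by rewrite ltr0n.
  rewrite ger0_norm ?subr_ge0 ?ler_pdivrMr//.
  rewrite ltrBlDr (_ : _ + _ = (1 + k%:R) / m.+1%:R); last by rewrite mulrDl div1r.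
  rewrite ltr_pdivlMr//.
  by move: xk; rewrite -[k.+1%:R]natr1 [k%:R + 1]addrC.
apply: (@measurable_fun_cvg _ _ R _ (fun m x => g (disc m x)) g) => [m|x Qx].
  move=> _ Y _.
  (* A rounded coordinate has [m.+2] possible values, since the coordinate 1 gives the numerator
     [m.+1]. *)
  pose cell (h : {ffun 'I_n -> 'I_m.+2}) := cube R n `&` \bigcap_(i in [set: 'I_n])
    ((fun x : pt R n => tnth x i) @^-1` `[(h i)%:R / m.+1%:R, (h i).+1%:R / m.+1%:R[%classic).
  rewrite (_ : _ `&` _ = \bigcup_(h in [set h : {ffun 'I_n -> 'I_m.+2} |
       Y (g [tuple (h i)%:R / m.+1%:R | i < n])]) cell h).
    apply: fin_bigcup_measurable => // h _; apply: measurableI; first exact: measurable_cube.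
    apply: fin_bigcap_measurable => // i _.
    rewrite -[X in measurable X]setTI; apply: measurable_tnth => //.
  have m0 : 0 < m.+1%:R :> R by rewrite ltr0n.
  apply/seteqP; split => [x /= [Qx Yx]|x [h /= Yh [Qx cx]]].
    have hx i : (Num.truncn ((tnth x i : R) * m.+1%:R) < m.+2)%N.
      have /andP[x0 x1] := Qx i.
      by rewrite truncn_lt_nat ?mulr_ge0// -[m.+2%:R]natr1 ltr_pwDr// ler_piMl.
    exists [ffun i => Ordinal (hx i)] => /=.
      rewrite (_ : [tuple _ | i < n] = disc m x)//.
      by apply: eq_from_tnth => i; rewrite !tnth_mktuple ffunE.
    split=> // i _ /=; rewrite ffunE /= in_itv /=.
    have /andP[x0 x1] := Qx i.
    have := truncn_itv (mulr_ge0 x0 (ler0n R m.+1)).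
    by rewrite ler_pdivrMr// ltr_pdivlMr.
  split => //; rewrite /preimage /= (_ : disc m x = [tuple (h i)%:R / m.+1%:R | i < n])//.
  apply: eq_from_tnth => i; rewrite !tnth_mktuple; congr (_%:R / _).
  apply: truncn_def; have := cx i Logic.I; rewrite /= in_itv /=.
  by rewrite ler_pdivrMr// ltr_pdivlMr.
apply/cvgrPdist_lt => e e0; have [d d0 hd] := ug e e0.
have : \forall m \near \oo, m.+1%:R^-1 < d.
  have /cvgrPdist_lt/(_ d d0) := @cvg_harmonic R.
  apply: filterS => m; rewrite sub0r normrN ger0_norm//.
  by rewrite /harmonic invr_ge0.
apply: filterS => m md; apply: hd => //; first exact: Qdisc.
by move=> i; apply: lt_trans md; exact: xdisc.
Qed.

Lemma ucont_measurable (f : pt R n -> Cplx R) : ucont f ->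
  measurable_fun (cube R n) (fun x => complex.Re (f x)) /\
  measurable_fun (cube R n) (fun x => complex.Im (f x)).
Proof.
move=> uf; split; apply: measurable_unif_continuous => e /uf[d d0 hd];
    exists d => // x y Qx Qy xy; apply: le_lt_trans (hd x y Qx Qy xy).
  by rewrite -cReN -cReD; exact: normr_Re_le.
by rewrite -cImN -cImD; exact: normr_Im_le.
Qed.

End measurability.

(** * Lebesgue measure on the cube *)

Section tonelli_on_rectangles.
Local Open Scope ereal_scope.
Context d1 d2 (T1 : measurableType d1) (T2 : measurableType d2) (R : realType).
Variables (m1 : {sigma_finite_measure set T1 -> \bar R})
          (m2 : {sigma_finite_measure set T2 -> \bar R}).
Variables (D1 : set T1) (D2 : set T2) (f : T1 * T2 -> \bar R).
Hypotheses (mD1 : measurable D1) (mD2 : measurable D2).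
Hypothesis mf : measurable_fun (D1 `*` D2) f.
Hypothesis f0 : forall x y, D1 x -> D2 y -> (0 <= f (x, y))%E.

(** Tonelli's theorem is applied to this extension by zero; [Fg] and [Gg] say that its partial
    integrals are the extensions by zero of those of [f]. *)
Let g := f \_ (D1 `*` D2).

Let mg : measurable_fun setT g.
Proof. by apply/(measurable_restrictT f (measurableX mD1 mD2)). Qed.

Let g0 z : (0 <= g z)%E.
Proof.
by case: z => x y; rewrite /g patchE; case: ifPn => // /set_mem[/= ? ?]; exact: f0.
Qed.

Let gE x y : g (x, y) = ((fun x => ((fun y => f (x, y)) \_ D2) y) \_ D1) x.
Proof.
rewrite /g !patchE /=; case: (pselect (D1 x)) => h1; last first.
  by rewrite !memNset//= => -[].
case: (pselect (D2 y)) => h2; last first.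
  by rewrite [in LHS]memNset 1?mem_set 1?memNset//= => -[].
by rewrite !mem_set.
Qed.

Let Fg x : \int[m2]_y g (x, y) = ((fun x => \int[m2]_(y in D2) f (x, y)) \_ D1) x.
Proof.
under eq_integral do rewrite gE.
rewrite patchE; case: ifPn => xD; last first.
  by rewrite integral0_eq// => y _; rewrite patchE (negbTE xD).
by rewrite [RHS]integral_mkcond; apply: eq_integral => y _; rewrite patchE xD.
Qed.

Let Gg y : \int[m1]_x g (x, y) = ((fun y => \int[m1]_(x in D1) f (x, y)) \_ D2) y.
Proof.
under eq_integral do rewrite gE.
rewrite patchE; case: ifPn => yD; last first.
  rewrite integral0_eq// => x _; rewrite patchE; case: ifP => // _.
  by rewrite patchE (negbTE yD).
rewrite [RHS]integral_mkcond; apply: eq_integral => x _; rewrite !patchE.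
by case: ifP => // _; rewrite yD.
Qed.

Lemma measurable_section_integral :
  measurable_fun D1 (fun x => \int[m2]_(y in D2) f (x, y)).
Proof.
apply/(measurable_restrictT _ mD1).
rewrite (_ : _ \_ _ = (fun x => \int[m2]_y g (x, y)))//; last first.
  by apply/funext => x; rewrite Fg.
exact: (measurable_fun_fubini_tonelli_F g).
Qed.

Lemma tonelli_in : (\int[m1 \x m2]_(z in D1 `*` D2) f z =
  \int[m1]_(x in D1) \int[m2]_(y in D2) f (x, y))%E.
Proof.
rewrite integral_mkcond -/g (fubini_tonelli1 g)// [RHS]integral_mkcond.
by apply: eq_integral => x _; rewrite /fubini_F Fg.
Qed.

Lemma tonelli_swap_in : (\int[m1]_(x in D1) \int[m2]_(y in D2) f (x, y) =
  \int[m2]_(y in D2) \int[m1]_(x in D1) f (x, y))%E.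
Proof.
rewrite [LHS]integral_mkcond [RHS]integral_mkcond.
under eq_integral do rewrite -Fg.
under [RHS]eq_integral do rewrite -Gg.
exact: (fubini_tonelli g).
Qed.

End tonelli_on_rectangles.

Section cube_measure.
Variable R : realType.
Local Notation T := (measurableTypeR R).
Local Notation I := (`[0, 1]%classic : set T).

Let mI : measurable I. Proof. exact: (@measurable_itv R). Qed.

Lemma lebesgue_measure_01 : @lebesgue_measure R I = 1%E.
Proof. by rewrite lebesgue_measure_itv /= lte_fin ltr01 oppr0 adde0. Qed.

Lemma cube0 x : cube R 0 x.
Proof. by case. Qed.

Lemma cube_cons n (a : T) (y : pt R n) :
  cube R n.+1 (cons_pt (a, y)) <-> I a /\ cube R n y.
Proof.
rewrite /= in_itv /=; split => [h|[a01 h] i].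
  split; first by have := h ord0.
  by move=> i; have := h (lift ord0 i); rewrite tnthS.
by have [j ->|->//] := unliftP ord0 i; rewrite tnthS.
Qed.

Lemma measurable_cons_pt n : measurable_fun setT (@cons_pt _ T n).
Proof. exact: measurable_cons. Qed.

Lemma measurable_cons_cube d (V : measurableType d) n (f : pt R n.+1 -> V) :
  measurable_fun (cube R n.+1) f ->
  measurable_fun (I `*` cube R n) (f \o @cons_pt _ T n).
Proof.
move=> mf; apply: (@measurable_comp _ _ _ _ _ _ (cube R n.+1)).
- exact: measurable_cube.
- by move=> _ [[a y] [/= ? ?] <-]; apply/cube_cons.
- exact: mf.
- by apply: measurable_funTS; exact: measurable_cons_pt.
Qed.

Lemma integral_cube_cons n (f : pt R n.+1 -> \bar R) :
  measurable_fun (cube R n.+1) f -> (forall x, cube R n.+1 x -> (0 <= f x)%E) ->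
  (\int[leb R n.+1]_(x in cube R n.+1) f x =
   \int[lebesgue_measure]_(a in I) \int[leb R n]_(y in cube R n) f (cons_pt (a, y)))%E.
Proof.
move=> mf f0.
transitivity (\int[pushforward (@lebesgue_measure R \x leb R n)%E (@cons_pt _ T n)]_(x in cube R n.+1) f x)%E.
  by [].
rewrite ge0_integral_pushforward//; last 2 first.
- exact: measurable_cube.
- by move=> x /set_mem; exact: f0.
rewrite (_ : _ @^-1` _ = I `*` cube R n); last first.
  by apply/seteqP; split => -[a y] /cube_cons.
rewrite (tonelli_in (@lebesgue_measure R) (leb R n) mI (@measurable_cube R n))//; first exact: measurable_cons_cube.
by move=> a y Ia Qy; apply: f0; apply/cube_cons.
Qed.

Lemma leb_cube n : leb R n (cube R n) = 1%E.
Proof.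
elim: n => [|n ih].
  by rewrite /= diracE mem_set//; exact: cube0.
have := @integral_cube_cons n (cst 1%E).
rewrite integral_cst ?mul1e//; last exact: measurable_cube.
move=> ->//.
rewrite (eq_integral (cst 1%E)); last first.
  by move=> a _; rewrite [LHS]integral_cst ?mul1e ?ih//; exact: measurable_cube.
by rewrite integral_cst// mul1e; exact: lebesgue_measure_01.
Qed.

Lemma integral_cube_cst n (c : \bar R) : (\int[leb R n]_(x in cube R n) c = c)%E.
Proof.
rewrite [LHS]integral_cst; last exact: measurable_cube.
by rewrite -[RHS]mule1; congr (_ * _)%E; exact: leb_cube.
Qed.

Lemma splice_cons N j (b a : T) (y : pt R j) (k : pt R N) :
  splice (cons_pt (b, y)) (cons_pt (a, k)) = cons_pt (b, splice y k).
Proof.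
apply: eq_from_tnth => i; rewrite tnth_mktuple.
have [l ->|->//] := unliftP ord0 i.
by rewrite !tnthS tnth_mktuple.
Qed.

Lemma splice0 N (y : pt R 0) (k : pt R N) : splice y k = k.
Proof.
apply: eq_from_tnth => i; rewrite tnth_mktuple nth_default// size_tuple.
exact: leq0n.
Qed.

Lemma tnth_splice_lt N j (y : pt R j) (k : pt R N) (i : 'I_N) (ij : (i < j)%N) :
  tnth (splice y k) i = tnth y (Ordinal ij).
Proof. by rewrite tnth_mktuple [RHS](tnth_nth (tnth k i)). Qed.

Lemma tnth_splice_ge N j (y : pt R j) (k : pt R N) (i : 'I_N) : (j <= i)%N ->
  tnth (splice y k) i = tnth k i.
Proof. by move=> ji; rewrite tnth_mktuple nth_default// size_tuple. Qed.

Lemma cube_splice N j (y : pt R j) (k : pt R N) :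
  cube R j y -> cube R N k -> cube R N (splice y k).
Proof.
move=> Qy Qk i; have [ji|ij] := leqP j i; first by rewrite tnth_splice_ge.
by rewrite tnth_splice_lt.
Qed.

Lemma measurable_splice N j :
  measurable_fun setT (fun z : pt R N * pt R j => splice z.2 z.1).
Proof.
apply/measurable_fun_tnthP => i.
have [ji|ij] := leqP j i.
  rewrite (_ : _ \o _ = (fun x => tnth x i) \o fst); last first.
    by apply/funext => z /=; rewrite tnth_splice_ge.
  by apply: measurableT_comp => //; exact: measurable_tnth.
rewrite (_ : _ \o _ = (fun x => tnth x (Ordinal ij)) \o snd); last first.
  by apply/funext => z /=; rewrite tnth_splice_lt.
by apply: measurableT_comp => //; exact: measurable_tnth.
Qed.

Lemma measurable_splice_cube d (V : measurableType d) N j (f : pt R N -> V) :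
  measurable_fun (cube R N) f ->
  measurable_fun (cube R N `*` cube R j) (fun z => f (splice z.2 z.1)).
Proof.
move=> mf; apply: (@measurable_comp _ _ _ _ _ _ (cube R N) f).
- exact: measurable_cube.
- by move=> _ [[a y] [/= ? ?] <-]; exact: cube_splice.
- exact: mf.
- by apply: measurable_funTS; exact: measurable_splice.
Qed.

Lemma measurable_splice_section d (V : measurableType d) N j (f : pt R N -> V) k :
  cube R N k -> measurable_fun (cube R N) f ->
  measurable_fun (cube R j) (fun y => f (splice y k)).
Proof.
move=> Qk mf; apply: (@measurable_comp _ _ _ _ _ _ (cube R N) f).
- exact: measurable_cube.
- by move=> _ [y ? <-]; exact: cube_splice.
- exact: mf.
- apply: measurable_funTS.
  apply: (measurableT_comp (@measurable_splice N j) (g := fun y => (k, y))).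
  exact: measurable_pair1.
Qed.

Lemma measurable_avg_ge0 N j (f : pt R N -> \bar R) :
  measurable_fun (cube R N) f -> (forall x, cube R N x -> (0 <= f x)%E) ->
  measurable_fun (cube R N) (fun k => \int[leb R j]_(y in cube R j) f (splice y k))%E.
Proof.
move=> mf f0.
apply: (measurable_section_integral (leb R j) (@measurable_cube R N)
  (@measurable_cube R j) (measurable_splice_cube mf)).
by move=> x y Qx Qy; apply: f0; exact: cube_splice.
Qed.

(** The coordinates of [k] that [splice] overwrites integrate to 1, the mass of the cube, and the
    new ones take their place. The induction on [N] peels off the first coordinate: [a] is the one
    discarded, [b] the one replacing it. *)
Lemma tonelli_splice N j (f : pt R N -> \bar R) : (j <= N)%N ->
  measurable_fun (cube R N) f -> (forall x, cube R N x -> (0 <= f x)%E) ->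
  (\int[leb R N]_(k in cube R N) \int[leb R j]_(y in cube R j) f (splice y k) =
   \int[leb R N]_(k in cube R N) f k)%E.
Proof.
elim: N j f => [|N ih] [|j] f jN mf f0 //.
- apply: eq_integral => k _.
  under eq_integral do rewrite splice0.
  exact: integral_cube_cst.
- apply: eq_integral => k _.
  under eq_integral do rewrite splice0.
  exact: integral_cube_cst.
rewrite integral_cube_cons; last 2 first.
- exact: measurable_avg_ge0.
- by move=> x Qx; apply: integral_ge0 => y Qy; apply: f0; exact: cube_splice.
pose h (z : pt R N * T) := (\int[leb R j]_(y in cube R j) f (cons_pt (z.2, splice y z.1)))%E.
have mfc b : I b -> measurable_fun (cube R N) (fun k => f (cons_pt (b, k))).
  move=> Ib; apply: (@measurable_comp _ _ _ _ _ _ (I `*` cube R N) (f \o @cons_pt _ T N)).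
  - by apply: measurableX => //; exact: measurable_cube.
  - by move=> _ [k ? <-].
  - exact: measurable_cons_cube.
  - by apply: measurable_funTS; exact: measurable_pair1.
have f0c b k : I b -> cube R N k -> (0 <= f (cons_pt (b, k)))%E.
  by move=> Ib Qk; apply: f0; apply/cube_cons.
transitivity (\int[lebesgue_measure]_(a in I) \int[leb R N]_(k in cube R N)
    \int[lebesgue_measure]_(b in I) h (k, b))%E.
  apply: eq_integral => a /set_mem Ia; apply: eq_integral => k /set_mem Qk.
  have Qak : cube R N.+1 (cons_pt (a, k)) by apply/cube_cons.
  rewrite integral_cube_cons; last 2 first.
  - exact: measurable_splice_section.
  - by move=> x Qx; apply: f0; exact: cube_splice.
  by apply: eq_integral => b _; apply: eq_integral => y _; rewrite splice_cons.
(* The integrand no longer contains [a], whose interval has length 1; what remains is to exchange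
   the integrals over [b] and [k]. *)
rewrite integral_cst// [X in (_ * X)%E](_ : _ = 1%E); last exact: lebesgue_measure_01.
rewrite mule1.
transitivity (\int[lebesgue_measure]_(b in I) \int[leb R N]_(k in cube R N) h (k, b))%E.
  apply: (tonelli_swap_in (leb R N) (@lebesgue_measure R) (@measurable_cube R N) mI (f := h)).
  - rewrite /h.
    apply: (measurable_section_integral (D1 := cube R N `*` I) (leb R j)
      (f := fun w => f (cons_pt (w.1.2, splice w.2 w.1.1)))) => //.
    + by apply: measurableX => //; exact: measurable_cube.
    + exact: measurable_cube.
    + apply: (@measurable_comp _ _ _ _ _ _ (I `*` cube R N) (f \o @cons_pt _ T N)
        _ (fun w => (w.1.2, splice w.2 w.1.1))).
      * by apply: measurableX => //; exact: measurable_cube.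
      * by move=> _ [[[k b] y] [[/= ? ?] ?] <-]; split => //=; exact: cube_splice.
      * exact: measurable_cons_cube.
      * apply: measurable_funTS; apply: measurable_fun_pair => /=.
          by apply: (@measurableT_comp _ _ _ _ _ _ snd).
        apply: (measurableT_comp (@measurable_splice N j)
          (g := fun w : (pt R N * T) * pt R j => (w.1.1, w.2))).
        apply: measurable_fun_pair => //.
        by apply: (@measurableT_comp _ _ _ _ _ _ fst).
    + by move=> [k b] y [/= ? ?] ?; apply: f0c => //; exact: cube_splice.
  - by move=> k b Qk Ib; apply: integral_ge0 => y Qy; apply: f0c => //; exact: cube_splice.
rewrite [RHS]integral_cube_cons//.
apply: eq_integral => b /set_mem Ib; rewrite /h /=.
by apply: (ih j (fun k => f (cons_pt (b, k)))) => // [|x Qx]; [exact: mfc|exact: f0c].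
Qed.

End cube_measure.

(** * Properties that hold almost everywhere on the cube *)

Section null_sets.
Variables (R : realType).
Local Notation T := (measurableTypeR R).
Local Notation I := (`[0, 1]%classic : set T).
Local Notation C := (Cplx R).

Definition aec n (P : pt R n -> Prop) :=
  \forall x \ae leb R n, cube R n x -> P x.

Lemma L2eqE N M (u v : vfun R N M) : L2eq u v <-> aec (fun k => u k = v k).
Proof. by []. Qed.

Lemma aecW n (P : pt R n -> Prop) : (forall x, cube R n x -> P x) -> aec P.
Proof. by move=> h; rewrite /aec; apply: aeW. Qed.

Lemma aecS n (P P' : pt R n -> Prop) :
  (forall x, cube R n x -> P x -> P' x) -> aec P -> aec P'.
Proof. by move=> h; rewrite /aec; apply: filterS => x Px Qx; exact: h (Px Qx). Qed.

Lemma aecS2 n (P P' P'' : pt R n -> Prop) :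
  (forall x, cube R n x -> P x -> P' x -> P'' x) -> aec P -> aec P' -> aec P''.
Proof. by move=> h; rewrite /aec; apply: filterS2 => x Px P'x Qx; exact: h (Px Qx) (P'x Qx). Qed.

Lemma aec_finType n (J : finType) (P : J -> pt R n -> Prop) :
  (forall i, aec (P i)) -> aec (fun x => forall i, P i x).
Proof.
rewrite /aec => h; have : \forall x \ae leb R n, forall i : J, cube R n x -> P i x.
  exact: filter_forall.
by apply: filterS => x hx Qx i; exact: hx.
Qed.

(** A box of positive measure inside the cube and near [x], built coordinate by coordinate. It also
    avoids the hyperplanes through [p], so that an identity known only off these hyperplanes can
    still be tested on it. *)
Lemma small_box n (x p : pt R n) (d : R) : 0 < d -> cube R n x ->
  exists S, [/\ measurable S, (0 < leb R n S)%E &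
    S `<=` [set y | [/\ cube R n y, near_pt d x y &
                        forall i, (tnth y i : R) != tnth p i]]].
Proof.
move=> d0; elim: n x p => [|n ih] x p Qx.
  exists setT; split=> //.
    by rewrite /= diracT.
  by move=> y _; split=> [|[]//|[]//]; exact: cube0.
case/tupleP: x Qx => a x Qx; case/tupleP: p => b p.
have [a01 {}Qx] : I a /\ cube R n x by exact/cube_cons.
have [S [mS S0 hS]] := ih x p Qx.
have [l [r [lr lrI lra lrb]]] : exists l r : R, [/\ l < r, `]l, r[ `<=` I,
    forall c, `]l, r[%classic c -> `|a - c| < d & forall c, `]l, r[%classic c -> c != b].
  move: a01; rewrite /= in_itv /= => /andP[a0 a1].
  pose l := Num.max 0 (a - d); pose r := Num.min 1 (a + d).
  have lr : l < r by rewrite lt_min !gt_max; apply/andP; split; apply/andP; split; lra.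
  (* If [b] falls inside the interval, only the part to its left is kept. *)
  pose r' := if l < (b : R) < r then b : R else r.
  have r'r : r' <= r by rewrite /r'; case: ifPn => // /andP[_ /ltW].
  exists l, r'; split.
  - by rewrite /r'; case: ifPn => // /andP[].
  - move=> c /=; rewrite !in_itv /= => /andP[lc cr].
    have := lt_le_trans cr r'r; rewrite lt_min => /andP[c1 _].
    by move: lc; rewrite gt_max => /andP[c0 _]; rewrite !ltW.
  - move=> c /=; rewrite in_itv /= => /andP[lc cr].
    have := lt_le_trans cr r'r; rewrite lt_min => /andP[_ c1].
    by move: lc; rewrite gt_max => /andP[_ c0]; rewrite ltr_norml; lra.
  - move=> c /=; rewrite in_itv /= => /andP[lc]; rewrite /r'.
    case: ifPn => [_ cb|]; first by rewrite lt_eqF.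
    by move=> + cr; apply: contraNneq => <-; rewrite lc.
pose S' : set (pt R n.+1) := [set z | `]l, r[%classic (thead z) /\ S [tuple of behead z]].
have cpK (c : T) (y : pt R n) : [tuple of behead (cons_pt (c, y))] = y by exact: val_inj.
have ES' : @cons_pt _ T n @^-1` S' = `]l, r[%classic `*` S.
  by apply/seteqP; split=> -[c y] /=; rewrite /S' /= theadE cpK.
exists S'; split.
- rewrite (_ : S' = ((fun z : pt R n.+1 => tnth z ord0) @^-1` `]l, r[%classic)
      `&` ((fun z : pt R n.+1 => [tuple of behead z]) @^-1` S)); last by [].
  apply: measurableI; rewrite -[X in measurable X]setTI.
    by apply: measurable_tnth.
  exact: measurable_behead.
- change (0 < (lebesgue_measure \x leb R n)%E (@cons_pt _ T n @^-1` S'))%E.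
  rewrite ES' product_measure1E//.
  have I0 : (0 < @lebesgue_measure R `]l, r[%classic)%E.
    by rewrite lebesgue_measure_itv /= lte_fin lr -EFinB lte_fin subr_gt0.
  exact: mule_gt0 I0 S0.
- move=> z; case/tupleP: z => c y [/= cl]; rewrite theadE in cl *.
  rewrite (_ : [tuple of _] = y); last exact: val_inj.
  move=> /hS[Qy xy yp]; split.
  + by apply/cube_cons; split=> //; exact: lrI.
  + move=> i; have [k ->|->] := unliftP ord0 i; last exact: lra.
    by rewrite !tnthS; exact: xy.
  + move=> i; have [k ->|->] := unliftP ord0 i; last exact: lrb.
    by rewrite !tnthS; exact: yp.
Qed.

(** If [f x] were not 0, the distance from [f x] would be less than [cabs (f x)] on a whole box of
    positive measure around [x], and [f] could not vanish there. *)
Lemma ucont_ae0 n (f : pt R n -> C) (p : pt R n) : ucont f ->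
  aec (fun y => (forall i, (tnth y i : R) != tnth p i) -> f y = 0) ->
  forall x, cube R n x -> f x = 0.
Proof.
move=> uf f0 x Qx; apply/eqP; apply: contrapT => /negP fx.
have c0 : 0 < cabs (f x) by rewrite cabs_gt0.
have [d d0 hd] := uf _ c0.
have [S [mS S0 hS]] := small_box p d0 Qx.
suff : leb R n S = 0%E by move=> S0'; rewrite S0' ltxx in S0.
apply/(negligibleP (leb R n) mS).
apply: negligibleS f0 => y /hS[Qy xy yp] /= h.
by have := hd x y Qx Qy xy; rewrite h// subr0 ltxx.
Qed.

Lemma ucont_sqr_int0 n (f : pt R n -> C) (p : pt R n) : ucont f ->
  (\int[leb R n]_(y in cube R n) (cabs (f y) ^+ 2)%:E = 0)%E ->
  forall x, cube R n x -> f x = 0.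
Proof.
move=> uf i0; apply: (ucont_ae0 (p := p) uf).
have [mr mi] := ucont_measurable uf.
have : ae_eq (leb R n) (cube R n) (fun y => (cabs (f y) ^+ 2)%:E) (cst 0%E).
  apply/ae_eq_integral_abs; first exact: measurable_cube.
    apply/measurable_EFinP.
    apply: (eq_measurable_fun (fun y => complex.Re (f y) ^+ 2 + complex.Im (f y) ^+ 2)).
      by move=> y _; rewrite cabs_sqr.
    by apply: measurable_funD; apply: measurable_funX.
  by under eq_integral do rewrite gee0_abs ?lee_fin ?sqr_ge0//.
apply: filterS => y h Qy _; apply/cabs0_eq0/eqP.
by have [/eqP] := h Qy; rewrite sqrf_eq0.
Qed.

End null_sets.

#[local] Hint Extern 0 (measurable (cube _ _)) => exact: measurable_cube : core.

(** * Real integrals over the cube and over its slices *)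

Section real_integral_on_cube.
Variable R : realType.
Implicit Types n j : nat.
Local Notation rintg n h := ((leb R n).-integrable (cube R n) (EFin \o h)).

Local Notation mQ n := (@measurable_cube R n).

Lemma leb_cube_lty n : (leb R n (cube R n) < +oo)%E.
Proof. by rewrite (_ : leb R n _ = 1%E) ?ltry//; exact: leb_cube. Qed.

Lemma rintg_bounded n (h : pt R n -> R) (c : R) :
  measurable_fun (cube R n) h -> (forall y, cube R n y -> `|h y| <= c) -> rintg n h.
Proof.
move=> mh hc; apply: measurable_bounded_integrable => //.
- exact: leb_cube_lty.
- exists c; split; first exact: num_real.
  by move=> M cM y Qy /=; apply: le_trans (hc y Qy) (ltW cM).
Qed.

Lemma rint_cst n (c : R) : \int[leb R n]_(y in cube R n) c = c.
Proof. by rewrite /Rintegral integral_cube_cst. Qed.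

(** The cube has finite measure and [1 + a ^+ 2] dominates the absolute value of [a]. *)
Lemma rintg_sqr n (h : pt R n -> R) : measurable_fun (cube R n) h ->
  (\int[leb R n]_(y in cube R n) (h y ^+ 2)%:E < +oo)%E -> rintg n h.
Proof.
move=> mh h2.
have i2 : rintg n (fun y => h y ^+ 2).
  apply/integrableP; split; first by apply/measurable_EFinP; exact: measurable_funX.
  by under eq_integral do rewrite /= ger0_norm ?sqr_ge0//.
have i1 : rintg n (fun=> 1) by apply: (rintg_bounded (c := 1)) => // y _; rewrite normr1.
apply: (le_integrable (mQ n) _ _ (integrableD (mQ n) i1 i2)).
  exact/measurable_EFinP.
move=> y _ /=; rewrite lee_fin; set a := h y.
have -> : `|1 + a ^+ 2| = 1 + `|a| ^+ 2 by rewrite ger0_norm ?addr_ge0 ?sqr_ge0// real_normK ?num_real.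
by nra.
Qed.

(** Jensen's inequality for the square: with [c] the mean of [h], integrate
    [2 * c * h <= h ^+ 2 + c ^+ 2] over a space of mass 1. *)
Lemma sqr_rint_le n (h : pt R n -> R) : measurable_fun (cube R n) h ->
  ((((\int[leb R n]_(y in cube R n) h y) ^+ 2)%:E) <=
     \int[leb R n]_(y in cube R n) (h y ^+ 2)%:E)%E.
Proof.
move=> mh; have [h2|] := ltP (\int[leb R n]_(y in cube R n) (h y ^+ 2)%:E)%E +oo%E; last first.
  by rewrite leye_eq => /eqP ->; rewrite leey.
have ih := rintg_sqr mh h2.
have i2 : rintg n (fun y => h y ^+ 2).
  apply/integrableP; split; first by apply/measurable_EFinP; exact: measurable_funX.
  by under eq_integral do rewrite /= ger0_norm ?sqr_ge0//.
rewrite -[leRHS]fineK; last exact: (integrable_fin_num (mQ n) i2).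
rewrite lee_fin -/(Rintegral _ _ _); set c := Rintegral _ _ h.
have ic : rintg n (fun=> c ^+ 2) by exact: (rintg_bounded (c := `|c ^+ 2|)).
have icl : rintg n (fun y => (2 * c) * h y).
  by move: (integrableZl (mQ n) (2 * c) ih); apply: (eq_integrable (mQ n)) => y _.
have il : rintg n (fun y => h y ^+ 2 + c ^+ 2).
  by move: (integrableD (mQ n) i2 ic); apply: (eq_integrable (mQ n)) => y _.
have : \int[leb R n]_(y in cube R n) (2 * c * h y) <=
    \int[leb R n]_(y in cube R n) (h y ^+ 2 + c ^+ 2).
  apply: (le_Rintegral (mQ n) icl il) => y _.
  rewrite -subr_ge0 (_ : _ - _ = (h y - c) ^+ 2) ?sqr_ge0//.
  by rewrite sqrrB -mulr_natl; ring.
rewrite (RintegralZl _ (mQ n) ih) (RintegralD (mQ n) i2 ic) rint_cst -/c.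
by rewrite /Rintegral; lra.
Qed.


Section positive_negative_parts.
Variables (n j : nat) (h : pt R n -> R).
Hypothesis mh : measurable_fun (cube R n) h.

Let H := EFin \o h.
Let mH : measurable_fun (cube R n) H. Proof. exact/measurable_EFinP. Qed.
Let P k := (\int[leb R j]_(y in cube R j) H^\+ (splice y k))%E.
Let N k := (\int[leb R j]_(y in cube R j) H^\- (splice y k))%E.

Let mP : measurable_fun (cube R n) P.
Proof. by apply: measurable_avg_ge0 => [|x _]; [exact: measurable_funepos|exact: funepos_ge0]. Qed.

Let mN : measurable_fun (cube R n) N.
Proof. by apply: measurable_avg_ge0 => [|x _]; [exact: measurable_funeneg|exact: funeneg_ge0]. Qed.

Let ravgE k : \int[leb R j]_(y in cube R j) h (splice y k) = fine (P k - N k)%E.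
Proof.
rewrite /Rintegral [in LHS]integralE; congr (fine (_ - _)%E).
  by apply: eq_integral => y _; rewrite !funeposE.
by apply: eq_integral => y _; rewrite !funenegE.
Qed.

Lemma measurable_ravg :
  measurable_fun (cube R n) (fun k => \int[leb R j]_(y in cube R j) h (splice y k)).
Proof.
apply: (eq_measurable_fun (fine \o (fun k => P k - N k)%E)).
  by move=> k _; rewrite [RHS]ravgE.
apply: measurableT_comp; first by [].
exact: emeasurable_funB.
Qed.

Hypotheses (jn : (j <= n)%N) (ih : rintg n h).

Let iP : (leb R n).-integrable (cube R n) P.
Proof.
apply/integrableP; split => //.
under eq_integral do rewrite gee0_abs ?integral_ge0//.
rewrite (tonelli_splice jn)//; last exact: measurable_funepos.
exact: (integrable_lty (mQ n) (integrable_funepos (mQ n) ih)).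
Qed.

Let iN : (leb R n).-integrable (cube R n) N.
Proof.
apply/integrableP; split => //.
under eq_integral do rewrite gee0_abs ?integral_ge0//.
rewrite (tonelli_splice jn)//; last exact: measurable_funeneg.
exact: (integrable_lty (mQ n) (integrable_funeneg (mQ n) ih)).
Qed.

(** Tonelli for the averages [P] and [N] of the positive and negative parts of [h], which are
    integrable along with [h]. *)
Lemma rint_ravg :
  \int[leb R n]_(k in cube R n) (\int[leb R j]_(y in cube R j) h (splice y k)) =
  \int[leb R n]_(k in cube R n) h k.
Proof.
congr fine.
transitivity (\int[leb R n]_(k in cube R n) (P k - N k))%E.
  apply: ae_eq_integral => //.
  - by apply/measurable_EFinP; exact: measurable_ravg.
  - exact: emeasurable_funB.
  (* Integrability makes [P] and [N] finite almost everywhere; the points where [fine] could return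
     a default value form a null set. *)
  - have := integrable_ae (mQ n) iP; have := integrable_ae (mQ n) iN.
    apply: filterS2 => k nN nP Qk; rewrite ravgE fineK//.
    by rewrite fin_numB nP// nN.
rewrite integralB// [RHS]integralE; congr (_ - _)%E.
  by rewrite (tonelli_splice jn)//; exact: measurable_funepos.
by rewrite (tonelli_splice jn)//; exact: measurable_funeneg.
Qed.

Lemma rintg_section : aec (fun k => rintg j (fun y => h (splice y k))).
Proof.
have := integrable_ae (mQ n) iP; have := integrable_ae (mQ n) iN.
apply: filterS2 => k nN nP Qk; apply/integrableP; split.
  apply/measurable_EFinP; exact: measurable_splice_section.
rewrite (eq_integral (fun y => H^\+ (splice y k) + H^\- (splice y k))%E); last first.
  by move=> y _; have := congr1 (fun F => F (splice y k)) (fune_abse H).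
have mpos : measurable_fun (cube R j) (fun y => H^\+ (splice y k))%E.
  by apply: measurable_splice_section => //; exact: measurable_funepos.
have mneg : measurable_fun (cube R j) (fun y => H^\- (splice y k))%E.
  by apply: measurable_splice_section => //; exact: measurable_funeneg.
rewrite ge0_integralD//.
by rewrite lte_add_pinfty// -ge0_fin_numE ?integral_ge0//; [exact: nP|exact: nN].
Qed.

End positive_negative_parts.

End real_integral_on_cube.

(** * Complex and matrix valued integrals *)

Section complex_integral_on_cube.
Variable R : realType.
Local Notation C := (Cplx R).
Local Notation rintg n h := ((leb R n).-integrable (cube R n) (EFin \o h)).
Local Notation mQ n := (@measurable_cube R n).

Definition cint n (g : pt R n -> C) : C :=
  Complex (\int[leb R n]_(y in cube R n) complex.Re (g y))
          (\int[leb R n]_(y in cube R n) complex.Im (g y)).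

Definition cmeas n (g : pt R n -> C) :=
  measurable_fun (cube R n) (fun y => complex.Re (g y)) /\
  measurable_fun (cube R n) (fun y => complex.Im (g y)).

Definition cintg n (g : pt R n -> C) :=
  rintg n (fun y => complex.Re (g y)) /\ rintg n (fun y => complex.Im (g y)).

Lemma avgE N j (f : pt R N -> C) k : avg j f k = cint (fun y : pt R j => f (splice y k)).
Proof. by []. Qed.

Lemma cmeas_eq n (g h : pt R n -> C) : (forall y, cube R n y -> g y = h y) ->
  cmeas g -> cmeas h.
Proof.
move=> gh [m1 m2]; split.
  by apply: (eq_measurable_fun (fun y => complex.Re (g y))) => // y /set_mem /gh ->.
by apply: (eq_measurable_fun (fun y => complex.Im (g y))) => // y /set_mem /gh ->.
Qed.

Lemma cmeasD n (g h : pt R n -> C) : cmeas g -> cmeas h -> cmeas (fun y => g y + h y).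
Proof.
move=> [g1 g2] [h1 h2]; split.
  apply: (eq_measurable_fun (fun y => complex.Re (g y) + complex.Re (h y))).
    by move=> y _; rewrite cReD.
  exact: measurable_funD.
apply: (eq_measurable_fun (fun y => complex.Im (g y) + complex.Im (h y))).
  by move=> y _; rewrite cImD.
exact: measurable_funD.
Qed.

Lemma cmeasM n (g h : pt R n -> C) : cmeas g -> cmeas h -> cmeas (fun y => g y * h y).
Proof.
move=> [g1 g2] [h1 h2]; split.
  apply: (eq_measurable_fun (fun y => complex.Re (g y) * complex.Re (h y) -
      complex.Im (g y) * complex.Im (h y))).
    by move=> y _; rewrite cReM.
  by apply: measurable_funB; exact: measurable_funM.
apply: (eq_measurable_fun (fun y => complex.Re (g y) * complex.Im (h y) +
    complex.Im (g y) * complex.Re (h y))).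
  by move=> y _; rewrite cImM.
by apply: measurable_funD; exact: measurable_funM.
Qed.

Lemma cmeas_cst n (c : C) : cmeas (fun _ : pt R n => c).
Proof. by split. Qed.

Lemma cmeas_sum n I (r : seq I) (P : pred I) (F : I -> pt R n -> C) :
  (forall i, P i -> cmeas (F i)) -> cmeas (fun y => \sum_(i <- r | P i) F i y).
Proof.
move=> mF; elim: r => [|i r ih].
  by apply: cmeas_eq (cmeas_cst n 0) => y _; rewrite big_nil.
case Pi : (P i).
  by apply: cmeas_eq (cmeasD (mF i Pi) ih) => y _; rewrite big_cons Pi.
by apply: cmeas_eq ih => y _; rewrite big_cons Pi.
Qed.

Lemma cintg_meas n (g : pt R n -> C) : cintg g -> cmeas g.
Proof. by move=> [/measurable_int/measurable_EFinP h1 /measurable_int/measurable_EFinP h2]. Qed.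

Lemma cintg_eq n (g h : pt R n -> C) : (forall y, cube R n y -> g y = h y) ->
  cintg g -> cintg h.
Proof.
move=> gh [m1 m2]; split.
  by move: m1; apply: (eq_integrable (mQ n)) => y /set_mem /= /gh ->.
by move: m2; apply: (eq_integrable (mQ n)) => y /set_mem /= /gh ->.
Qed.

Lemma cintgD n (g h : pt R n -> C) : cintg g -> cintg h -> cintg (fun y => g y + h y).
Proof.
move=> [g1 g2] [h1 h2]; split.
  by move: (integrableD (mQ n) g1 h1); apply: (eq_integrable (mQ n)) => y _; rewrite /= cReD.
by move: (integrableD (mQ n) g2 h2); apply: (eq_integrable (mQ n)) => y _; rewrite /= cImD.
Qed.

Let rintgZ n (c : R) (h : pt R n -> R) : rintg n h -> rintg n (fun y => c * h y).
Proof. by move=> ih; move: (integrableZl (mQ n) c ih); apply: (eq_integrable (mQ n)). Qed.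

Let rintgB n (g h : pt R n -> R) : rintg n g -> rintg n h -> rintg n (fun y => g y - h y).
Proof. by move=> ig ih; move: (integrableB (mQ n) ig ih); apply: (eq_integrable (mQ n)). Qed.

Let rintgD n (g h : pt R n -> R) : rintg n g -> rintg n h -> rintg n (fun y => g y + h y).
Proof. by move=> ig ih; move: (integrableD (mQ n) ig ih); apply: (eq_integrable (mQ n)). Qed.

Lemma cintgZ n (c : C) (g : pt R n -> C) : cintg g -> cintg (fun y => c * g y).
Proof.
move=> [g1 g2]; split.
  move: (rintgB (rintgZ (complex.Re c) g1) (rintgZ (complex.Im c) g2)).
  by apply: (eq_integrable (mQ n)) => y _; rewrite /= cReM.
move: (rintgD (rintgZ (complex.Re c) g2) (rintgZ (complex.Im c) g1)).
by apply: (eq_integrable (mQ n)) => y _; rewrite /= cImM.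
Qed.

Lemma cintg_bounded n (g : pt R n -> C) (c : R) : cmeas g ->
  (forall y, cube R n y -> cabs (g y) <= c) -> cintg g.
Proof.
move=> [g1 g2] gc; split; apply: (rintg_bounded (c := c)) => // y Qy.
  exact: le_trans (normr_Re_le _) (gc y Qy).
exact: le_trans (normr_Im_le _) (gc y Qy).
Qed.

Lemma cintg_cst n (c : C) : cintg (fun _ : pt R n => c).
Proof. exact: (cintg_bounded (cmeas_cst n c) (c := cabs c)). Qed.

Lemma cintg_ucont n (g : pt R n -> C) : ucont g -> cintg g.
Proof.
move=> ug; have [c _ gc] := ucont_bounded ug.
exact: cintg_bounded (ucont_measurable ug) gc.
Qed.

Lemma cintg_sum n I (r : seq I) (P : pred I) (F : I -> pt R n -> C) :
  (forall i, P i -> cintg (F i)) -> cintg (fun y => \sum_(i <- r | P i) F i y).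
Proof.
move=> mF; elim: r => [|i r ih].
  by apply: cintg_eq (cintg_cst n 0) => y _; rewrite big_nil.
case Pi : (P i).
  by apply: cintg_eq (cintgD (mF i Pi) ih) => y _; rewrite big_cons Pi.
by apply: cintg_eq ih => y _; rewrite big_cons Pi.
Qed.

Lemma cint_eq n (g h : pt R n -> C) : (forall y, cube R n y -> g y = h y) ->
  cint g = cint h.
Proof. by move=> gh; congr Complex; apply: eq_Rintegral => y /set_mem/gh ->. Qed.

Lemma cint_aec n (g h : pt R n -> C) : cmeas g -> cmeas h ->
  aec (fun y => g y = h y) -> cint g = cint h.
Proof.
move=> [g1 g2] [h1 h2] gh; congr Complex; congr fine; apply: ae_eq_integral => //.
- exact/measurable_EFinP.
- exact/measurable_EFinP.
- by move: gh; apply: aecS => y _ ->.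
- exact/measurable_EFinP.
- exact/measurable_EFinP.
- by move: gh; apply: aecS => y _ ->.
Qed.

Lemma cint_cst n (c : C) : cint (fun _ : pt R n => c) = c.
Proof. by rewrite /cint !rint_cst; case: c. Qed.

Lemma cintD n (g h : pt R n -> C) : cintg g -> cintg h ->
  cint (fun y => g y + h y) = cint g + cint h.
Proof.
move=> [g1 g2] [h1 h2]; rewrite /cint; apply/eqP; rewrite eq_complex /=; apply/andP; split; apply/eqP.
  rewrite -RintegralD//; apply: eq_Rintegral => y _; exact: cReD.
rewrite -RintegralD//; apply: eq_Rintegral => y _; exact: cImD.
Qed.

Lemma cintZ n (c : C) (g : pt R n -> C) : cintg g ->
  cint (fun y => c * g y) = c * cint g.
Proof.
move=> [g1 g2]; apply/eqP; rewrite eq_complex; apply/andP; split; apply/eqP.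
  rewrite cReM /= -!RintegralZl// -RintegralB//; [|exact: rintgZ..].
  by apply: eq_Rintegral => y _; exact: cReM.
rewrite cImM /= -!RintegralZl// -RintegralD//; [|exact: rintgZ..].
by apply: eq_Rintegral => y _; exact: cImM.
Qed.

Lemma cint_sum n I (r : seq I) (P : pred I) (F : I -> pt R n -> C) :
  (forall i, P i -> cintg (F i)) ->
  cint (fun y => \sum_(i <- r | P i) F i y) = \sum_(i <- r | P i) cint (F i).
Proof.
move=> mF; elim: r => [|i r ih].
  by rewrite big_nil -[RHS](cint_cst n 0); apply: cint_eq => y _; rewrite big_nil.
rewrite big_cons; case Pi : (P i); rewrite -ih.
  rewrite -cintD//; last by apply: cintg_sum.
    by apply: cint_eq => y _; rewrite big_cons Pi.
  exact: mF.
by apply: cint_eq => y _; rewrite big_cons Pi.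
Qed.

(** The factor 2 comes from bounding the real and the imaginary part separately; only the order of
    magnitude matters later. *)
Lemma cabs_cint_le n (g : pt R n -> C) (c : R) : cintg g ->
  (forall y, cube R n y -> cabs (g y) <= c) -> cabs (cint g) <= 2 * c.
Proof.
move=> [g1 g2] gc; apply: le_trans (cabs_leD _) _; rewrite mulr_natl mulr2n /=.
have h (f : pt R n -> R) : rintg n f -> (forall y, cube R n y -> `|f y| <= c) ->
    `|\int[leb R n]_(y in cube R n) f y| <= c.
  move=> fi fc; apply: le_trans (le_normr_Rintegral (mQ n) fi) _.
  have nfi : rintg n (fun y => `|f y|) by move: (integrable_abse fi); apply: (eq_integrable (mQ n)).
  have ci : rintg n (fun=> c) by exact: (rintg_bounded (c := `|c|)).
  by rewrite -[leRHS](rint_cst n); exact: (le_Rintegral (mQ n) nfi ci).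
by apply: lerD; apply: h => // y Qy; apply: le_trans (gc y Qy);
  [exact: normr_Re_le|exact: normr_Im_le].
Qed.

Section averages.
Variables (n j : nat) (g : pt R n -> C).

Lemma cmeas_avg : cmeas g -> cmeas (avg j g).
Proof. by move=> [g1 g2]; split; [exact: (@measurable_ravg R n j _ g1)|exact: (@measurable_ravg R n j _ g2)]. Qed.

Lemma cmeas_section k : cube R n k -> cmeas g -> cmeas (fun y : pt R j => g (splice y k)).
Proof. by move=> Qk [g1 g2]; split; [exact: (measurable_splice_section Qk g1)|exact: (measurable_splice_section Qk g2)]. Qed.

Lemma cint_avg : (j <= n)%N -> cintg g -> cint (avg j g) = cint g.
Proof.
by move=> jn gi; have [m1 m2] := cintg_meas gi; case: gi => g1 g2; congr Complex; [exact: (rint_ravg m1 jn g1)|exact: (rint_ravg m2 jn g2)].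
Qed.

Lemma cintg_section : (j <= n)%N -> cintg g ->
  aec (fun k => cintg (fun y : pt R j => g (splice y k))).
Proof.
move=> jn gi; have [m1 m2] := cintg_meas gi; case: gi => g1 g2.
by apply: aecS2 (rintg_section m1 jn g1) (rintg_section m2 jn g2) => k Qk; split.
Qed.

(** Tonelli for the indicator of a measurable null set [Z] that contains the exceptional points: its
    averages have integral 0, so almost all of them vanish, and where one vanishes almost every
    point of the section avoids [Z]. *)
Lemma aec_section (P : pt R n -> Prop) : (j <= n)%N -> aec P ->
  aec (fun k => aec (fun y : pt R j => P (splice y k))).
Proof.
move=> jn [Z [mZ Z0 PZ]].
have mi : measurable_fun (cube R n) (EFin \o (\1_Z : _ -> R)).
  by apply/measurable_EFinP; exact: measurable_indic.
have z0 : (\int[leb R n]_(k in cube R n) (\1_Z k)%:E = 0)%E.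
  rewrite integral_indic//; apply/eqP; rewrite -measure_le0 -Z0.
  by apply: le_measure; rewrite ?inE//; apply: measurableI.
have i0 : forall x : pt R n, cube R n x -> (0 <= (\1_Z x : R)%:E)%E by move=> x _; rewrite lee_fin.
have h := tonelli_splice jn mi i0.
rewrite /= z0 in h.
have : ae_eq (leb R n) (cube R n)
    (fun k => \int[leb R j]_(y in cube R j) (\1_Z (splice y k) : R)%:E)%E (cst 0%E).
  apply/ae_eq_integral_abs => //.
    exact: (@measurable_avg_ge0 R n j _ mi i0).
  rewrite -[RHS]h; apply: eq_integral => k _; rewrite gee0_abs//.
  by apply: integral_ge0 => y _; rewrite lee_fin.
rewrite /aec; apply: filterS => k + Qk => /(_ Qk) hk.
have : ae_eq (leb R j) (cube R j) (fun y : pt R j => (\1_Z (splice y k) : R)%:E) (cst 0%E).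
  apply/ae_eq_integral_abs => //.
    exact: (measurable_splice_section Qk mi).
  by rewrite -[RHS]hk; apply: eq_integral => y _; rewrite gee0_abs// lee_fin.
apply: filterS => y hy Qy.
apply: contrapT => nP; have : Z (splice y k).
  by apply: PZ => /= hP; apply/nP/hP/cube_splice.
move=> Zy; have /eqP := hy Qy.
by rewrite indicE mem_set// eqe oner_eq0.
Qed.

Lemma ucont_section k : cube R n k -> ucont g -> ucont (fun y : pt R j => g (splice y k)).
Proof.
move=> Qk ug e /ug[d d0 h]; exists d => // x y Qx Qy xy.
apply: h; [exact: cube_splice..|].
move=> i; have [ji|ij] := leqP j i.
  by rewrite !tnth_splice_ge// subrr normr0.
by rewrite !tnth_splice_lt; exact: xy.
Qed.

Lemma ucont_avg : ucont g -> ucont (avg j g).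
Proof.
(* The factor 2 of [cabs_cint_le] turns [e / 4] into [e / 2], which leaves a strict inequality. *)
move=> ug e e0; have e4 : 0 < e / 4 by rewrite divr_gt0.
have [d d0 h] := ug _ e4; exists d => // x y Qx Qy xy.
rewrite !avgE -[X in _ - X]mul1r -mulNr -cintZ; last exact/cintg_ucont/ucont_section.
rewrite -cintD; last 2 first.
- exact/cintg_ucont/ucont_section.
- exact/cintgZ/cintg_ucont/ucont_section.
apply: (@le_lt_trans _ _ (2 * (e / 4))); last lra.
apply: cabs_cint_le.
  apply: cintgD; first exact/cintg_ucont/ucont_section.
  exact/cintgZ/cintg_ucont/ucont_section.
move=> z Qz; rewrite mulN1r; apply/ltW/h; [exact: cube_splice..|].
move=> i; have [ji|ij] := leqP j i.
  by rewrite !tnth_splice_ge//; exact: xy.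
by rewrite !tnth_splice_lt subrr normr0.
Qed.

End averages.

Lemma splice_splice N i j (y : pt R i) (z : pt R j) (k : pt R N) : (j <= i)%N ->
  splice y (splice z k) = splice y k.
Proof.
move=> ji; apply: eq_from_tnth => l; have [il|li] := leqP i l.
  by rewrite !(tnth_splice_ge _ _ il) (tnth_splice_ge _ _ (leq_trans ji il)).
by rewrite !(tnth_splice_lt _ _ li).
Qed.

(** Lets an average of level [j] be computed inside a slice of level [i]; this is what reduces
    statements about averages of averages to a cube of dimension [i]. *)
Lemma splice_spliceA N i j (y : pt R i) (z : pt R j) (k : pt R N) : (j <= i)%N ->
  splice z (splice y k) = splice (splice z y) k.
Proof.
move=> ji; apply: eq_from_tnth => l; have [il|li] := leqP i l.
  by rewrite !(tnth_splice_ge _ _ il) (tnth_splice_ge _ _ (leq_trans ji il)) (tnth_splice_ge _ _ il).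
have [jl|lj] := leqP j l.
  by rewrite (tnth_splice_ge _ _ jl) !(tnth_splice_lt _ _ li) (tnth_splice_ge (N := i)).
by rewrite (tnth_splice_lt _ _ lj) (tnth_splice_lt _ _ li) (tnth_splice_lt (N := i)).
Qed.

Lemma avg_splice N i j (f : pt R N -> C) (y : pt R j) k : (j <= i)%N ->
  avg i f (splice y k) = avg i f k.
Proof.
by move=> ji; rewrite !avgE; apply: cint_eq => z _; rewrite splice_splice.
Qed.

Lemma avg_eq N j (f g : pt R N -> C) k : cube R N k ->
  (forall x, cube R N x -> f x = g x) -> avg j f k = avg j g k.
Proof. by move=> Qk fg; apply: cint_eq => y Qy; apply: fg; exact: cube_splice. Qed.

End complex_integral_on_cube.

Section matrix_integral.
Variable R : realType.
Local Notation C := (Cplx R).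

Definition cintmx n p q (F : pt R n -> 'M[C]_(p, q)) : 'M[C]_(p, q) :=
  \matrix_(a, b) cint (fun y => F y a b).

Definition cintgmx n p q (F : pt R n -> 'M[C]_(p, q)) :=
  forall a b, cintg (fun y => F y a b).

Lemma avgmxE N j p q (F : pt R N -> 'M[C]_(p, q)) k :
  avgmx j F k = cintmx (fun y : pt R j => F (splice y k)).
Proof. by []. Qed.

Lemma cintmx_eq n p q (F G : pt R n -> 'M[C]_(p, q)) :
  (forall y, cube R n y -> F y = G y) -> cintmx F = cintmx G.
Proof. by move=> FG; apply/matrixP => a b; rewrite !mxE; apply: cint_eq => y /FG ->. Qed.

Lemma cintgmx_ucmx n p q (F : pt R n -> 'M[C]_(p, q)) : ucmx F -> cintgmx F.
Proof. by move=> uF a b; exact/cintg_ucont/uF. Qed.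

Lemma cintgmxZ n p q (c : C) (F : pt R n -> 'M[C]_(p, q)) :
  cintgmx F -> cintgmx (fun y => c *: F y).
Proof. by move=> iF a b; apply: cintg_eq (cintgZ c (iF a b)) => y _; rewrite mxE. Qed.

Lemma cintgmx_sum n p q I (r : seq I) (P : pred I) (F : I -> pt R n -> 'M[C]_(p, q)) :
  (forall i, P i -> cintgmx (F i)) -> cintgmx (fun y => \sum_(i <- r | P i) F i y).
Proof.
move=> iF a b; apply: (cintg_eq (g := fun y => \sum_(i <- r | P i) F i y a b)).
  by move=> y _; rewrite summxE.
by apply: cintg_sum => i Pi; exact: iF.
Qed.

Lemma cintgmxMl n p q s (A : 'M[C]_(s, p)) (F : pt R n -> 'M[C]_(p, q)) :
  cintgmx F -> cintgmx (fun y => A *m F y).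
Proof.
move=> iF a b; apply: (cintg_eq (g := fun y => \sum_l A a l * F y l b)).
  by move=> y _; rewrite mxE.
by apply: cintg_sum => l _; exact/cintgZ/iF.
Qed.

Lemma cintgmxMr n p q s (A : 'M[C]_(q, s)) (F : pt R n -> 'M[C]_(p, q)) :
  cintgmx F -> cintgmx (fun y => F y *m A).
Proof.
move=> iF a b; apply: (cintg_eq (g := fun y => \sum_l A l b * F y a l)).
  by move=> y _; rewrite mxE; apply: eq_bigr => l _; rewrite mulrC.
by apply: cintg_sum => l _; exact/cintgZ/iF.
Qed.

Lemma cintmx_cst n p q (A : 'M[C]_(p, q)) : cintmx (fun _ : pt R n => A) = A.
Proof. by apply/matrixP => a b; rewrite !mxE cint_cst. Qed.

Lemma cintmxD n p q (F G : pt R n -> 'M[C]_(p, q)) : cintgmx F -> cintgmx G ->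
  cintmx (fun y => F y + G y) = cintmx F + cintmx G.
Proof.
move=> iF iG; apply/matrixP => a b; rewrite !mxE -cintD//.
by apply: cint_eq => y _; rewrite mxE.
Qed.

Lemma cintmxZ n p q (c : C) (F : pt R n -> 'M[C]_(p, q)) : cintgmx F ->
  cintmx (fun y => c *: F y) = c *: cintmx F.
Proof.
move=> iF; apply/matrixP => a b; rewrite !mxE -cintZ//.
by apply: cint_eq => y _; rewrite mxE.
Qed.

Lemma cintmxB n p q (F G : pt R n -> 'M[C]_(p, q)) : cintgmx F -> cintgmx G ->
  cintmx (fun y => F y - G y) = cintmx F - cintmx G.
Proof.
move=> iF iG; rewrite -[- cintmx G]scaleN1r -cintmxZ// -cintmxD//; last exact: cintgmxZ.
by apply: cintmx_eq => y _; rewrite scaleN1r.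
Qed.

Lemma cintmx_sum n p q I (r : seq I) (P : pred I) (F : I -> pt R n -> 'M[C]_(p, q)) :
  (forall i, P i -> cintgmx (F i)) ->
  cintmx (fun y => \sum_(i <- r | P i) F i y) = \sum_(i <- r | P i) cintmx (F i).
Proof.
move=> iF; apply/matrixP => a b; rewrite summxE mxE.
transitivity (cint (fun y => \sum_(i <- r | P i) F i y a b)).
  by apply: cint_eq => y _; rewrite summxE.
rewrite cint_sum => [|i Pi]; last exact: iF.
by apply: eq_bigr => i _; rewrite mxE.
Qed.

Lemma cintmxMl n p q s (A : 'M[C]_(s, p)) (F : pt R n -> 'M[C]_(p, q)) :
  cintgmx F -> cintmx (fun y => A *m F y) = A *m cintmx F.
Proof.
move=> iF; apply/matrixP => a b; rewrite !mxE.
transitivity (cint (fun y => \sum_l A a l * F y l b)).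
  by apply: cint_eq => y _; rewrite mxE.
rewrite cint_sum => [|l _]; last exact/cintgZ/iF.
by apply: eq_bigr => l _; rewrite mxE cintZ.
Qed.

Lemma cintmxMr n p q s (A : 'M[C]_(q, s)) (F : pt R n -> 'M[C]_(p, q)) :
  cintgmx F -> cintmx (fun y => F y *m A) = cintmx F *m A.
Proof.
move=> iF; apply/matrixP => a b; rewrite !mxE.
transitivity (cint (fun y => \sum_l A l b * F y a l)).
  by apply: cint_eq => y _; rewrite mxE; apply: eq_bigr => l _; rewrite mulrC.
rewrite cint_sum => [|l _]; last exact/cintgZ/iF.
by apply: eq_bigr => l _; rewrite mxE cintZ// mulrC.
Qed.

Lemma ucmx_eq n p q (F G : pt R n -> 'M[C]_(p, q)) :
  (forall y, cube R n y -> F y = G y) -> ucmx F -> ucmx G.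
Proof. by move=> FG uF a b; apply: ucont_eq (uF a b) => y /FG ->. Qed.

Lemma ucmx_avg N j p q (F : pt R N -> 'M[C]_(p, q)) : ucmx F -> ucmx (avgmx j F).
Proof.
by move=> uF a b; apply: ucont_eq (ucont_avg j (uF a b)) => k _; rewrite mxE.
Qed.

Lemma ucmx_section N j p q (F : pt R N -> 'M[C]_(p, q)) k : cube R N k ->
  ucmx F -> ucmx (fun y : pt R j => F (splice y k)).
Proof. by move=> Qk uF a b; exact: ucont_section _ Qk (uF a b). Qed.

Lemma cont_cube_mxP n p q (F : pt R n -> 'M[C]_(p, q)) : cont_cube_mx F <-> ucmx F.
Proof. by split=> h a b; apply/cont_cubeP; exact: h. Qed.

Lemma avgmx_splice N i j p q (F : pt R N -> 'M[C]_(p, q)) (y : pt R j) k : (j <= i)%N ->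
  avgmx i F (splice y k) = avgmx i F k.
Proof. by move=> ji; apply/matrixP => a b; rewrite !mxE avg_splice. Qed.

Lemma avgmx_eq N j p q (F G : pt R N -> 'M[C]_(p, q)) k : cube R N k ->
  (forall x, cube R N x -> F x = G x) -> avgmx j F k = avgmx j G k.
Proof. by move=> Qk FG; apply: cintmx_eq => y Qy; apply: FG; exact: cube_splice. Qed.

End matrix_integral.

(** * Square integrable functions *)

Section L2_space.
Variables (R : realType) (N : nat).
Local Notation C := (Cplx R).

Lemma L2_cmeas M (u : vfun R N M) : L2 u -> forall i, cmeas (fun k => u k i ord0).
Proof. by move=> Lu i; exact: (proj1 Lu i). Qed.

Lemma measurable_sqr_cabs n (g : pt R n -> C) : cmeas g ->
  measurable_fun (cube R n) (fun y => (cabs (g y) ^+ 2)%:E).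
Proof.
move=> [g1 g2]; apply/measurable_EFinP.
apply: (eq_measurable_fun (fun y => complex.Re (g y) ^+ 2 + complex.Im (g y) ^+ 2)).
  by move=> y _; rewrite cabs_sqr.
by apply: measurable_funD; exact: measurable_funX.
Qed.

Lemma integral_sqnorm M (u : vfun R N M) : (forall i, cmeas (fun k => u k i ord0)) ->
  (\int[leb R N]_(k in cube R N) (sqnorm u k)%:E =
   \sum_i \int[leb R N]_(k in cube R N) (cabs (u k i ord0) ^+ 2)%:E)%E.
Proof.
move=> mu; rewrite -ge0_integral_sum//.
- by apply: eq_integral => k _; rewrite /sqnorm sumEFin.
- by move=> i; exact: measurable_sqr_cabs.
- by move=> i k _; rewrite lee_fin sqr_ge0.
Qed.

Lemma cintg_sqr n (g : pt R n -> C) : cmeas g ->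
  (\int[leb R n]_(y in cube R n) (cabs (g y) ^+ 2)%:E < +oo)%E -> cintg g.
Proof.
move=> mg gfin; have [g1 g2] := mg.
have le (f : pt R n -> R) : measurable_fun (cube R n) f ->
    (forall y, f y ^+ 2 <= cabs (g y) ^+ 2) ->
    (\int[leb R n]_(y in cube R n) (f y ^+ 2)%:E < +oo)%E.
  move=> mf fg; apply: le_lt_trans gfin; apply: ge0_le_integral => //.
  - by move=> y _; rewrite lee_fin sqr_ge0.
  - by apply/measurable_EFinP; exact: measurable_funX.
  - exact: measurable_sqr_cabs.
  - by move=> y _; rewrite lee_fin.
split; apply: rintg_sqr => //; apply: le => // y; rewrite cabs_sqr.
  by rewrite lerDl sqr_ge0.
by rewrite lerDr sqr_ge0.
Qed.

Lemma L2_cintg M (u : vfun R N M) : L2 u -> forall i, cintg (fun k => u k i ord0).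
Proof.
move=> Lu i; have mu := L2_cmeas Lu; apply: cintg_sqr (mu i) _.
case: Lu => _; rewrite (integral_sqnorm mu); apply: le_lt_trans.
rewrite (bigD1 i)//= leeDl// sume_ge0// => l _.
by apply: integral_ge0 => k _; rewrite lee_fin sqr_ge0.
Qed.

Lemma L2_ucmx M (u : vfun R N M) : ucmx u -> L2 u.
Proof.
move=> uu; have mu i : cmeas (fun k => u k i ord0) by exact: ucont_measurable (uu i ord0).
split; first exact: mu.
rewrite (integral_sqnorm mu); apply: lte_sum_pinfty => i _.
have [c c0 hc] := ucont_bounded (uu i ord0).
apply: (@le_lt_trans _ _ (c ^+ 2)%:E); last exact: ltry.
rewrite -(integral_cube_cst N (c ^+ 2)%:E); apply: ge0_le_integral => //.
- by move=> y _; rewrite lee_fin sqr_ge0.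
- exact: measurable_sqr_cabs.
- by move=> y Qy; rewrite lee_fin ler_pXn2r ?nnegrE ?cabs_ge0 ?(ltW c0)//; exact: hc.
Qed.

End L2_space.

Lemma sqr_cabsE (R : realType) (z : Cplx R) : ((cabs z ^+ 2)%:C)%C = z * z^*%C.
Proof. by rewrite rmorphXn -sqr_normc. Qed.

(** * The kernels determined by an operator *)

Section kernel_uniqueness.
Variables (R : realType) (N M : nat) (r r' : hrep R N M).
Local Notation C := (Cplx R).
Hypothesis rr' : oper_eq (oper_of r) (oper_of r').

Lemma ucmx_rA0 (s : hrep R N M) : ucmx (rA0 s).
Proof. exact/cont_cube_mxP/rA0_cont. Qed.

Lemma ucmx_rA (s : hrep R N M) j : (1 <= j <= N)%N -> ucmx (rA s j).
Proof. by move=> jN; exact/cont_cube_mxP/rA_cont. Qed.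

Lemma ucmx_rB (s : hrep R N M) j : (1 <= j <= N)%N -> ucmx (rB s j).
Proof. by move=> jN; exact/cont_cube_mxP/rB_cont. Qed.

Lemma ucmx_rB_section (s : hrep R N M) j k : (1 <= j <= N)%N -> cube R N k ->
  ucmx (fun y : pt R j => rB s j (splice y k)).
Proof.
move=> jN Qk a b; exact: (ucont_section j Qk (ucmx_rB jN a b)).
Qed.

Lemma ucmx_oper_of (s : hrep R N M) (u : vfun R N M) : ucmx u -> ucmx (oper_of s u).
Proof.
move=> uu; apply: ucmxD; first exact: ucmxM (ucmx_rA0 s) uu.
rewrite (_ : (fun k => _) = fun k => \sum_(1 <= j < N.+1 | (1 <= j < N.+1)%N)
    rA s j k *m avgmx j (fun x => rB s j x *m u x) k); last first.
  by apply/funext => k; rewrite big_nat.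
apply: ucmx_sum => j jN; apply: ucmxM; first exact: ucmx_rA.
by apply: ucmx_avg; apply: ucmxM => //; exact: ucmx_rB.
Qed.

(** Operators given by continuous coefficients send continuous functions to continuous functions, so
    equality almost everywhere becomes equality at each point. This is what allows a point [k] to be
    fixed before the test function is chosen. *)
Lemma oper_of_eq_pointwise (u : vfun R N M) : ucmx u ->
  forall k, cube R N k -> oper_of r u k = oper_of r' u k.
Proof.
move=> uu k Qk; apply/matrixP => a b; apply/eqP; rewrite -subr_eq0; apply/eqP.
pose f (x : pt R N) : C := oper_of r u x a b - oper_of r' u x a b.
have uf : ucont f by apply: ucontB; exact: ucmx_oper_of.
apply: (ucont_ae0 (p := k) uf) => //.
have /L2eqE := rr' (L2_ucmx uu).
by apply: aecS => x _ h _; rewrite /f h subrr.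
Qed.

Lemma oper_of_term (s : hrep R N M) (u : vfun R N M) j k : (1 <= j <= N)%N -> ucmx u ->
  cube R N k -> rA s j k *m avgmx j (fun x => rB s j x *m u x) k =
  cintmx (fun y : pt R j => (rA s j k *m rB s j (splice y k)) *m u (splice y k)).
Proof.
move=> jN uu Qk; rewrite avgmxE -cintmxMl.
  by apply: cintmx_eq => y _; rewrite mulmxA.
apply: cintgmx_ucmx; apply: (ucmx_section _ Qk (F := fun x => rB s j x *m u x)) => //.
by apply: ucmxM => //; exact: ucmx_rB.
Qed.

Let t j k (x : pt R N) (jN : (j < N)%N) : C :=
  ((tnth x (Ordinal jN) : R)%:C)%C - ((tnth k (Ordinal jN) : R)%:C)%C.

(* At a fixed [k], test with [u x = (x_j - k_j)^2 w x]: the factor kills the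
   terms of level [i < j], for which [x_j = k_j], and the terms of level [i > j]
   vanish by downward induction; [w] is then chosen as the conjugate of an entry
   of the difference of the two kernels. *)
Lemma kernel_unique j k (y : pt R j) : (1 <= j <= N)%N -> cube R N k -> cube R j y ->
  rA r j k *m rB r j (splice y k) = rA r' j k *m rB r' j (splice y k).
Proof.
move=> jN Qk Qy; move: y Qy.
pose G i (x : pt R N) := rA r i k *m rB r i x - rA r' i k *m rB r' i x.
have uG i : (1 <= i <= N)%N -> ucmx (G i).
  move=> iN; apply: ucmxD; last apply: ucmxN.
    by apply: ucmxM; [exact: ucmx_cst|exact: ucmx_rB].
  by apply: ucmxM; [exact: ucmx_cst|exact: ucmx_rB].
suff : forall y : pt R j, cube R j y -> G j (splice y k) = 0.
  by move=> h y Qy; apply/eqP; rewrite -subr_eq0; apply/eqP; exact: h.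
move: jN; have [m] := ubnP (N - j); elim: m j => // m ih j; rewrite ltnS => jm jN.
have {ih} G0 i : (j < i <= N)%N -> forall y : pt R i, cube R i y -> G i (splice y k) = 0.
  move=> /andP[ji iN]; apply: ih; last by rewrite (leq_ltn_trans _ ji).
  by apply: leq_trans jm; apply: ltn_sub2l => //; exact: leq_trans iN.
have j1N : (j.-1 < N)%N by case/andP: jN; case: (j).
have j1j : (j.-1 < j)%N by case/andP: jN; case: (j).
(* Coordinates are counted from 0: the last variable of a slice of level [j] has index [j.-1], and
   it is overwritten by [splice] at level [j] but not at lower levels. *)
pose T (x : pt R N) : C := t k x j1N.
have uT : ucont T.
  by apply: ucontB; [exact: ucont_tnth|exact: ucont_cst].
have T0 i (y : pt R i) : (i < j)%N -> T (splice y k) = 0.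
  move=> ij; rewrite /T /t tnth_splice_ge ?subrr//=.
  by rewrite -ltnS prednK//; case/andP: jN.
have TJ x : (T x)^*%C = T x by rewrite /T /t -rmorphB; exact: conjc_real.
have conjM (z w : C) : (z * w)^*%C = z^*%C * w^*%C by exact: rmorphM.
have key a b (y : pt R j) : cube R j y -> T (splice y k) * G j (splice y k) a b = 0.
  (* The real factor [T] occurs twice so that the entry [a] of [G j x *m u x] is the squared modulus
     of [T x * G j x a b]; a vanishing integral then forces this product to vanish. *)
  pose u (x : pt R N) : 'cV[C]_M := \col_c (if c == b then T x * (T x * (G j x a b)^*%C) else 0).
  have uu : ucmx u.
    move=> c z; apply: (ucont_eq (f := fun x => if c == b then T x * (T x * (G j x a b)^*%C) else 0)).
      by move=> x _; rewrite [RHS]mxE.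
    case: eqP => _; last exact: ucont_cst.
    by do 2 apply: ucontM => //; apply: ucont_conj; exact: uG.
  have uTT x : T x = 0 -> u x = 0.
    by move=> Tx; apply/matrixP => c z; rewrite [LHS]mxE [RHS]mxE Tx mul0r; case: ifP.
  have := oper_of_eq_pointwise uu Qk; rewrite /oper_of.
  (* This removes the multiplication terms: splicing no variable at all returns [k], where [T]
     vanishes. *)
  have -> : u k = 0.
    apply: uTT; have := T0 0%N [tuple]; rewrite splice0; apply.
    by case/andP: jN.
  rewrite !mulmx0 !add0r => /eqP; rewrite -subr_eq0 -sumrB => /eqP h.
  have int0 : cintmx (fun y : pt R j => G j (splice y k) *m u (splice y k)) = 0.
    rewrite -[RHS]h (bigD1_seq j)/= ?mem_index_iota ?iota_uniq//.
    rewrite [X in _ + X]big_nat_cond big1 ?addr0.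
      rewrite !oper_of_term// -cintmxB.
      - by apply: cintmx_eq => z _; rewrite mulmxBl.
      - apply: cintgmx_ucmx; apply: ucmxM; last exact: (ucmx_section _ Qk uu).
        by apply: ucmxM; [exact: ucmx_cst|exact: ucmx_rB_section].
      - apply: cintgmx_ucmx; apply: ucmxM; last exact: (ucmx_section _ Qk uu).
        by apply: ucmxM; [exact: ucmx_cst|exact: ucmx_rB_section].
    move=> i /andP[iN ij]; rewrite !oper_of_term//.
    rewrite -cintmxB; last 2 first.
    - apply: cintgmx_ucmx; apply: ucmxM; last exact: (ucmx_section _ Qk uu).
      by apply: ucmxM; [exact: ucmx_cst|exact: ucmx_rB_section].
    - apply: cintgmx_ucmx; apply: ucmxM; last exact: (ucmx_section _ Qk uu).
      by apply: ucmxM; [exact: ucmx_cst|exact: ucmx_rB_section].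
    rewrite -[RHS](cintmx_cst i); apply: cintmx_eq => z Qz; rewrite -mulmxBl.
    move: ij; rewrite neq_ltn => /orP[ij|ji].
      by rewrite uTT ?mulmx0// T0.
    by rewrite [X in X *m _](G0 i _ z Qz) ?mul0mx// ji; case/andP: iN.
  have uf : ucont (fun y : pt R j => T (splice y k) * G j (splice y k) a b).
    by apply: ucontM; [exact: (ucont_section _ Qk uT)|exact: (ucont_section _ Qk (uG j jN a b))].
  apply: (ucont_sqr_int0 y uf).
  have /matrixP/(_ a ord0) := int0; rewrite !mxE.
  have -> : cint (fun y : pt R j => (G j (splice y k) *m u (splice y k)) a ord0) =
     cint (fun y : pt R j => ((cabs (T (splice y k) * G j (splice y k) a b) ^+ 2)%:C)%C).
    apply: cint_eq => z _; rewrite mxE (bigD1 b)//= big1 ?addr0.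
      rewrite [u _ _ _]mxE eqxx sqr_cabsE conjM TJ; ring.
    by move=> c /negbTE cb; rewrite [u _ _ _]mxE cb mulr0.
  move=> /(congr1 (@complex.Re R)) /= /eqP.
  have := ucont_measurable uf => mf.
  rewrite /Rintegral fine_eq0; first by move/eqP.
  rewrite ge0_fin_numE; last by apply: integral_ge0 => z _; rewrite lee_fin sqr_ge0.
  have [c c0 hc] := ucont_bounded uf.
  apply: (@le_lt_trans _ _ (c ^+ 2)%:E); last exact: ltry.
  rewrite -(integral_cube_cst j (c ^+ 2)%:E); apply: ge0_le_integral => //.
  - by move=> z _; rewrite lee_fin sqr_ge0.
  - exact: measurable_sqr_cabs.
  - by move=> z Qz; rewrite lee_fin ler_pXn2r ?nnegrE ?cabs_ge0 ?(ltW c0)//; exact: hc.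
move=> y Qy; apply/matrixP => a b; rewrite [RHS]mxE; move: y Qy.
have jN' : (j <= N)%N by case/andP: jN.
(* Where the last variable equals that of [k] the factor [T] is 0 and [key] is silent. These points
   lie on a hyperplane that [ucont_ae0] leaves out. *)
apply: (ucont_ae0 (p := [tuple tnth k (widen_ord jN' i) | i < j])).
  exact: (ucont_section _ Qk (uG j jN a b)).
apply: aecW => z Qz /(_ (Ordinal j1j)); rewrite tnth_mktuple => zk.
have /eqP := key a b z Qz; rewrite mulf_eq0 => /orP[|/eqP//].
rewrite /T /t subr_eq0 => /eqP/complexI Te; case/eqP: zk.
rewrite -(@tnth_splice_lt R N j z k (Ordinal j1N) j1j) Te.
by congr tnth; exact: val_inj.
Qed.

(** Once the kernels agree, the integral terms cancel, and constant basis vectors as test functions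
    read off the columns of [rA0]. *)
Lemma rA0_unique k : cube R N k -> rA0 r k = rA0 r' k.
Proof.
move=> Qk; apply/matrixP => a b.
pose u (x : pt R N) : 'cV[C]_M := delta_mx b ord0.
have uu : ucmx u by exact: ucmx_cst.
have := oper_of_eq_pointwise uu Qk; rewrite /oper_of.
have -> : \sum_(1 <= j < N.+1) rA r j k *m avgmx j (fun x => rB r j x *m u x) k =
    \sum_(1 <= j < N.+1) rA r' j k *m avgmx j (fun x => rB r' j x *m u x) k.
  rewrite big_nat [RHS]big_nat; apply: eq_bigr => j jN.
  rewrite (oper_of_term r jN uu Qk) (oper_of_term r' jN uu Qk).
  by apply: cintmx_eq => y Qy; congr (_ *m _); exact: kernel_unique.
move=> /addIr; rewrite /u -!colE => /matrixP/(_ a ord0).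
by rewrite !mxE.
Qed.

End kernel_uniqueness.

(** * Independence of the representation *)

Section factorizations_of_a_kernel.
Variables (R : realType) (n p m m' : nat).
Local Notation C := (Cplx R).
Variables (a : pt R n -> 'M[C]_(p, m)) (b : pt R n -> 'M[C]_(m, p)).
Variables (a' : pt R n -> 'M[C]_(p, m')) (b' : pt R n -> 'M[C]_(m', p)).
Hypotheses (ua : ucmx a) (ub : ucmx b) (ua' : ucmx a') (ub' : ucmx b').
Hypothesis ab : forall z y, cube R n z -> cube R n y -> a z *m b y = a' z *m b' y.

Let D := cintmx (fun z => b z *m a z).
Let D' := cintmx (fun z => b' z *m a' z).
Let G := cintmx (fun z => b z *m a' z).
Let G' := cintmx (fun z => b' z *m a z).

(** Multiply the hypothesis by [a y] on the right and integrate over [y]; [mulG] does the same with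
    [a' y]. *)
Let mulD q (x : 'M[C]_(q, m)) (x' : 'M[C]_(q, m')) :
  (forall y, cube R n y -> x *m b y = x' *m b' y) -> x *m D = x' *m G'.
Proof.
move=> h; rewrite -!cintmxMl; last 2 first.
- by apply: cintgmx_ucmx; exact: ucmxM.
- by apply: cintgmx_ucmx; exact: ucmxM.
by apply: cintmx_eq => y Qy; rewrite !mulmxA h.
Qed.

Let mulG q (x : 'M[C]_(q, m)) (x' : 'M[C]_(q, m')) :
  (forall y, cube R n y -> x *m b y = x' *m b' y) -> x *m G = x' *m D'.
Proof.
move=> h; rewrite -!cintmxMl; last 2 first.
- by apply: cintgmx_ucmx; exact: ucmxM.
- by apply: cintgmx_ucmx; exact: ucmxM.
by apply: cintmx_eq => y Qy; rewrite !mulmxA h.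
Qed.

Let int_mul q s (f : pt R n -> 'M[C]_(q, p)) (g : pt R n -> 'M[C]_(p, s))
    t (x : 'M[C]_(s, t)) : ucmx f -> ucmx g ->
  cintmx (fun z => f z *m g z) *m x = cintmx (fun z => f z *m (g z *m x)).
Proof.
move=> uf ug; rewrite -cintmxMr; last by apply: cintgmx_ucmx; exact: ucmxM.
by apply: cintmx_eq => z _; rewrite mulmxA.
Qed.

(** Each of the four products is an integral over [z] of one factor times an expression such as
    [a z *m D], which [mulD] or [mulG] rewrites under the integral because [ab] holds for every
    second argument. *)
Lemma det_1add_cintmx : \det (1%:M + D) = \det (1%:M + D').
Proof.
apply: (@det_1add_intertwined _ _ _ D G G' D').
- rewrite [LHS](int_mul D ub ua) [RHS](int_mul G' ub ua').
  by apply: cintmx_eq => z Qz; congr (_ *m _); apply: mulD => y; exact: ab.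
- rewrite [LHS](int_mul G ub ua) [RHS](int_mul D' ub ua').
  by apply: cintmx_eq => z Qz; congr (_ *m _); apply: mulG => y; exact: ab.
- rewrite [LHS](int_mul D ub' ua) [RHS](int_mul G' ub' ua').
  by apply: cintmx_eq => z Qz; congr (_ *m _); apply: mulD => y; exact: ab.
- rewrite [LHS](int_mul D' ub' ua') [RHS](int_mul G ub' ua).
  by apply: cintmx_eq => z Qz; congr (_ *m _); symmetry; apply: mulG => y; exact: ab.
Qed.

Lemma resolvent_cintmx q (x : 'M[C]_(q, m)) (x' : 'M[C]_(q, m')) y :
  1%:M + D \in unitmx -> 1%:M + D' \in unitmx -> cube R n y ->
  (forall y, cube R n y -> x *m b y = x' *m b' y) ->
  x *m invmx (1%:M + D) *m b y = x' *m invmx (1%:M + D') *m b' y.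
Proof.
move=> uD uD' Qy h; apply: (@resolvent_intertwined _ _ _ _ _ D G' D') => //.
- rewrite [LHS](int_mul D ub' ua) [RHS](int_mul G' ub' ua').
  by apply: cintmx_eq => z Qz; congr (_ *m _); apply: mulD => w; exact: ab.
- exact: mulD.
- rewrite [LHS](int_mul (b y) ub' ua) [RHS](int_mul (b' y) ub' ua').
  by apply: cintmx_eq => z Qz; congr (_ *m _); exact: ab.
- exact: h.
Qed.

End factorizations_of_a_kernel.

Section independence_of_representation.
Variables (R : realType) (N M : nat).
Local Notation C := (Cplx R).
Implicit Types r : hrep R N M.

(** A uniform bound is what makes the inverse matrices uniformly continuous; for the family [rep_1D]
    with small parameter it is [2^-1]. *)
Definition nonvanishing (c : R) r :=
  (forall k, cube R N k -> c <= cabs (\det (rA0 r k))) /\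
  (forall j k, (1 <= j <= N)%N -> cube R N k -> c <= cabs (\det (Emx r j k))).

Lemma unitmx_cabs (c : R) m (A : 'M[C]_m) : 0 < c -> c <= cabs (\det A) -> A \in unitmx.
Proof. by move=> c0 h; rewrite unitmxE unitfE -cabs_gt0; exact: lt_le_trans h. Qed.

Lemma ucmx_Emx r j : (1 <= j <= N)%N -> ucmx (Ared r j.-1 j) -> ucmx (Emx r j).
Proof.
move=> jN uA; apply: ucmxD; first exact: ucmx_cst.
by apply: ucmx_avg; apply: ucmxM => //; exact: ucmx_rB.
Qed.

Lemma ucmx_Ared_rec (c : R) r j : 0 < c -> (1 <= j <= N)%N ->
  (forall k, cube R N k -> c <= cabs (\det (Emx r j k))) ->
  (forall i, (1 <= i <= N)%N -> ucmx (Ared r j.-1 i)) ->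
  forall i, (1 <= i <= N)%N -> ucmx (Ared r j i).
Proof.
case: j => // j c0 jN hE uA i iN; apply: ucmxD; first exact: uA.
apply: ucmxN; apply: ucmxM; last first.
  by apply: ucmx_avg; apply: ucmxM; [exact: ucmx_rB|exact: uA].
by apply: ucmxM; [exact: uA|exact: (ucmx_inv c0 hE (ucmx_Emx jN (uA _ jN)))].
Qed.

Section two_representations.
Variables (c : R) (r r' : hrep R N M).
Hypotheses (c0 : 0 < c) (ndr : nonvanishing c r).
Hypothesis rr' : oper_eq (oper_of r) (oper_of r').

(** The invariant of the elimination. The factors [A_{i,j}] of the two representations are not
    comparable; what agrees is the kernel [A_{i,j} B_i] of every level [i > j] still to be
    eliminated. *)
Let stage j := [/\
  forall i, (1 <= i <= N)%N -> ucmx (Ared r j i),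
  forall i, (1 <= i <= N)%N -> ucmx (Ared r' j i) &
  forall i k (y : pt R i), (j < i <= N)%N -> cube R N k -> cube R i y ->
    Ared r j i k *m rB r i (splice y k) = Ared r' j i k *m rB r' i (splice y k)].

Let stage0 : stage 0.
Proof.
have [h0 _] := ndr.
have A0E k : cube R N k -> rA0 r k = rA0 r' k by exact: rA0_unique.
split.
- move=> i iN; apply: ucmxM; last exact: ucmx_rA.
  exact: (ucmx_inv c0 h0 (@ucmx_rA0 _ _ _ r)).
- move=> i iN; apply: ucmxM; last exact: ucmx_rA.
  apply: (ucmx_inv c0 _ (@ucmx_rA0 _ _ _ r')) => k Qk.
  by rewrite -A0E//; exact: h0.
- move=> i k y iN Qk Qy /=; rewrite -!mulmxA A0E//; congr (_ *m _).
  exact: (kernel_unique rr').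
Qed.

Let stage_Emx j : (1 <= j <= N)%N -> stage j.-1 ->
  forall k, cube R N k -> \det (Emx r j k) = \det (Emx r' j k).
Proof.
move=> jN [uA uA' K] k Qk.
apply: (@det_1add_cintmx R j M _ _ (fun z : pt R j => Ared r j.-1 j (splice z k))
   (fun z : pt R j => rB r j (splice z k)) (fun z : pt R j => Ared r' j.-1 j (splice z k))
   (fun z : pt R j => rB r' j (splice z k))).
- exact: (@ucmx_section R N j _ _ _ k Qk (uA _ jN)).
- exact: ucmx_rB_section.
- exact: (@ucmx_section R N j _ _ _ k Qk (uA' _ jN)).
- exact: ucmx_rB_section.
move=> z y Qz Qy; have := K j (splice z k) y; rewrite splice_splice//; apply => //.
  by case/andP: jN; case: (j) => // j' _ ->; rewrite ltnS leqnn.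
exact: cube_splice.
Qed.

Let stageS j : (1 <= j <= N)%N -> stage j.-1 -> stage j.
Proof.
move=> jN st; have [uA uA' K] := st.
have [_ hE] := ndr.
have dE := stage_Emx jN st.
have hE' k : cube R N k -> c <= cabs (\det (Emx r' j k)).
  by move=> Qk; rewrite -dE//; exact: hE.
split.
- by apply: (ucmx_Ared_rec c0 jN) => // k; exact: hE.
- exact: (ucmx_Ared_rec c0 jN).
case: j => // j in jN st uA uA' K hE dE hE' *.
move=> i k y /andP[ji iN] Qk Qy /=.
have iN' : (1 <= i <= N)%N by rewrite (leq_trans _ ji).
have jiN : (j < i <= N)%N by rewrite (ltnW ji).
rewrite !mulmxBl K//; congr (_ - _).
(* With the outer factors moved under the average, the subtracted term is an integral of a product
   of two kernels: [A E^-1 B] of level [j.+1], handled by [resolvent_cintmx], and [A_{i,j} B_i],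
   handled by the invariant. *)
have pull (s : hrep R N M) : (forall i, (1 <= i <= N)%N -> ucmx (Ared s j i)) ->
    Ared s j j.+1 k *m invmx (Emx_of (Ared s j j.+1) k) *m
      avgmx j.+1 (fun x => rB s j.+1 x *m Ared s j i x) k *m rB s i (splice y k) =
    cintmx (fun z : pt R j.+1 => Ared s j j.+1 k *m invmx (Emx s j.+1 k) *m
       rB s j.+1 (splice z k) *m (Ared s j i (splice z k) *m rB s i (splice y k))).
  move=> us.
  have iBA : cintgmx (fun z : pt R j.+1 => rB s j.+1 (splice z k) *m Ared s j i (splice z k)).
    apply: cintgmx_ucmx; apply: ucmxM; first exact: ucmx_rB_section.
    exact: (@ucmx_section R N j.+1 _ _ _ k Qk (us _ iN')).
  rewrite avgmxE -cintmxMl// -cintmxMr; last exact: cintgmxMl.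
  by apply: cintmx_eq => z _; rewrite /Emx !mulmxA.
rewrite (pull r uA) (pull r' uA'); apply: cintmx_eq => z Qz; congr (_ *m _); last first.
  have := K i (splice z k) y; rewrite splice_splice//; last exact: ltnW.
  by apply => //; exact: cube_splice.
apply: (@resolvent_cintmx R j.+1 M _ _ (fun z : pt R j.+1 => Ared r j j.+1 (splice z k))
   (fun z : pt R j.+1 => rB r j.+1 (splice z k)) (fun z : pt R j.+1 => Ared r' j j.+1 (splice z k))
   (fun z : pt R j.+1 => rB r' j.+1 (splice z k))) => //.
- exact: (@ucmx_section R N j.+1 _ _ _ k Qk (uA _ jN)).
- exact: ucmx_rB_section.
- exact: (@ucmx_section R N j.+1 _ _ _ k Qk (uA' _ jN)).
- exact: ucmx_rB_section.
- move=> x w Qx Qw; have := K j.+1 (splice x k) w; rewrite splice_splice//; apply => //.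
    by rewrite ltnSn; case/andP: jN.
  exact: cube_splice.
- exact: unitmx_cabs c0 (hE _ _ jN Qk).
- exact: unitmx_cabs c0 (hE' _ Qk).
- by move=> w Qw; apply: K => //; rewrite ltnSn; case/andP: jN.
Qed.

Lemma pi_repr_unique : calC_eq (pi_repr r) (pi_repr r').
Proof.
have st j : (j <= N)%N -> stage j.
  elim: j => [_|j ih jN]; first exact: stage0.
  by apply: stageS => //; apply: ih; exact: ltnW.
move=> j k Qk; rewrite /pi_repr; case: eqP => [_|/eqP j0].
  by rewrite (rA0_unique rr' Qk).
have jN : (1 <= j <= N)%N by rewrite lt0n j0 -ltnS ltn_ord.
apply: stage_Emx => //; apply: st; apply: leq_trans (leq_pred _) _.
by rewrite -ltnS ltn_ord.
Qed.

End two_representations.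

End independence_of_representation.

(** * Bounded operators *)

Section bounded_operators.
Variables (R : realType) (N : nat).
Local Notation C := (Cplx R).
Local Notation vf M := (vfun R N M).
Local Notation sq u := (\int[leb R N]_(k in cube R N) (sqnorm u k)%:E)%E.

(** Source and target may have different dimensions, so that a term [A <B .>_j] can be treated as a
    composition of three operators. The constant bounds the square of the norm, and the integrals
    stay extended-real. *)
Definition bop M m (F : vf M -> vf m) := [/\
  forall u, L2 u -> L2 (F u),
  forall u v, L2 u -> L2 v -> L2eq u v -> L2eq (F u) (F v),
  forall (a b : C) u v, L2 u -> L2 v ->
    L2eq (F (fun k => a *: u k + b *: v k)) (fun k => a *: F u k + b *: F v k) &
  exists2 c : R, 0 <= c & forall u, L2 u -> (sq (F u) <= c%:E * sq u)%E].

Lemma L2P M (u : vf M) :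
  L2 u <-> (forall i, cmeas (fun k => u k i ord0)) /\ (sq u < +oo)%E.
Proof. by []. Qed.

Lemma sqnorm_ge0 M (u : vf M) k : 0 <= sqnorm u k.
Proof. by apply: sumr_ge0 => i _; exact: sqr_ge0. Qed.

Lemma sq_ge0 M (u : vf M) : (0 <= sq u)%E.
Proof. by apply: integral_ge0 => k _; rewrite lee_fin sqnorm_ge0. Qed.

Lemma measurable_sqnorm M (u : vf M) : (forall i, cmeas (fun k => u k i ord0)) ->
  measurable_fun (cube R N) (fun k => (sqnorm u k)%:E).
Proof.
move=> mu; apply/measurable_EFinP; apply: measurable_sum => i.
by apply/measurable_EFinP; exact: measurable_sqr_cabs.
Qed.

Lemma sq_le M m (u : vf M) (v : vf m) (c : R) : 0 <= c ->
  (forall i, cmeas (fun k => u k i ord0)) -> (forall i, cmeas (fun k => v k i ord0)) ->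
  (forall k, cube R N k -> sqnorm v k <= c * sqnorm u k) -> (sq v <= c%:E * sq u)%E.
Proof.
move=> c0 mu mv h; rewrite -ge0_integralZl//.
- apply: ge0_le_integral => //.
  + by move=> k _; rewrite lee_fin sqnorm_ge0.
  + exact: measurable_sqnorm.
  + by apply: measurable_funeM; exact: measurable_sqnorm.
- exact: measurable_sqnorm.
- by move=> k _; rewrite lee_fin sqnorm_ge0.
Qed.

Lemma L2_lin M (a b : C) (u v : vf M) : L2 u -> L2 v ->
  L2 (fun k => a *: u k + b *: v k).
Proof.
move=> /L2P[mu u2] /L2P[mv v2].
have mw i : cmeas (fun k => (a *: u k + b *: v k) i ord0).
  apply: (@cmeas_eq _ _ (fun k => a * u k i ord0 + b * v k i ord0)).
    by move=> k _; rewrite !mxE.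
  by apply: cmeasD; apply: cmeasM => //; exact: cmeas_cst.
split; first exact: mw.
pose c := 2 * (cabs a ^+ 2 + cabs b ^+ 2).
have c0 : 0 <= c by rewrite mulr_ge0// addr_ge0// sqr_ge0.
apply: (@le_lt_trans _ _ (c%:E * (sq u + sq v))%E).
  rewrite -ge0_integralD//; last 4 first.
  - by move=> k _; rewrite lee_fin sqnorm_ge0.
  - exact: measurable_sqnorm.
  - by move=> k _; rewrite lee_fin sqnorm_ge0.
  - exact: measurable_sqnorm.
  rewrite -ge0_integralZl//; last 2 first.
  - by apply: emeasurable_funD; exact: measurable_sqnorm.
  - by move=> k _; rewrite -EFinD lee_fin addr_ge0// sqnorm_ge0.
  apply: ge0_le_integral => //.
  - by move=> k _; rewrite lee_fin sqnorm_ge0.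
  - exact: measurable_sqnorm.
  - by apply: measurable_funeM; apply: emeasurable_funD; exact: measurable_sqnorm.
  move=> k _; rewrite -EFinD -EFinM lee_fin /sqnorm -big_split/= mulr_sumr.
  apply: ler_sum => i _; rewrite !mxE.
  have h := cabsD (a * u k i ord0) (b * v k i ord0); rewrite !cabsM in h.
  apply: (@le_trans _ _ ((cabs a * cabs (u k i ord0) + cabs b * cabs (v k i ord0)) ^+ 2)).
    by rewrite ler_pXn2r ?nnegrE ?addr_ge0 ?mulr_ge0 ?cabs_ge0.
  rewrite /c; move: (cabs a) (cabs b) (cabs (u k i ord0)) (cabs (v k i ord0)) => x y z w.
  rewrite -subr_ge0 (_ : _ - _ = (x * z - y * w) ^+ 2 + 2 * ((x * w) ^+ 2 + (y * z) ^+ 2)).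
    by rewrite addr_ge0 ?sqr_ge0 ?mulr_ge0 ?addr_ge0 ?sqr_ge0.
  by ring.
have : sq u \is a fin_num by rewrite ge0_fin_numE// sq_ge0.
have : sq v \is a fin_num by rewrite ge0_fin_numE// sq_ge0.
by move=> /fineK <- /fineK <-; rewrite -EFinD -EFinM ltry.
Qed.

Lemma L2_eq M (u v : vf M) : (forall k, cube R N k -> u k = v k) -> L2 u -> L2 v.
Proof.
move=> uv /L2P[mu u2]; apply/L2P; split.
  by move=> i; apply: cmeas_eq (mu i) => k /uv ->.
by rewrite (eq_integral (fun k => (sqnorm u k)%:E))// => k /set_mem Qk; rewrite /sqnorm uv.
Qed.

Lemma L2eq_refl M (u : vf M) : L2eq u u.
Proof. by apply/L2eqE; exact: aecW. Qed.

Lemma L2eq_trans M (u v w : vf M) : L2eq u v -> L2eq v w -> L2eq u w.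
Proof. by move=> /L2eqE uv /L2eqE vw; apply/L2eqE; apply: aecS2 uv vw => k _ -> ->. Qed.

Lemma L2eq_sym M (u v : vf M) : L2eq u v -> L2eq v u.
Proof. by move=> /L2eqE uv; apply/L2eqE; apply: aecS uv => k _ ->. Qed.

Lemma bop_id M : bop (fun u : vf M => u).
Proof.
split=> //.
- by move=> a b u v _ _; exact: L2eq_refl.
- by exists 1 => // u _; rewrite mul1e.
Qed.

Lemma bop_comp M m p (F : vf m -> vf p) (G : vf M -> vf m) : bop F -> bop G ->
  bop (F \o G).
Proof.
move=> [F1 F2 F3 [c c0 F4]] [G1 G2 G3 [d d0 G4]]; split.
- by move=> u Lu; apply/F1/G1.
- by move=> u v Lu Lv uv; apply: F2; [exact: G1..|exact: G2].
- move=> a b u v Lu Lv; apply: L2eq_trans (F3 a b _ _ (G1 u Lu) (G1 v Lv)).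
  apply: F2; [|exact: L2_lin (G1 u Lu) (G1 v Lv)|exact: G3].
  by apply: G1; exact: L2_lin.
- exists (c * d); first exact: mulr_ge0.
  move=> u Lu; apply: le_trans (F4 _ (G1 u Lu)) _.
  by rewrite EFinM -muleA; apply: lee_wpmul2l; rewrite ?lee_fin//; exact: G4.
Qed.

Lemma bopD M m (F G : vf M -> vf m) (a b : C) : bop F -> bop G ->
  bop (fun u k => a *: F u k + b *: G u k).
Proof.
move=> [F1 F2 F3 [c c0 F4]] [G1 G2 G3 [d d0 G4]]; split.
- by move=> u Lu; apply: L2_lin; [exact: F1|exact: G1].
- move=> u v Lu Lv uv; apply/L2eqE.
  have /L2eqE := F2 u v Lu Lv uv; have /L2eqE := G2 u v Lu Lv uv.
  by apply: aecS2 => k _ -> ->.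
- move=> e f u v Lu Lv; apply/L2eqE.
  have /L2eqE := F3 e f u v Lu Lv; have /L2eqE := G3 e f u v Lu Lv.
  apply: aecS2 => k _ -> ->; rewrite !scalerDr !scalerA addrACA.
  by congr ((_ + _) + (_ + _)); rewrite mulrC.
- pose C1 := 2 * cabs a ^+ 2; pose C2 := 2 * cabs b ^+ 2.
  have C10 : 0 <= C1 by rewrite mulr_ge0 ?sqr_ge0.
  have C20 : 0 <= C2 by rewrite mulr_ge0 ?sqr_ge0.
  exists (C1 * c + C2 * d); first by rewrite addr_ge0 ?(mulr_ge0 C10 c0) ?(mulr_ge0 C20 d0).
  move=> u Lu; have /L2P[mF _] := F1 u Lu; have /L2P[mG _] := G1 u Lu.
  have /L2P[mH _] := L2_lin a b (F1 u Lu) (G1 u Lu).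
  apply: (@le_trans _ _ (C1%:E * sq (F u) + C2%:E * sq (G u))%E).
    rewrite -!ge0_integralZl//; last 4 first.
    - exact: measurable_sqnorm.
    - by move=> k _; rewrite lee_fin sqnorm_ge0.
    - exact: measurable_sqnorm.
    - by move=> k _; rewrite lee_fin sqnorm_ge0.
    rewrite -ge0_integralD//; last 4 first.
    - by move=> k _; rewrite -EFinM lee_fin mulr_ge0// sqnorm_ge0.
    - by apply: measurable_funeM; exact: measurable_sqnorm.
    - by move=> k _; rewrite -EFinM lee_fin mulr_ge0// sqnorm_ge0.
    - by apply: measurable_funeM; exact: measurable_sqnorm.
    apply: ge0_le_integral => //.
    - by move=> k _; rewrite lee_fin sqnorm_ge0.
    - exact: measurable_sqnorm.
    - by apply: emeasurable_funD; apply: measurable_funeM; exact: measurable_sqnorm.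
    move=> k _; rewrite -!EFinM -EFinD lee_fin /sqnorm !mulr_sumr -big_split/=.
    apply: ler_sum => i _; rewrite !mxE.
    have h := cabsD (a * F u k i ord0) (b * G u k i ord0); rewrite !cabsM in h.
    apply: (@le_trans _ _ ((cabs a * cabs (F u k i ord0) + cabs b * cabs (G u k i ord0)) ^+ 2)).
      by rewrite ler_pXn2r ?nnegrE ?addr_ge0 ?mulr_ge0 ?cabs_ge0.
    rewrite /C1 /C2; move: (cabs a) (cabs b) (cabs (F u k i ord0)) (cabs (G u k i ord0)) => x y z w.
    rewrite -subr_ge0 (_ : _ - _ = (x * z - y * w) ^+ 2) ?sqr_ge0//.
    by ring.
  have -> : ((C1 * c + C2 * d)%:E * sq u = (C1 * c)%:E * sq u + (C2 * d)%:E * sq u)%E.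
    by rewrite EFinD ge0_muleDl// lee_fin; [exact: mulr_ge0 C10 c0|exact: mulr_ge0 C20 d0].
  apply: leeD.
    by rewrite (EFinM C1 c) -muleA; apply: lee_wpmul2l; rewrite ?lee_fin//; exact: F4.
  by rewrite (EFinM C2 d) -muleA; apply: lee_wpmul2l; rewrite ?lee_fin//; exact: G4.
Qed.

Lemma bop_eq M m (F G : vf M -> vf m) : (forall u k, F u k = G u k) -> bop F -> bop G.
Proof.
by move=> FG; rewrite (_ : F = G)//; apply/funext => u; apply/funext => k; exact: FG.
Qed.

Lemma ucmx_bounded n p q (A : pt R n -> 'M[C]_(p, q)) : ucmx A ->
  exists2 c : R, 0 < c & forall k, cube R n k -> forall a b, cabs (A k a b) <= c.
Proof.
move=> uA.
have /choice[c hc] : forall ab : 'I_p * 'I_q, exists c : R,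
    0 < c /\ forall k, cube R n k -> cabs (A k ab.1 ab.2) <= c.
  by move=> ab; have [c c0 h] := ucont_bounded (uA ab.1 ab.2); exists c.
exists (1 + \sum_ab c ab).
  by rewrite ltr_wpDr// sumr_ge0// => ab _; exact/ltW/(hc ab).1.
move=> k Qk a b; apply: le_trans ((hc (a, b)).2 k Qk) _.
rewrite (bigD1 (a, b))//= addrCA lerDl addr_ge0// sumr_ge0// => ab _.
exact/ltW/(hc ab).1.
Qed.

Lemma cmeas_mulmx p q (A : pt R N -> 'M[C]_(p, q)) (u : vf q) : ucmx A ->
  (forall i, cmeas (fun k => u k i ord0)) -> forall i, cmeas (fun k => (A k *m u k) i ord0).
Proof.
move=> uA mu i; apply: (@cmeas_eq _ _ (fun k => \sum_l A k i l * u k l ord0)).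
  by move=> k _; rewrite mxE.
by apply: cmeas_sum => l _; apply: cmeasM => //; exact: ucont_measurable (uA i l).
Qed.

Lemma bop_mulmx p q (A : pt R N -> 'M[C]_(p, q)) : ucmx A ->
  bop (fun u : vf q => (fun k => A k *m u k) : vf p).
Proof.
move=> uA.
have [c c0 hc] := ucmx_bounded uA.
(* Each of the [p] coordinates of the product is a sum of [q] terms, hence at most [q * c] times the
   square root of [sqnorm u k]. *)
pose d := p%:R * (q%:R * c) ^+ 2 : R.
have d0 : 0 <= d by rewrite mulr_ge0 ?sqr_ge0.
have bnd (u : vf q) : (forall i, cmeas (fun k => u k i ord0)) ->
    (sq (fun k => A k *m u k) <= d%:E * sq u)%E.
  move=> mu; apply: sq_le => //; first exact: cmeas_mulmx.
  move=> k Qk; rewrite {1}/sqnorm.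
  apply: (@le_trans _ _ (\sum_(i < p) (q%:R * c) ^+ 2 * sqnorm u k)); last first.
    by rewrite sumr_const card_ord -[_ *+ p]mulr_natl mulrA.
  apply: ler_sum => i _; rewrite mxE.
  have s0 := sqnorm_ge0 u k.
  have -> : (q%:R * c) ^+ 2 * sqnorm u k = (q%:R * c * Num.sqrt (sqnorm u k)) ^+ 2.
    by rewrite [RHS]exprMn sqr_sqrtr.
  rewrite ler_pXn2r ?nnegrE ?cabs_ge0 ?mulr_ge0 ?sqrtr_ge0 ?(ltW c0)//.
  apply: le_trans (cabs_sum _ _ _) _.
  apply: (@le_trans _ _ (\sum_(l < q) c * Num.sqrt (sqnorm u k))); last first.
    by rewrite sumr_const card_ord -[_ *+ q]mulr_natl mulrA.
  apply: ler_sum => l _; rewrite cabsM; apply: ler_pM; rewrite ?cabs_ge0//; first exact: hc.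
  rewrite -[leLHS]ger0_norm ?cabs_ge0// -sqrtr_sqr ler_wsqrtr// /sqnorm (bigD1 l)//= lerDl.
  by apply: sumr_ge0 => b _; exact: sqr_ge0.
split.
- move=> u /L2P[mu u2]; apply/L2P; split; first exact: cmeas_mulmx.
  apply: le_lt_trans (bnd u mu) _.
  have : sq u \is a fin_num by rewrite ge0_fin_numE// sq_ge0.
  by move=> /fineK <-; rewrite -EFinM ltry.
- by move=> u v _ _ /L2eqE uv; apply/L2eqE; apply: aecS uv => k _ ->.
- by move=> a b u v _ _; apply/L2eqE; apply: aecW => k _; rewrite mulmxDr !scalemxAr.
- by exists d => // u /L2P[mu _]; exact: bnd.
Qed.

Lemma L2_section M j (u : vf M) : (j <= N)%N -> L2 u ->
  aec (fun k => cintgmx (fun y : pt R j => u (splice y k))).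
Proof.
move=> jN Lu.
have := aec_finType (fun i => cintg_section jN (L2_cintg Lu i)).
by apply: aecS => k _ h a b; rewrite (ord1 b); exact: h.
Qed.

(** Averaging is a contraction, by Jensen's inequality on each section and then [tonelli_splice]. It
    respects equality almost everywhere even though it reads values on slices that may be null,
    thanks to [aec_section]. *)
Lemma bop_avg M j : (j <= N)%N -> bop (fun u : vf M => avgmx j u : vf M).
Proof.
move=> jN.
have mavg (u : vf M) : (forall i, cmeas (fun k => u k i ord0)) ->
    forall i, cmeas (fun k => avgmx j u k i ord0).
  move=> mu i; apply: cmeas_eq (cmeas_avg j (mu i)) => k _.
  by rewrite mxE.
have bnd (u : vf M) : (forall i, cmeas (fun k => u k i ord0)) -> (sq (avgmx j u) <= sq u)%E.
  move=> mu; rewrite (integral_sqnorm mu) (integral_sqnorm (mavg u mu)).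
  apply: lee_sum => i _.
  have mi := measurable_sqr_cabs (mu i).
  rewrite -(tonelli_splice jN mi); last by move=> x _; rewrite lee_fin sqr_ge0.
  apply: ge0_le_integral => //.
  - by move=> k _; rewrite lee_fin sqr_ge0.
  - exact: (measurable_sqr_cabs (mavg u mu i)).
  - by apply: (@measurable_avg_ge0 R N j _ mi) => x _; rewrite lee_fin sqr_ge0.
  move=> k Qk; rewrite mxE cabs_sqr EFinD.
  have [m1 m2] := cmeas_section j Qk (mu i).
  apply: le_trans (leeD (sqr_rint_le m1) (sqr_rint_le m2)) _.
  rewrite -ge0_integralD//.
  - by under eq_integral do rewrite -EFinD -cabs_sqr.
  - by move=> y _; rewrite lee_fin sqr_ge0.
  - by apply/measurable_EFinP; exact: measurable_funX.
  - by move=> y _; rewrite lee_fin sqr_ge0.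
  - by apply/measurable_EFinP; exact: measurable_funX.
split.
- move=> u /L2P[mu u2]; apply/L2P; split; first exact: mavg.
  exact: le_lt_trans (bnd u mu) u2.
- move=> u v Lu Lv /L2eqE uv; apply/L2eqE.
  have := aec_section jN uv.
  apply: aecS => k Qk h; apply/matrixP => a b; rewrite !mxE (ord1 b).
  apply: cint_aec.
  + exact: cmeas_section Qk (L2_cmeas Lu a).
  + exact: cmeas_section Qk (L2_cmeas Lv a).
  + by apply: aecS h => y _ ->.
- move=> a b u v Lu Lv; apply/L2eqE.
  apply: aecS2 (L2_section jN Lu) (L2_section jN Lv) => k Qk iu iv.
  rewrite !avgmxE cintmxD; [|exact: cintgmxZ..].
  by rewrite !cintmxZ.
- by exists 1 => // u /L2P[mu _]; rewrite mul1e; exact: bnd.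
Qed.

Lemma bop_sum M m (I : Type) (s : seq I) (P : pred I) (F : I -> vf M -> vf m) :
  (forall i, P i -> bop (F i)) -> bop (fun u k => \sum_(i <- s | P i) F i u k).
Proof.
move=> bF; elim: s => [|i s ih].
  apply: (bop_eq (F := fun u k => (0 : 'M[C]_(m, M)) *m u k)).
    by move=> u k; rewrite mul0mx big_nil.
  by apply: bop_mulmx; exact: ucmx_cst.
case Pi : (P i).
  apply: bop_eq (bopD 1 1 (bF i Pi) ih) => u k.
  by rewrite big_cons Pi !scale1r.
by apply: bop_eq ih => u k; rewrite big_cons Pi.
Qed.

Lemma bop_bounded_oper M (F : oper R N M) : bop F -> bounded_oper F.
Proof.
move=> [F1 F2 F3 [c c0 F4]]; split=> //.
exists (Num.sqrt c) => u Lu; rewrite /L2norm -sqrtrM//.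
have fin (v : vf M) : L2 v -> sq v \is a fin_num.
  by move=> /L2P[_ h]; rewrite ge0_fin_numE// sq_ge0.
have fFu := fin _ (F1 u Lu); have fu := fin _ Lu.
rewrite ler_wsqrtr// /Rintegral -[c]/(fine c%:E) -fineM//.
by rewrite fine_le// ?fin_numM//; exact: F4.
Qed.

End bounded_operators.

(** * Inversion of an operator by its elimination factors *)

Section inverse.
Variables (R : realType) (N M : nat).
Local Notation C := (Cplx R).
Local Notation K := (pt R N).

Lemma bop_rank_one j m (A : K -> 'M[C]_(M, m)) (B : K -> 'M[C]_(m, M)) : (j <= N)%N ->
  ucmx A -> ucmx B ->
  bop (fun (u : vfun R N M) k => A k *m avgmx j (fun x => B x *m u x) k).
Proof.
by move=> jN uA uB; exact: (bop_comp (bop_mulmx uA) (bop_comp (bop_avg R m jN) (bop_mulmx uB))).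
Qed.

Lemma L2_mul_section j m (B : K -> 'M[C]_(m, M)) (u : vfun R N M) : (j <= N)%N ->
  ucmx B -> L2 u ->
  aec (fun k => cintgmx (fun y : pt R j => B (splice y k) *m u (splice y k))).
Proof.
move=> jN uB Lu; have [bB _ _ _] := bop_mulmx uB.
exact: (L2_section jN (bB u Lu)).
Qed.

Section rank_one_perturbation.
Variables (j m : nat) (A : K -> 'M[C]_(M, m)) (B : K -> 'M[C]_(m, M)).
Hypotheses (jN : (j <= N)%N) (uA : ucmx A) (uB : ucmx B).
Let E k := 1%:M + avgmx j (fun x => B x *m A x) k.
Hypotheses (Eu : forall k, cube R N k -> E k \in unitmx) (uE : ucmx (fun k => invmx (E k))).
Let P : oper R N M := fun u k => u k + A k *m avgmx j (fun x => B x *m u x) k.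
(** The Woodbury formula: inverting [P] is reduced to inverting the matrices [E k]. *)
Let P' : oper R N M :=
  fun u k => u k - A k *m invmx (E k) *m avgmx j (fun x => B x *m u x) k.

Lemma bop_perturb : bop P.
Proof.
apply: bop_eq (bopD 1 1 (@bop_id R N M) (bop_rank_one jN uA uB)) => u k.
by rewrite !scale1r.
Qed.

Lemma bop_perturb_inv : bop P'.
Proof.
apply: bop_eq (bopD 1 (-1) (@bop_id R N M) (bop_rank_one jN (ucmxM uA uE) uB)) => u k.
by rewrite scale1r scaleN1r.
Qed.

(* A function which is constant in [k_1, ..., k_j] comes out of the average. *)
Let avg_add m' (X : K -> 'M[C]_(M, m')) (v : 'M[C]_(m', 1)) (u w : vfun R N M) k :
  cube R N k -> ucmx X -> cintgmx (fun y : pt R j => B (splice y k) *m u (splice y k)) ->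
  (forall y, cube R j y -> w (splice y k) = u (splice y k) + X (splice y k) *m v) ->
  avgmx j (fun x => B x *m w x) k =
    avgmx j (fun x => B x *m u x) k + avgmx j (fun x => B x *m X x) k *m v.
Proof.
move=> Qk uX iu wE.
have iBX : cintgmx (fun y : pt R j => B (splice y k) *m X (splice y k)).
  apply: cintgmx_ucmx; apply: (ucmx_section j Qk (F := fun x => B x *m X x)).
  exact: ucmxM.
rewrite !avgmxE -cintmxMr// -cintmxD//; last exact: cintgmxMr.
by apply: cintmx_eq => y Qy; rewrite wE// mulmxDr mulmxA.
Qed.

Let E_splice (y : pt R j) k : E (splice y k) = E k.
Proof. by rewrite /E avgmx_splice. Qed.

Lemma perturb_invK : oper_eq (P \o P') id.
Proof.
move=> u Lu; apply/L2eqE; apply: aecS (L2_mul_section jN uB Lu) => k Qk iu.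
set x := avgmx j (fun x => B x *m u x) k.
rewrite /= {1}/P (avg_add (X := A) (v := - (invmx (E k) *m x)) Qk uA iu); last first.
  by move=> y Qy; rewrite /P' E_splice avgmx_splice// mulmxN mulmxA.
rewrite -/x {1}/P' -/x -addrA -[RHS]addr0; congr (_ + _).
rewrite -mulmxA -mulmxN -mulmxDr addrC mulmxN -addrA -opprD.
rewrite [X in x - X](_ : _ = E k *m (invmx (E k) *m x)).
  by rewrite (mulKVmx (Eu Qk)) subrr mulmx0.
by rewrite [E k in RHS]/E mulmxDl mul1mx addrC.
Qed.

Lemma perturbK : oper_eq (P' \o P) id.
Proof.
move=> u Lu; apply/L2eqE; apply: aecS (L2_mul_section jN uB Lu) => k Qk iu.
set x := avgmx j (fun x => B x *m u x) k.
rewrite /= {1}/P' (avg_add (X := A) (v := x) Qk uA iu); last first.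
  by move=> y Qy; rewrite /P avgmx_splice.
rewrite -/x {1}/P -/x -addrA -[RHS]addr0; congr (_ + _).
rewrite -{2}[x]mul1mx -mulmxDl -/(E k) -!mulmxA (mulKmx (Eu Qk)).
by rewrite subrr.
Qed.

End rank_one_perturbation.

Section inverse_of_representation.
Variables (c : R) (r : hrep R N M).
Hypotheses (c0 : 0 < c) (ndr : nonvanishing c r).

Let uAred j : (j <= N)%N -> forall i, (1 <= i <= N)%N -> ucmx (Ared r j i).
Proof.
have [h0 hE] := ndr.
elim: j => [_|j ih jN] i iN.
  apply: ucmxM; last exact: ucmx_rA.
  exact: (ucmx_inv c0 h0 (@ucmx_rA0 _ _ _ r)).
apply: (ucmx_Ared_rec c0 (j := j.+1)) => //; last by apply: ih; exact: ltnW.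
by move=> k; exact: hE.
Qed.

(* With [A_0] and the factors [I + A_{j,j-1} <B_j .>_j] for [j = 1, ..., N], the operator
   is the ordered product [A_0 (I + A_{1,0} <B_1 .>_1) ... (I + A_{N,N-1} <B_N .>_N)];
   [tail_oper j] is the product of the factors of index greater than [j]. *)
Definition tail_oper j : oper R N M := fun u k =>
  u k + \sum_(j.+1 <= i < N.+1) Ared r j i k *m avgmx i (fun x => rB r i x *m u x) k.

Lemma bop_tail_oper j : (j <= N)%N -> bop (tail_oper j).
Proof.
move=> jN; have bS : bop (fun (u : vfun R N M) k => \sum_(j.+1 <= i < N.+1 | (j.+1 <= i < N.+1)%N)
    Ared r j i k *m avgmx i (fun x => rB r i x *m u x) k).
  apply: bop_sum => i /andP[ji iN].
  have iN' : (1 <= i <= N)%N by rewrite (leq_trans _ ji).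
  by apply: bop_rank_one => //; [exact: uAred|exact: ucmx_rB].
apply: bop_eq (bopD 1 1 (@bop_id R N M) bS) => u k.
by rewrite !scale1r /tail_oper -big_nat.
Qed.

Let Pj j : oper R N M := fun u k =>
  u k + Ared r j.-1 j k *m avgmx j (fun x => rB r j x *m u x) k.

(** The averages [<B_i u>_i] with [i > j] come out of [<.>_j], so coefficients can be compared: the
    claim is [A_{i,j} + A_{j,j-1} <B_j A_{i,j}>_j = A_{i,j-1}]. The elimination rule achieves this
    because it gives [<B_j A_{i,j}>_j = E_j^-1 <B_j A_{i,j-1}>_j]. *)
Lemma tail_oper_split j : (1 <= j <= N)%N ->
  oper_eq (tail_oper j.-1) (Pj j \o tail_oper j).
Proof.
case: j => // j jN u Lu; have [_ hE] := ndr.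
have uB := @ucmx_rB _ _ _ r _ jN.
apply/L2eqE; apply: aecS (L2_mul_section jN uB Lu) => k Qk iu.
set x := fun i => avgmx i (fun x => rB r i x *m u x) k.
have Eu : Emx r j.+1 k \in unitmx by exact: unitmx_cabs c0 (hE _ _ jN Qk).
have uA i : (j.+1 <= i <= N)%N -> ucmx (Ared r j.+1 i).
  by move=> /andP[ji iN]; apply: uAred => //; rewrite (leq_trans _ ji).
have iBA i : (j.+2 <= i < N.+1)%N ->
    cintgmx (fun y : pt R j.+1 => rB r j.+1 (splice y k) *m Ared r j.+1 i (splice y k)).
  move=> /andP[ji iN]; apply: cintgmx_ucmx.
  apply: (ucmx_section j.+1 Qk (F := fun x => rB r j.+1 x *m Ared r j.+1 i x)).
  by apply: ucmxM => //; apply: uA; rewrite ltnW.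
rewrite /= /Pj /= {2}/tail_oper -/(x j.+1).
have -> : avgmx j.+1 (fun z => rB r j.+1 z *m tail_oper j.+1 u z) k =
    x j.+1 + \sum_(j.+2 <= i < N.+1)
       avgmx j.+1 (fun z => rB r j.+1 z *m Ared r j.+1 i z) k *m x i.
  transitivity (cintmx (fun y : pt R j.+1 => rB r j.+1 (splice y k) *m u (splice y k) +
     \sum_(j.+2 <= i < N.+1 | (j.+2 <= i < N.+1)%N)
       (rB r j.+1 (splice y k) *m Ared r j.+1 i (splice y k)) *m x i)).
    rewrite avgmxE; apply: cintmx_eq => y Qy; rewrite /tail_oper mulmxDr; congr (_ + _).
    rewrite mulmx_sumr -big_nat; rewrite [LHS]big_nat [RHS]big_nat.
    by apply: eq_bigr => i /andP[ji iN]; rewrite mulmxA avgmx_splice// ltnW.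
  rewrite cintmxD//; last first.
    by apply: cintgmx_sum => i ji; apply: cintgmxMr; exact: iBA.
  congr (_ + _); rewrite cintmx_sum; last by move=> i ji; apply: cintgmxMr; exact: iBA.
  by rewrite [RHS]big_nat; apply: eq_bigr => i ji; rewrite cintmxMr//; exact: iBA.
rewrite {1}/tail_oper -addrA; congr (_ + _).
rewrite big_ltn ?ltnS; last by case/andP: jN.
rewrite mulmxDr addrCA; congr (_ + _).
rewrite mulmx_sumr -big_split/= [LHS]big_nat [RHS]big_nat; apply: eq_bigr => i /andP[ji iN].
rewrite mulmxA -mulmxDl; congr (_ *m _).
have iN' : (1 <= i <= N)%N by rewrite (leq_trans _ ji).
have jN' : (j <= N)%N by case/andP: jN => _ /ltnW.
set X := avgmx j.+1 (fun x => rB r j.+1 x *m Ared r j i x) k.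
set D := avgmx j.+1 (fun x => rB r j.+1 x *m Ared r j j.+1 x) k.
have EE : Emx r j.+1 k = 1%:M + D by [].
have -> : avgmx j.+1 (fun z => rB r j.+1 z *m (Ared r j i z -
      Ared r j j.+1 z *m invmx (Emx_of (Ared r j j.+1) z) *m
        avgmx j.+1 (fun x => rB r j.+1 x *m Ared r j i x) z)) k =
    X - D *m (invmx (Emx r j.+1 k) *m X).
  rewrite /X /D !avgmxE -cintmxMr; last first.
    apply: cintgmx_ucmx.
    apply: (ucmx_section j.+1 Qk (F := fun x => rB r j.+1 x *m Ared r j j.+1 x)).
    by apply: ucmxM => //; exact: uAred.
  rewrite -cintmxB; last 2 first.
  - apply: cintgmx_ucmx.
    apply: (ucmx_section j.+1 Qk (F := fun x => rB r j.+1 x *m Ared r j i x)).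
    by apply: ucmxM => //; exact: uAred.
  - apply: cintgmxMr; apply: cintgmx_ucmx.
    apply: (ucmx_section j.+1 Qk (F := fun x => rB r j.+1 x *m Ared r j j.+1 x)).
    by apply: ucmxM => //; exact: uAred.
  apply: cintmx_eq => y Qy.
  have -> : Emx_of (Ared r j j.+1) (splice y k) = Emx r j.+1 k.
    by rewrite EE /Emx_of avgmx_splice.
  rewrite (avgmx_splice _ _ _ (leqnn j.+1)).
  rewrite mulmxBr; congr (_ - _).
  by rewrite -[in RHS]mulmxA -[in LHS]mulmxA.
rewrite -/X [Emx_of _ _](_ : _ = Emx r j.+1 k)// -mulmxA.
(* Since [E = 1 + D], one has [X - D E^-1 X = E^-1 X]. *)
rewrite [X - _](_ : _ = invmx (Emx r j.+1 k) *m X) ?subrK//.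
apply/eqP; rewrite subr_eq -{1}[invmx _ *m X]mul1mx -mulmxDl -EE.
by rewrite (mulKVmx Eu).
Qed.

(** Downward induction from [tail_oper N], which is the identity. Each further factor on the left of
    the operator puts its Woodbury inverse on the right of the inverse. *)
Lemma tail_oper_inverse j : (j <= N)%N -> exists G : oper R N M,
  [/\ bop G, oper_eq (tail_oper j \o G) id & oper_eq (G \o tail_oper j) id].
Proof.
move=> jN; have [n] := ubnP (N - j); elim: n j jN => // n ih j jN; rewrite ltnS => jn.
move: jN; rewrite leq_eqVlt => /orP[/eqP ->|jN].
  have TE u k : tail_oper N u k = u k.
    by rewrite /tail_oper big_geq ?addr0.
  exists id; split; first exact: bop_id.
    by move=> u Lu; apply/L2eqE; apply: aecW => k _ /=; rewrite TE.
  by move=> u Lu; apply/L2eqE; apply: aecW => k _ /=; rewrite TE.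
have [G [bG TG GT]] : exists G : oper R N M,
    [/\ bop G, oper_eq (tail_oper j.+1 \o G) id & oper_eq (G \o tail_oper j.+1) id].
  apply: ih => //; apply: leq_trans jn; apply: ltn_sub2l => //.
have jN1 : (1 <= j.+1 <= N)%N by [].
have [_ hE] := ndr.
have uA := uAred (ltnW jN) jN1.
have uB := @ucmx_rB _ _ _ r _ jN1.
have Eu k : cube R N k -> Emx r j.+1 k \in unitmx.
  by move=> Qk; exact: unitmx_cabs c0 (hE _ _ jN1 Qk).
have uE : ucmx (fun k => invmx (Emx r j.+1 k)).
  by apply: (ucmx_inv c0) => [k|]; [exact: hE|exact: ucmx_Emx].
pose P' : oper R N M := fun u k => u k - Ared r j j.+1 k *m invmx (Emx r j.+1 k) *m
  avgmx j.+1 (fun x => rB r j.+1 x *m u x) k.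
have PP' : oper_eq (Pj j.+1 \o P') id := perturb_invK jN uA uB Eu.
have P'P : oper_eq (P' \o Pj j.+1) id := perturbK jN uA uB Eu.
have bP' : bop P' := bop_perturb_inv jN uA uB uE.
have bP : bop (Pj j.+1) := bop_perturb jN uA uB.
have bT := bop_tail_oper jN.
have T_split := tail_oper_split jN1.
have [P'1 P'2 _ _] := bP'; have [P1 P2 _ _] := bP; have [G1 G2 _ _] := bG; have [T1 _ _ _] := bT.
exists (G \o P'); split; first exact: bop_comp.
  move=> u Lu /=; apply: L2eq_trans (T_split _ (G1 _ (P'1 _ Lu))) _.
  apply: L2eq_trans (PP' u Lu); apply: P2; [|exact: P'1|exact: TG (P'1 u Lu)].
  exact/T1/G1/P'1.
move=> u Lu; apply: L2eq_trans (GT u Lu).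
have [T01 _ _ _] := bop_tail_oper (ltnW jN).
apply: G2; [exact/P'1/T01|exact: T1|].
apply: L2eq_trans (P'P _ (T1 u Lu)); apply: P'2; [exact: T01|exact/P1/T1|exact: T_split].
Qed.

Lemma oper_of_inverse : exists G : oper R N M,
  [/\ bounded_oper G, oper_eq (oper_of r \o G) id & oper_eq (G \o oper_of r) id].
Proof.
have [G [bG TG GT]] := tail_oper_inverse (leq0n N).
have [h0 _] := ndr.
have uA0 := @ucmx_rA0 _ _ _ r.
have bA0 := bop_mulmx uA0.
have bA0' := bop_mulmx (ucmx_inv c0 h0 uA0).
have u0 k : cube R N k -> rA0 r k \in unitmx by move=> Qk; exact: unitmx_cabs c0 (h0 k Qk).
have opE (u : vfun R N M) k : cube R N k -> oper_of r u k = rA0 r k *m tail_oper 0 u k.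
  move=> Qk; rewrite /oper_of /tail_oper mulmxDr mulmx_sumr; congr (_ + _).
  by apply: eq_bigr => j _; rewrite /= -mulmxA (mulKVmx (u0 k Qk)).
have [A1 A2 _ _] := bA0; have [A'1 A'2 _ _] := bA0'; have [G1 G2 _ _] := bG.
have [T1 _ _ _] := bop_tail_oper (leq0n N).
exists (G \o (fun u k => invmx (rA0 r k) *m u k)); split.
- exact/bop_bounded_oper/bop_comp.
- move=> u Lu; apply/L2eqE; have /L2eqE := TG _ (A'1 u Lu).
  by apply: aecS => k Qk /= h; rewrite opE// h (mulKVmx (u0 k Qk)).
- move=> u Lu; apply: L2eq_trans (GT u Lu); apply: G2; [apply: A'1|exact: T1|].
    by apply: L2_eq (A1 _ (T1 u Lu)) => k Qk; rewrite opE.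
  by apply/L2eqE; apply: aecW => k Qk /=; rewrite opE// (mulKmx (u0 k Qk)).
Qed.

End inverse_of_representation.

End inverse.

(** * First order expansion of the invariants *)

Section orders_of_vanishing.
Variables (R : realType) (N : nat).
Local Notation C := (Cplx R).
Local Notation K := (pt R N).
Implicit Types (p q : nat) (F G : C -> K -> C).

(* [F t k = O(t^p)] uniformly in [k], with [F t] continuous for small [t]. *)
Definition ufam p F := exists c d : R, [/\ 0 <= c, 0 < d &
  forall t, cabs t < d -> ucont (F t) /\
    forall k, cube R N k -> cabs (F t k) <= c * cabs t ^+ p].

Lemma ufam_near p F G (d : R) : 0 < d ->
  (forall t k, cabs t < d -> cube R N k -> F t k = G t k) -> ufam p F -> ufam p G.
Proof.
move=> d0 FG [c [e [c0 e0 h]]]; exists c, (Num.min d e); split=> //.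
  by rewrite lt_min d0.
move=> t; rewrite lt_min => /andP[td te]; have [uF bF] := h t te; split.
  by apply: ucont_eq uF => k Qk; exact: FG.
by move=> k Qk; rewrite -FG//; exact: bF.
Qed.

Lemma ufam_eq p F G : (forall t k, cube R N k -> F t k = G t k) -> ufam p F -> ufam p G.
Proof. by move=> FG; apply: (ufam_near ltr01) => t k _; exact: FG. Qed.

Lemma ufam_cst (f : K -> C) : ucont f -> ufam 0 (fun=> f).
Proof.
move=> uf; have [c c0 hc] := ucont_bounded uf; exists c, 1; split=> //; first exact: ltW.
by move=> t _; split=> // k Qk; rewrite mulr1; exact: hc.
Qed.

Lemma ufam_zero p : ufam p (fun _ _ => 0).
Proof.
exists 0, 1; split=> // t _; split; first exact: ucont_cst.
by move=> k _; rewrite cabs0 mul0r.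
Qed.

Lemma ufam_param : ufam 1 (fun t _ => t).
Proof.
exists 1, 1; split=> // t _; split; first exact: ucont_cst.
by move=> k _; rewrite mul1r.
Qed.

Lemma ufam_le p q F : (q <= p)%N -> ufam p F -> ufam q F.
Proof.
move=> qp [c [d [c0 d0 h]]]; exists c, (Num.min 1 d); split=> //.
  by rewrite lt_min ltr01.
move=> t; rewrite lt_min => /andP[t1 td]; have [uF bF] := h t td; split=> // k Qk.
apply: le_trans (bF k Qk) _; apply: ler_wpM2l => //.
by apply: ler_wiXn2l => //; [exact: cabs_ge0|exact: ltW].
Qed.

Lemma ufamD p F G : ufam p F -> ufam p G -> ufam p (fun t k => F t k + G t k).
Proof.
move=> [c [d [c0 d0 hF]]] [c' [d' [c'0 d'0 hG]]]; exists (c + c'), (Num.min d d').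
split; [exact: addr_ge0|by rewrite lt_min d0|].
move=> t; rewrite lt_min => /andP[td td'].
have [uF bF] := hF t td; have [uG bG] := hG t td'; split; first exact: ucontD.
by move=> k Qk; apply: le_trans (cabsD _ _) _; rewrite mulrDl; apply: lerD; [exact: bF|exact: bG].
Qed.

Lemma ufamM p q F G : ufam p F -> ufam q G -> ufam (p + q) (fun t k => F t k * G t k).
Proof.
move=> [c [d [c0 d0 hF]]] [c' [d' [c'0 d'0 hG]]]; exists (c * c'), (Num.min d d').
split; [exact: mulr_ge0|by rewrite lt_min d0|].
move=> t; rewrite lt_min => /andP[td td'].
have [uF bF] := hF t td; have [uG bG] := hG t td'; split; first exact: ucontM.
move=> k Qk; rewrite cabsM exprD mulrACA.
by apply: ler_pM; rewrite ?cabs_ge0//; [exact: bF|exact: bG].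
Qed.

Lemma ufamZ p (c : C) F : ufam p F -> ufam p (fun t k => c * F t k).
Proof. by move=> uF; apply: (@ufamM 0 p _ _ (ufam_cst (ucont_cst _ c)) uF). Qed.

Lemma ufamN p F : ufam p F -> ufam p (fun t k => - F t k).
Proof. by move=> /(ufamZ (-1)); apply: ufam_eq => t k _; rewrite mulN1r. Qed.

Lemma ufam_sum p I (r : seq I) (P : pred I) (F : I -> C -> K -> C) :
  (forall i, P i -> ufam p (F i)) -> ufam p (fun t k => \sum_(i <- r | P i) F i t k).
Proof.
move=> uF; elim: r => [|i r ih].
  by apply: ufam_eq (ufam_zero p) => t k _; rewrite big_nil.
case Pi : (P i).
  by apply: ufam_eq (ufamD (uF i Pi) ih) => t k _; rewrite big_cons Pi.
by apply: ufam_eq ih => t k _; rewrite big_cons Pi.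
Qed.

Lemma ufam_prod I (r : seq I) (P : pred I) (F : I -> C -> K -> C) :
  (forall i, P i -> ufam 0 (F i)) -> ufam 0 (fun t k => \prod_(i <- r | P i) F i t k).
Proof.
move=> uF; elim: r => [|i r ih].
  by apply: ufam_eq (ufam_cst (ucont_cst _ 1)) => t k _; rewrite big_nil.
case Pi : (P i).
  by apply: ufam_eq (ufamM (uF i Pi) ih) => t k _; rewrite big_cons Pi.
by apply: ufam_eq ih => t k _; rewrite big_cons Pi.
Qed.

Lemma ufam_avg p j F : ufam p F -> ufam p (fun t => avg j (F t)).
Proof.
move=> [c [d [c0 d0 hF]]]; exists (2 * c), d; split=> //; first exact: mulr_ge0.
move=> t td; have [uF bF] := hF t td; split; first exact: ucont_avg.
move=> k Qk; rewrite avgE -mulrA; apply: cabs_cint_le.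
  exact/cintg_ucont/ucont_section.
by move=> y Qy; apply: bF; exact: cube_splice.
Qed.

Lemma ufam_small F (e : R) : 0 < e -> ufam 1 F ->
  exists2 d : R, 0 < d & forall t k, cabs t < d -> cube R N k -> cabs (F t k) <= e.
Proof.
move=> e0 [c [d [c0 d0 h]]]; exists (Num.min d (e / (c + 1))).
  by rewrite lt_min d0 divr_gt0// ltr_wpDl.
move=> t k; rewrite lt_min => /andP[td te] Qk.
have [_ bF] := h t td; apply: le_trans (bF k Qk) _.
have c1 : 0 < c + 1 by rewrite ltr_wpDl.
rewrite ltr_pdivlMr// mulrC in te; apply: le_trans (ltW te); rewrite expr1 ler_wpM2r ?cabs_ge0//.
by rewrite lerDl.
Qed.

(** A further factor multiplies the old remainder by [1 + F i], which is O(1), and adds the product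
    of [F i] with the old sum, which is O(t^2). *)
Lemma ufam_prod1D I (r : seq I) (F : I -> C -> K -> C) : (forall i, ufam 1 (F i)) ->
  ufam 2 (fun t k => \prod_(i <- r) (1 + F i t k) - 1 - \sum_(i <- r) F i t k).
Proof.
move=> uF; elim: r => [|i r ih].
  by apply: ufam_eq (ufam_zero 2) => t k _; rewrite !big_nil subrr subr0.
have uS : ufam 1 (fun t k => \sum_(i <- r) F i t k) by exact: ufam_sum.
have u0 : ufam 0 (fun t k => 1 + F i t k).
  by apply: ufamD; [exact/ufam_cst/ucont_cst|exact: ufam_le (uF i)].
apply: ufam_eq (ufamD (ufamM u0 ih) (ufamM (uF i) uS)) => t k _; rewrite !big_cons.
by ring.
Qed.

Definition ufmx p m n (F : C -> K -> 'M[C]_(m, n)) :=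
  forall a b, ufam p (fun t k => F t k a b).

Lemma ufmx_near p m n (F G : C -> K -> 'M[C]_(m, n)) (d : R) : 0 < d ->
  (forall t k, cabs t < d -> cube R N k -> F t k = G t k) -> ufmx p F -> ufmx p G.
Proof. by move=> d0 FG uF a b; apply: (ufam_near d0) (uF a b) => t k td Qk; rewrite FG. Qed.

Lemma ufmx_eq p m n (F G : C -> K -> 'M[C]_(m, n)) :
  (forall t k, cube R N k -> F t k = G t k) -> ufmx p F -> ufmx p G.
Proof. by move=> FG; apply: (ufmx_near ltr01) => t k _; exact: FG. Qed.

Lemma ufmx_cst m n (A : K -> 'M[C]_(m, n)) : ucmx A -> ufmx 0 (fun=> A).
Proof. by move=> uA a b; exact: ufam_cst. Qed.

Lemma ufmx_le p q m n (F : C -> K -> 'M[C]_(m, n)) : (q <= p)%N -> ufmx p F -> ufmx q F.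
Proof. by move=> qp uF a b; exact: ufam_le (uF a b). Qed.

Lemma ufmxD p m n (F G : C -> K -> 'M[C]_(m, n)) :
  ufmx p F -> ufmx p G -> ufmx p (fun t k => F t k + G t k).
Proof. by move=> uF uG a b; apply: ufam_eq (ufamD (uF a b) (uG a b)) => t k _; rewrite mxE. Qed.

Lemma ufmxN p m n (F : C -> K -> 'M[C]_(m, n)) : ufmx p F -> ufmx p (fun t k => - F t k).
Proof. by move=> uF a b; apply: ufam_eq (ufamN (uF a b)) => t k _; rewrite mxE. Qed.

Lemma ufmxM p q m n l (F : C -> K -> 'M[C]_(m, n)) (G : C -> K -> 'M[C]_(n, l)) :
  ufmx p F -> ufmx q G -> ufmx (p + q) (fun t k => F t k *m G t k).
Proof.
move=> uF uG a b; apply: (@ufam_eq _ (fun t k => \sum_i F t k a i * G t k i b)).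
  by move=> t k _; rewrite mxE.
by apply: ufam_sum => i _; exact: ufamM.
Qed.

Lemma ufmx_param m n (A : K -> 'M[C]_(m, n)) : ucmx A -> ufmx 1 (fun t k => t *: A k).
Proof.
move=> uA a b; apply: ufam_eq (ufamM ufam_param (ufam_cst (uA a b))) => t k _.
by rewrite mxE.
Qed.

Lemma ufmx_avg p j m n (F : C -> K -> 'M[C]_(m, n)) : ufmx p F ->
  ufmx p (fun t => avgmx j (F t)).
Proof. by move=> uF a b; apply: ufam_eq (ufam_avg j (uF a b)) => t k _; rewrite mxE. Qed.

Lemma ufam_tr p m (F : C -> K -> 'M[C]_m) : ufmx p F -> ufam p (fun t k => \tr (F t k)).
Proof. by move=> uF; apply: ufam_sum => i _; exact: uF. Qed.

Lemma ufam_det m (F : C -> K -> 'M[C]_m) : ufmx 0 F -> ufam 0 (fun t k => \det (F t k)).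
Proof.
move=> uF; apply: ufam_sum => s _; apply: ufamZ.
by apply: ufam_prod => i _; exact: uF.
Qed.

Lemma ufmx_small m n (F : C -> K -> 'M[C]_(m, n)) : ufmx 1 F ->
  exists2 d : R, 0 < d & forall t, cabs t < d -> ucmx (F t).
Proof.
move=> uF.
have /choice[d hd] : forall ab : 'I_m * 'I_n, exists d : R,
    0 < d /\ forall t, cabs t < d -> ucont (fun k => F t k ab.1 ab.2).
  move=> ab; have [c [d [_ d0 h]]] := uF ab.1 ab.2.
  by exists d; split=> // t /h[].
exists (\big[Num.min/1]_ab d ab).
  by apply/bigmin_gtP; split=> // ab _; exact: (hd ab).1.
move=> t td a b; apply: (hd (a, b)).2; apply: lt_le_trans td _.
exact: bigmin_le_cond.
Qed.

Section perturbation_of_identity.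
Variables (m : nat) (X : C -> K -> 'M[C]_m).
Hypothesis uX : ufmx 1 X.

Let uX1 : ufmx 0 (fun t k => 1%:M + X t k).
Proof.
by apply: ufmxD; [apply: ufmx_cst; exact: ucmx_cst|exact: ufmx_le uX].
Qed.

(** In the Leibniz formula a permutation [s] that moves [i] also moves [s i], so its term contains
    two off-diagonal entries and is O(t^2). The identity contributes the product of the diagonal
    entries [1 + X i i]. *)
Lemma ufam_det1D : ufam 2 (fun t k => \det (1%:M + X t k) - 1 - \tr (X t k)).
Proof.
pose f (s : 'S_m) t k : C := (-1) ^+ s * \prod_i (1%:M + X t k) i (s i).
have u1 : ufam 2 (fun t k => \prod_i (1 + X t k i i) - 1 - \sum_i X t k i i).
  exact: ufam_prod1D.
have us (s : 'S_m) : s != 1%g -> ufam 2 (f s).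
  move=> s1; have [i si] : exists i, s i != i.
    apply/existsP; apply: contraNT s1; rewrite negb_exists => /forallP h.
    by apply/eqP/permP => i; rewrite perm1; apply/eqP; move: (h i); rewrite negbK.
  have ssi : s (s i) != s i by rewrite (inj_eq perm_inj).
  have u i' : s i' != i' -> ufam 1 (fun t k => (1%:M + X t k) i' (s i')).
    move=> si'; apply: ufam_eq (uX i' (s i')) => t k _.
    by rewrite !mxE eq_sym (negbTE si') add0r.
  apply: ufamZ; apply: (@ufam_eq _ (fun t k => (1%:M + X t k) i (s i) *
      ((1%:M + X t k) (s i) (s (s i)) *
       \prod_(l | (l != i) && (l != s i)) (1%:M + X t k) l (s l)))).
    by move=> t k _; rewrite [RHS](bigD1 i)//= [in RHS](bigD1 (s i)).
  apply: (@ufamM 1 1 _ _ (u i si)); apply: (@ufamM 1 0 _ _ (u (s i) ssi)).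
  by apply: ufam_prod => l _; exact: uX1.
have uS : ufam 2 (fun t k => \sum_(s : 'S_m | s != 1%g) f s t k) by exact: ufam_sum.
apply: ufam_eq (ufamD u1 uS) => t k _.
rewrite [\det _](bigD1 1%g)//= odd_perm1 expr0 mul1r.
rewrite (eq_bigr (fun i => (1%:M + X t k) i ((1%g : 'S_m) i))); last first.
  by move=> i _; rewrite perm1 !mxE eqxx.
by rewrite addrAC; congr (_ - _); rewrite addrAC.
Qed.

(** The determinant tends to 1 uniformly, so any constant below 1 would serve as the bound. *)
Lemma det1D_ge : exists2 d : R, 0 < d &
  forall t k, cabs t < d -> cube R N k -> 2^-1 <= cabs (\det (1%:M + X t k)).
Proof.
have u1 : ufam 1 (fun t k => \det (1%:M + X t k) - 1).
  apply: ufam_eq (ufamD (ufam_le (leqnSn 1) ufam_det1D) (ufam_tr uX)) => t k _.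
  by rewrite subrK.
have h2 : 0 < 2^-1 :> R by rewrite invr_gt0.
have [d d0 h] := ufam_small h2 u1; exists d => // t k td Qk.
have := h t k td Qk; set D := \det _ => hD.
have := cabsD (1 - D) D; rewrite subrK cabs1 cabsC => h1.
by lra.
Qed.

Lemma ufmx_inv1D : ufmx 0 (fun t k => invmx (1%:M + X t k)).
Proof.
have [d d0 hd] := det1D_ge.
have uV : ufam 0 (fun t k => (\det (1%:M + X t k))^-1).
  have [c [e [c0 e0 h]]] := ufam_det uX1.
  (* The constant 2 is the inverse of the lower bound of [det1D_ge]. *)
  exists 2, (Num.min d e); split=> //; first by rewrite lt_min d0.
  move=> t; rewrite lt_min => /andP[td te]; have [uD _] := h t te; split.
    have h2 : 0 < 2^-1 :> R by rewrite invr_gt0.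
    by apply: (ucontV h2 _ uD) => k Qk; exact: hd.
  move=> k Qk; rewrite mulr1 cabsV.
  rewrite -[leRHS]invrK lef_pV2 ?posrE ?invr_gt0//; first exact: hd.
  by apply: lt_le_trans (hd t k td Qk); rewrite invr_gt0.
move=> a b; apply: (ufam_near (F := fun t k => (\det (1%:M + X t k))^-1 *
    cofactor (1%:M + X t k) b a) d0).
  move=> t k td Qk; have u : 1%:M + X t k \in unitmx.
    by apply: (unitmx_cabs _ (hd t k td Qk)); rewrite invr_gt0.
  by rewrite /invmx u !mxE.
apply: (@ufamM 0 0 _ _ uV); apply: ufamZ; apply: ufam_det => i j.
by apply: ufam_eq (uX1 (lift b i) (lift a j)) => t k _; rewrite !mxE.
Qed.

Lemma ufmx_inv1D_sub1 : ufmx 1 (fun t k => invmx (1%:M + X t k) - 1%:M).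
Proof.
have [d d0 hd] := det1D_ge.
apply: (ufmx_near (F := fun t k => - (X t k *m invmx (1%:M + X t k))) d0); last first.
  by apply: ufmxN; exact: (@ufmxM 1 0 _ _ _ _ _ uX ufmx_inv1D).
move=> t k td Qk; have u : 1%:M + X t k \in unitmx.
  by apply: (unitmx_cabs _ (hd t k td Qk)); rewrite invr_gt0.
have := mulmxV u; rewrite {1}mulmxDl mul1mx => e.
by apply: (addrI (X t k *m invmx (1%:M + X t k))); rewrite subrr addrA [_ *m _ + _]addrC e subrr.
Qed.

End perturbation_of_identity.

End orders_of_vanishing.

Lemma tr_cintmx (R : realType) n p (F : pt R n -> 'M[Cplx R]_p) : cintgmx F ->
  \tr (cintmx F) = cint (fun y => \tr (F y)).
Proof.
by move=> iF; rewrite cint_sum// /mxtrace; apply: eq_bigr => i _; rewrite mxE.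
Qed.

(** * Expansion along the family I + tA *)

Section one_parameter_family.
Variables (R : realType) (N M : nat) (r : hrep R N M).
Local Notation C := (Cplx R).
Local Notation K := (pt R N).

(** Kept transparent: the inner dimensions must convert to those of [r] for a difference such as
    [A_{i,j} - t A_i] to be well typed. *)
Definition rep_1D (t : C) : hrep R N M.
Proof.
refine (@Hrep R N M (rdim r) (fun k => 1%:M + t *: rA0 r k)
  (fun j k => t *: rA r j k) (rB r) (@rdim_gt0 _ _ _ r) _ _ (@rB_cont _ _ _ r)).
  by apply/cont_cube_mxP/ucmxD; [exact: ucmx_cst|apply: ucmxZ; exact: ucmx_rA0].
by move=> j jN; apply/cont_cube_mxP/ucmxZ; exact: ucmx_rA.
Defined.

Lemma oper_of_rep_1D t (u : vfun R N M) k :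
  oper_of (rep_1D t) u k = u k + t *: oper_of r u k.
Proof.
rewrite /oper_of /= mulmxDl mul1mx -scalemxAl scalerDr -addrA; congr (_ + (_ + _)).
by rewrite scaler_sumr; apply: eq_bigr => j _; rewrite -scalemxAl.
Qed.

(** The initial error is [((I + t A_0)^-1 - I) (t A_i)], a product of two O(t) factors. Each
    elimination step subtracts [A_{j+1,j} E^-1 <B A_{i,j}>], where the outer factors are O(t) and
    the inverse is O(1). *)
Lemma ufmx_Ared j : (j <= N)%N -> forall i, (1 <= i <= N)%N ->
  ufmx 2 (fun t k => (Ared (rep_1D t) j i k : 'M[C]_(M, rdim r i)) - t *: rA r i k).
Proof.
have uB i : (1 <= i <= N)%N -> ufmx 0 (fun=> rB r i).
  by move=> iN; apply: ufmx_cst; exact: ucmx_rB.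
elim: j => [_|j ih jN] i iN.
  apply: (ufmx_eq (F := fun t k => (invmx (1%:M + t *: rA0 r k) - 1%:M) *m (t *: rA r i k))).
    by move=> t k _; rewrite mulmxBl mul1mx.
  apply: (@ufmxM R N 1 1); last by apply: ufmx_param; exact: ucmx_rA.
  by apply: ufmx_inv1D_sub1; apply: ufmx_param; exact: ucmx_rA0.
have {}ih := ih (ltnW jN).
have u1 l : (1 <= l <= N)%N -> ufmx 1 (fun t k => (Ared (rep_1D t) j l k : 'M[C]_(M, rdim r l))).
  move=> lN; apply: (ufmx_eq (F := fun t k => (Ared (rep_1D t) j l k - t *: rA r l k) + t *: rA r l k)).
    by move=> t k _; rewrite subrK.
  by apply: ufmxD; [exact: ufmx_le (ih l lN)|apply: ufmx_param; exact: ucmx_rA].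
have jN1 : (1 <= j.+1 <= N)%N by [].
have uX l : (1 <= l <= N)%N -> ufmx 1 (fun t => avgmx j.+1 (fun x =>
    rB r j.+1 x *m (Ared (rep_1D t) j l x : 'M[C]_(M, rdim r l)))).
  move=> lN; apply: (@ufmx_avg R N 1 j.+1 _ _ (fun t x => rB r j.+1 x *m (Ared (rep_1D t) j l x))).
  exact: (@ufmxM R N 0 1 _ _ _ _ _ (uB _ jN1) (u1 l lN)).
apply: (ufmx_eq (F := fun t k => (Ared (rep_1D t) j i k - t *: rA r i k) -
    (Ared (rep_1D t) j j.+1 k *m invmx (1%:M + avgmx j.+1 (fun x =>
    rB r j.+1 x *m Ared (rep_1D t) j j.+1 x) k) *m
      avgmx j.+1 (fun x => rB r j.+1 x *m Ared (rep_1D t) j i x) k))).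
  by move=> t k _; rewrite addrAC.
apply: ufmxD; first exact: ih.
apply: ufmxN; apply: (@ufmxM R N 1 1); last exact: uX.
by apply: (@ufmxM R N 1 0); [exact: u1|apply: ufmx_inv1D; exact: uX].
Qed.

Let ufmx_X j : (1 <= j <= N)%N -> ufmx 1 (fun t => avgmx j (fun x =>
    rB r j x *m (Ared (rep_1D t) j.-1 j x : 'M[C]_(M, rdim r j)))).
Proof.
move=> jN; apply: (@ufmx_avg R N 1 j _ _ (fun t x => rB r j x *m (Ared (rep_1D t) j.-1 j x))).
apply: (@ufmxM R N 0 1); first by apply: ufmx_cst; exact: ucmx_rB.
apply: (ufmx_eq (F := fun t k => (Ared (rep_1D t) j.-1 j k - t *: rA r j k) + t *: rA r j k)).
  by move=> t k _; rewrite subrK.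
apply: ufmxD; last by apply: ufmx_param; exact: ucmx_rA.
apply: ufmx_le (ufmx_Ared _ jN) => //.
by case/andP: jN => _; apply: leq_trans; exact: leq_pred.
Qed.

Lemma rep_1D_nonvanishing : exists2 d : R, 0 < d &
  forall t, cabs t < d -> nonvanishing 2^-1 (rep_1D t).
Proof.
have [d0 d00 h0] := det1D_ge (ufmx_param (@ucmx_rA0 _ _ _ r)).
have /choice[d hd] : forall j : 'I_N.+1, exists d : R, 0 < d /\
    ((1 <= j)%N -> forall t k, cabs t < d -> cube R N k ->
      2^-1 <= cabs (\det (Emx (rep_1D t) j k))).
  move=> j; have [j0|j0] := posnP j; first by exists 1; split=> //; rewrite j0.
  have jN : (1 <= j <= N)%N by rewrite j0 -ltnS ltn_ord.
  by have [d dpos h] := det1D_ge (ufmx_X jN); exists d.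
exists (Num.min d0 (\big[Num.min/1]_j d j)).
  by rewrite lt_min d00; apply/bigmin_gtP; split=> // j _; exact: (hd j).1.
move=> t; rewrite lt_min => /andP[t0 tj]; split=> [k Qk|j k jN Qk]; first exact: h0.
have jN1 : (j < N.+1)%N by case/andP: jN.
apply: ((hd (Ordinal jN1)).2 _ t k) => //; first by case/andP: jN.
by apply: lt_le_trans tj _; exact: bigmin_le_cond.
Qed.

(** At a level [j >= 1] there are two errors: that of the determinant expansion, and the average of
    [\tr (B_j (A_{j,j-1} - t A_j))], which is O(t^2) by [ufmx_Ared]. *)
Lemma pi_repr_rep_1D (j : 'I_N.+1) :
  ufam 2 (fun t k => pi_repr (rep_1D t) j k - 1 - t * trace_repr r j k).
Proof.
rewrite /pi_repr /trace_repr; case: eqP => [_|/eqP j0].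
  apply: ufam_eq (ufam_det1D (ufmx_param (@ucmx_rA0 _ _ _ r))) => t k _.
  by rewrite mxtraceZ.
have jN : (1 <= j <= N)%N by rewrite lt0n j0 -ltnS ltn_ord.
have uB := @ucmx_rB _ _ _ r _ jN.
have uA := @ucmx_rA _ _ _ r _ jN.
have uD := ufmx_Ared (leq_trans (leq_pred j) (ltn_ord j : (j <= N)%N)) jN.
(* For small [t] the difference is continuous in [k], so that the average of the trace may be split
   into two integrals. *)
have [d d0 hd] := ufmx_small (ufmx_le (leqnSn 1) uD).
have uS : ufam 2 (fun t => avg j (fun x =>
    \tr (rB r j x *m (Ared (rep_1D t) j.-1 j x - t *: rA r j x)))).
  apply: (@ufam_avg R N 2 j (fun t x => \tr (rB r j x *m (Ared (rep_1D t) j.-1 j x - t *: rA r j x)))).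
  apply: (ufam_tr (F := fun t x => rB r j x *m (Ared (rep_1D t) j.-1 j x - t *: rA r j x))).
  by apply: (@ufmxM R N 0 2) => //; exact: ufmx_cst.
apply: (ufam_near (F := fun t k => (\det (Emx (rep_1D t) j k) - 1 -
    \tr (avgmx j (fun x => rB r j x *m (Ared (rep_1D t) j.-1 j x : 'M[C]_(M, rdim r j))) k)) +
  avg j (fun x => \tr (rB r j x *m (Ared (rep_1D t) j.-1 j x - t *: rA r j x))) k) d0); last first.
  by apply: ufamD => //; exact: (ufam_det1D (ufmx_X jN)).
move=> t k td Qk; rewrite -addrA; congr (_ + _).
have uBA : ucmx (fun x => rB r j x *m rA r j x) by exact: ucmxM.
have uBD : ucmx (fun x => rB r j x *m (Ared (rep_1D t) j.-1 j x - t *: rA r j x)).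
  by apply: ucmxM => //; exact: hd.
have sec (f : K -> C) : ucont f -> cintg (fun y : pt R j => f (splice y k)).
  by move=> uf; exact/cintg_ucont/(ucont_section j Qk).
rewrite !avgE -[t * _]cintZ; last by apply: (sec (fun x => \tr (rB r j x *m rA r j x))); exact: ucont_tr.
have -> : \tr (avgmx j (fun x => rB r j x *m (Ared (rep_1D t) j.-1 j x : 'M[C]_(M, rdim r j))) k) =
    cint (fun y : pt R j => \tr (rB r j (splice y k) *m
      (Ared (rep_1D t) j.-1 j (splice y k) - t *: rA r j (splice y k)))) +
    cint (fun y : pt R j => t * \tr (rB r j (splice y k) *m rA r j (splice y k))).
  rewrite -cintD; last 2 first.
  - by apply: (sec (fun x => \tr (rB r j x *m (Ared (rep_1D t) j.-1 j x - t *: rA r j x)))); exact: ucont_tr.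
  - by apply: (sec (fun x => t * \tr (rB r j x *m rA r j x))); apply: ucontZ; exact: ucont_tr.
  rewrite avgmxE tr_cintmx; last first.
    apply: cintgmx_ucmx; apply: (ucmx_section j Qk
      (F := fun x => rB r j x *m (Ared (rep_1D t) j.-1 j x : 'M[C]_(M, rdim r j)))).
    apply: ucmx_eq (ucmxD uBD (ucmxZ t uBA)) => x _.
    by rewrite scalemxAr -mulmxDr subrK.
  apply: cint_eq => y _; rewrite -mxtraceZ -mxtraceD.
  by rewrite scalemxAr -mulmxDr subrK.
by rewrite opprD addrAC addNr add0r.
Qed.

End one_parameter_family.

Section small_parameter_limits.
Variable R : realType.
Local Notation C := (Cplx R).

Lemma near_0_cabs (P : C -> Prop) (d : R) : 0 < d ->
  (forall t : C, t != 0 -> cabs t < d -> P t) -> \forall t \near (0 : C)^', P t.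
Proof.
move=> d0 h.
have d0' : 0 < (d%:C)%C :> C by rewrite ltcR.
have hd := dnbhs0_lt d0'.
have hn : \forall t \near (0 : C)^', t != 0 by exact: nbhs_dnbhs_neq.
near=> t; apply: h; first by near: t; exact: hn.
by rewrite -ltcR -normr_cabs; near: t; exact: hd.
Unshelve. all: by end_near.
Qed.

Lemma cvge0_small (g : C -> \bar R) : (forall t, 0 <= g t)%E ->
  (forall e : R, 0 < e -> \forall t \near (0 : C)^', (g t <= e%:E)%E) ->
  g t @[t --> (0 : C)^'] --> 0%E.
Proof.
move=> g0 h.
have fin1 := h 1 ltr01.
apply/fine_cvgP; split.
  move: fin1; apply: filterS => t gt; rewrite ge0_fin_numE//.
  exact: le_lt_trans gt (ltry _).
apply/cvgrPdist_le => e e0; have := h e e0; apply: filterS => t gt.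
rewrite sub0r normrN ger0_norm ?fine_ge0// -lee_fin fineK// ge0_fin_numE//.
exact: le_lt_trans gt (ltry _).
Qed.

Lemma cvge0_lt (g : C -> \bar R) (e : R) : 0 < e ->
  g t @[t --> (0 : C)^'] --> 0%E -> \forall t \near (0 : C)^', (g t < e%:E)%E.
Proof.
move=> e0 gl; have e0' : (0 < e%:E :> \bar R)%E by rewrite lte_fin.
exact: gl (open_ereal_lt' e0').
Qed.

End small_parameter_limits.

(** * The limit that defines tau *)

Section value_of_tau.
Variables (R : realType) (N M : nat).
Local Notation C := (Cplx R).
Local Notation K := (pt R N).

Lemma cnorm_ge0 (f : cfam R N) : (0 <= cnorm f)%E.
Proof. by rewrite /cnorm; exact: bigmax_ge_id. Qed.

Lemma cabs_le_cnorm (f : cfam R N) j k : cube R N k -> ((cabs (f j k))%:E <= cnorm f)%E.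
Proof.
move=> Qk; apply: (@le_trans _ _ (ereal_sup [set (cabs (f j k))%:E | k in cube R N])).
  by apply: ereal_sup_ubound; exists k.
by apply: (le_bigmax_cond _ (fun j => ereal_sup [set (cabs (f j k))%:E | k in cube R N])).
Qed.

Lemma cnorm_le (f : cfam R N) (c : R) : 0 <= c ->
  (forall j k, cube R N k -> cabs (f j k) <= c) -> (cnorm f <= c%:E)%E.
Proof.
move=> c0 h; rewrite /cnorm; apply/bigmax_leP; split; first by rewrite lee_fin.
by move=> j _; apply: ge_ereal_sup => _ [k Qk <-]; rewrite lee_fin; exact: h.
Qed.

Lemma tau_lim_unique (F : oper R N M) f g : tau_lim F f -> tau_lim F g -> calC_eq f g.
Proof.
move=> [_ hf] [_ hg] j k Qk; apply/eqP; rewrite -subr_eq0; apply/eqP/cabs0_eq0.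
apply/eqP; rewrite eq_le cabs_ge0 andbT; apply/ler_addgt0Pr => e e0; rewrite add0r.
have e2 : 0 < e / 2 by rewrite divr_gt0.
have nf := cvge0_lt e2 hf; have ng := cvge0_lt e2 hg.
have [t [/= tf tg]] := @filter_ex _ _ (Proper_dnbhs_numFieldType (0 : C)) _ (filterI nf ng).
have := le_lt_trans (cabs_le_cnorm _ j Qk) tf.
have := le_lt_trans (cabs_le_cnorm _ j Qk) tg.
rewrite !lte_fin; set q := _ / t => h1 h2.
rewrite (_ : f j k - g j k = (q - g j k) - (q - f j k)); last by ring.
by apply: le_trans (cabsD _ _) _; rewrite cabsN; lra.
Qed.

Lemma calC_trace_repr (r : hrep R N M) : calC (trace_repr r).
Proof.
move=> j; rewrite /trace_repr; case: eqP => [j0|/eqP j0]; split.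
- by apply/cont_cubeP/ucont_tr; exact: ucmx_rA0.
- move=> k k' _ _ h; congr (\tr (rA0 r _)).
  by apply: eq_from_tnth => i; apply: h; rewrite j0.
- have jN : (1 <= j <= N)%N by rewrite lt0n j0 -ltnS ltn_ord.
  apply/cont_cubeP/ucont_avg/ucont_tr/ucmxM; [exact: ucmx_rB|exact: ucmx_rA].
- move=> k k' _ _ h; rewrite !avgE; apply: cint_eq => y _.
  suff -> : splice y k = splice y k' by [].
  apply: eq_from_tnth => i; have [ji|ij] := leqP j i.
    by rewrite !tnth_splice_ge//; exact: h.
  by rewrite !tnth_splice_lt.
Qed.

Lemma bop_oper_of (s : hrep R N M) : bop (oper_of s).
Proof.
have bS : bop (fun (u : vfun R N M) k => \sum_(1 <= i < N.+1 | (1 <= i < N.+1)%N)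
    rA s i k *m avgmx i (fun x => rB s i x *m u x) k).
  apply: bop_sum => i iN.
  by apply: bop_rank_one; [case/andP: iN|exact: ucmx_rA|exact: ucmx_rB].
apply: bop_eq (bopD 1 1 (bop_mulmx (@ucmx_rA0 _ _ _ s)) bS) => u k.
by rewrite !scale1r /oper_of -big_nat.
Qed.

Section one_operator.
Variables (A : oper R N M) (r : hrep R N M).
Hypotheses (LA : L2_oper A) (rA : represents r A).

Lemma L2_oper_1D t : L2_oper (oper_lin 1 id t A).
Proof.
have [A1 A2] := LA; split; first by move=> u Lu; apply: L2_lin => //; exact: A1.
move=> u v Lu Lv /[dup] uv /L2eqE uvE; apply/L2eqE.
have /L2eqE := A2 u v Lu Lv uv.
by apply: aecS2 uvE => k _; rewrite /oper_lin => -> ->.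
Qed.

Lemma represents_1D t : represents (rep_1D r t) (oper_lin 1 id t A).
Proof.
move=> u Lu; apply/L2eqE; have /L2eqE := rA Lu.
by apply: aecS => k _ h; rewrite /oper_lin h oper_of_rep_1D scale1r.
Qed.

(** [bpi] picks the value at an unknown representation [s']. Invertibility shows that there is a
    value to pick, and [pi_repr_unique] compares [s'] with the explicit [rep_1D r t], for which the
    determinants are bounded below. *)
Lemma bpi_1D t c : 0 < c -> nonvanishing c (rep_1D r t) ->
  calC_eq (bpi (oper_lin 1 id t A)) (pi_repr (rep_1D r t)).
Proof.
move=> c0 nd; set F := oper_lin 1 id t A; set s := rep_1D r t.
have LF : L2_oper F by exact: L2_oper_1D.
have sF : represents s F by exact: represents_1D.
have [G [bG sG Gs]] := oper_of_inverse c0 nd.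
have [[G1 G2] _ _] := bG.
have [F1 F2] := LF.
have inv : InvH F.
  split; first by split=> //; exists s.
  exists G; split=> //.
    by move=> u Lu; apply: L2eq_trans (sG u Lu); exact: sF (G1 u Lu).
  move=> u Lu; apply: L2eq_trans (Gs u Lu); apply: G2; [exact: F1| |exact: sF].
  by have [b _ _ _] := bop_oper_of s; exact: b.
have ex : [set p | InvH F /\ exists2 r0, represents r0 F & p = pi_repr r0] (pi_repr s).
  by split=> //; exists s.
have := @xgetPex _ (fun _ _ => 0) _ (ex_intro _ _ ex).
rewrite -/(bpi F) => -[_ [s' s'F ->]] j k Qk; symmetry.
have ss' : oper_eq (oper_of s) (oper_of s').
  by move=> u Lu; apply: L2eq_trans (s'F u Lu); apply: L2eq_sym; exact: sF.
exact: (pi_repr_unique c0 nd ss').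
Qed.

Lemma tau_lim_trace_repr : tau_lim A (trace_repr r).
Proof.
split; first exact: calC_trace_repr.
have [d d0 nd] := rep_1D_nonvanishing r.
have /choice[c hc] : forall j : 'I_N.+1, exists c : R * R, [/\ 0 <= c.1, 0 < c.2 &
    forall t, cabs t < c.2 -> forall k, cube R N k ->
    cabs (pi_repr (rep_1D r t) j k - 1 - t * trace_repr r j k) <= c.1 * cabs t ^+ 2].
  move=> j; have [c [e [c0 e0 h]]] := pi_repr_rep_1D r j; exists (c, e).
  by split=> // t /h[].
pose c1 := \sum_j (c j).1.
have c10 : 0 <= c1 by apply: sumr_ge0 => j _; have [] := hc j.
pose d1 := Num.min d (\big[Num.min/1]_j (c j).2).
have d10 : 0 < d1.
  by rewrite lt_min d0; apply/bigmin_gtP; split=> // j _; have [] := hc j.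
have est t j k : cabs t < d1 -> cube R N k ->
    cabs (bpi (oper_lin 1 id t A) j k - 1 - t * trace_repr r j k) <= c1 * cabs t ^+ 2.
  rewrite lt_min => /andP[td tj] Qk.
  have h2 : 0 < 2^-1 :> R by rewrite invr_gt0.
  rewrite (bpi_1D h2 (nd t td) j Qk); have [cj0 _ h] := hc j.
  apply: le_trans (h t _ k Qk) _.
    by apply: lt_le_trans tj _; exact: bigmin_le_cond.
  rewrite ler_wpM2r ?sqr_ge0// /c1 (bigD1 j)//= lerDl.
  by apply: sumr_ge0 => l _; have [] := hc l.
(* The value at the identity is read off the estimate at parameter 0, where the operator is the
   identity and the error bound is 0. *)
have bpi1 j k : cube R N k -> bpi (id : oper R N M) j k = 1.
  move=> Qk; have id0 : oper_lin 1 id 0 A = id.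
    apply/funext => u; apply/funext => k'.
    by rewrite /oper_lin scale1r scale0r addr0.
  have := est 0 j k; rewrite id0 cabs0 mul0r subr0 expr0n mulr0 => /(_ d10 Qk) h.
  apply/eqP; rewrite -subr_eq0; apply/eqP/cabs0_eq0/eqP.
  by rewrite eq_le h cabs_ge0.
apply: cvge0_small => [t|e e0]; first exact: cnorm_ge0.
(* Division by [t] leaves an error of at most [c1 * cabs t]; the added 1 keeps the denominator
   positive when [c1] is 0. *)
have e1 : 0 < e / (c1 + 1) by rewrite divr_gt0// ltr_wpDl.
apply: (near_0_cabs (d := Num.min d1 (e / (c1 + 1)))); first by rewrite lt_min d10.
move=> t t0; rewrite lt_min => /andP[td te]; apply: cnorm_le; first exact: ltW.
move=> j k Qk; rewrite bpi1//.
have -> : (bpi (oper_lin 1 id t A) j k - 1) / t - trace_repr r j k =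
    (bpi (oper_lin 1 id t A) j k - 1 - t * trace_repr r j k) / t by field.
have ct : 0 < cabs t by rewrite cabs_gt0.
rewrite cabsM cabsV ler_pdivrMr//; apply: le_trans (est t j k td Qk) _.
rewrite expr2 mulrA ler_pM2r//; move: te; rewrite ltr_pdivlMr ?ltr_wpDl//; nra.
Qed.

Lemma tau_lim_tau : tau_lim A (tau A).
Proof. exact: (xgetPex _ (ex_intro _ _ tau_lim_trace_repr)). Qed.

Lemma tauE : calC_eq (tau A) (trace_repr r).
Proof. exact: tau_lim_unique tau_lim_tau tau_lim_trace_repr. Qed.

End one_operator.

End value_of_tau.

(** * Compositions *)

Section averages_of_products.
Variable R : realType.
Local Notation C := (Cplx R).

Lemma L2_section_L2 N j M (u : vfun R N M) : (j <= N)%N -> L2 u ->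
  aec (fun k => L2 (fun y : pt R j => u (splice y k))).
Proof.
move=> jN /L2P[mu u2].
have ms := measurable_sqnorm mu.
have s0 (x : pt R N) : cube R N x -> (0 <= (sqnorm u x)%:E)%E by rewrite lee_fin sqnorm_ge0.
have mI := @measurable_avg_ge0 R N j _ ms s0.
have iI : (leb R N).-integrable (cube R N) (fun k =>
    \int[leb R j]_(y in cube R j) (sqnorm u (splice y k))%:E)%E.
  apply/integrableP; split=> //.
  rewrite (eq_integral (fun k => \int[leb R j]_(y in cube R j) (sqnorm u (splice y k))%:E)%E).
    by rewrite (tonelli_splice jN ms s0).
  move=> k _; rewrite gee0_abs//; apply: integral_ge0 => y _.
  by rewrite lee_fin sqnorm_ge0.
have := integrable_ae (@measurable_cube R N) iI; apply: filterS => k fin Qk.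
apply/L2P; split; first by move=> i; exact: cmeas_section Qk (mu i).
by rewrite -ge0_fin_numE ?fin// integral_ge0// => y _; rewrite lee_fin sqnorm_ge0.
Qed.

Lemma cintmx_aec n p q (F G : pt R n -> 'M[C]_(p, q)) :
  (forall a b, cmeas (fun y => F y a b)) -> (forall a b, cmeas (fun y => G y a b)) ->
  aec (fun y => F y = G y) -> cintmx F = cintmx G.
Proof.
move=> mF mG FG; apply/matrixP => a b; rewrite !mxE; apply: cint_aec => //.
by apply: aecS FG => y _ ->.
Qed.

Lemma cintmx_avgmx n j p q (F : pt R n -> 'M[C]_(p, q)) : (j <= n)%N -> cintgmx F ->
  cintmx (avgmx j F) = cintmx F.
Proof.
move=> jn iF; apply/matrixP => a b; rewrite !mxE -(cint_avg jn (iF a b)).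
by apply: cint_eq => y _; rewrite mxE.
Qed.

(** Averaging is symmetric for the integral pairing: both sides equal the integral of
    [avgmx j f y *m avgmx j g y], an averaged factor being constant for the inner average. On the
    right this is an identity almost everywhere only, as [g] is merely square integrable. *)
Lemma cintmx_mul_avgmx n j p m (f : pt R n -> 'M[C]_(p, m)) (g : vfun R n m) :
  (j <= n)%N -> ucmx f -> L2 g ->
  cintmx (fun y => f y *m avgmx j g y) = cintmx (fun y => avgmx j f y *m g y).
Proof.
move=> jn uf Lg.
have [bA _ _ _] := bop_avg R m jn.
have uaf := ucmx_avg j uf.
have [bf _ _ _] := bop_mulmx uf; have [baf _ _ _] := bop_mulmx uaf.
have cg (u : vfun R n p) : L2 u -> cintgmx u.
  by move=> Lu a b; rewrite (ord1 b); exact: L2_cintg.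
have cm (u : vfun R n p) : L2 u -> forall a b, cmeas (fun y => u y a b).
  by move=> Lu a b; rewrite (ord1 b); exact: L2_cmeas.
transitivity (cintmx (fun y => avgmx j f y *m avgmx j g y)).
  rewrite -(cintmx_avgmx jn); last exact: cg (bf _ (bA _ Lg)).
  apply: cintmx_eq => y Qy; rewrite !avgmxE -cintmxMr.
    by apply: cintmx_eq => z Qz; rewrite -avgmxE avgmx_splice.
  by apply: cintgmx_ucmx; exact: (@ucmx_section R n j _ _ _ y Qy uf).
rewrite -[RHS](cintmx_avgmx jn); last exact: cg (baf _ Lg).
apply: cintmx_aec.
- exact: cm (baf _ (bA _ Lg)).
- have [bA' _ _ _] := bop_avg R p jn; exact: cm (bA' _ (baf _ Lg)).
apply: aecS (L2_section jn Lg) => y Qy ig.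
transitivity (cintmx (fun z : pt R j => avgmx j f y *m g (splice z y))).
  by rewrite (cintmxMl _ ig).
by apply: cintmx_eq => z Qz; rewrite avgmx_splice.
Qed.

Lemma avgmx_section N i j p q (F : pt R N -> 'M[C]_(p, q)) (y : pt R i) k : (j <= i)%N ->
  avgmx j (fun z : pt R i => F (splice z k)) y = avgmx j F (splice y k).
Proof. by move=> ji; rewrite !avgmxE; apply: cintmx_eq => z _; rewrite -splice_spliceA. Qed.

Lemma avgmx_mul_avgmx N i j p m (F : pt R N -> 'M[C]_(p, m)) (G : vfun R N m) :
  (j <= i <= N)%N -> ucmx F -> L2 G ->
  aec (fun k => avgmx i (fun x => F x *m avgmx j G x) k = avgmx i (fun x => avgmx j F x *m G x) k).
Proof.
move=> /andP[ji iN] uF LG; apply: aecS (L2_section_L2 iN LG) => k Qk LGk.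
have := cintmx_mul_avgmx ji (@ucmx_section R N i _ _ _ k Qk uF) LGk.
rewrite !avgmxE => h.
transitivity (cintmx (fun y : pt R i => F (splice y k) *m avgmx j (fun y : pt R i => G (splice y k)) y)).
  by apply: cintmx_eq => y _; rewrite avgmx_section.
by rewrite h; apply: cintmx_eq => y _; rewrite avgmx_section.
Qed.

(** Brings the cross terms of a composition into a form where both factors are averaged; cyclicity
    of the trace can then exchange them. The factors are continuous, so every [k] is allowed. *)
Lemma avg_tr_avgmx N i j p m (F : pt R N -> 'M[C]_(p, m)) (G : pt R N -> 'M[C]_(m, p)) k :
  (j <= i)%N -> cube R N k -> ucmx F -> ucmx G ->
  avg i (fun x => \tr (F x *m avgmx j G x)) k =
  avg i (fun x => \tr (avgmx j F x *m avgmx j G x)) k.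
Proof.
move=> ji Qk uF uG; rewrite !avgE.
have uFk := @ucmx_section R N i _ _ _ k Qk uF.
have uGk := @ucmx_section R N i _ _ _ k Qk uG.
have uH : ucmx (fun y : pt R i => F (splice y k) *m avgmx j G (splice y k)).
  apply: ucmxM => //; apply: (@ucmx_section R N i _ _ _ k Qk); exact: ucmx_avg.
rewrite -(cint_avg ji); last by apply: cintg_ucont; exact: ucont_tr.
apply: cint_eq => y Qy; rewrite avgE -tr_cintmx.
  congr (\tr _); rewrite -[avgmx j F _]avgmx_section// [avgmx j _ y]avgmxE -cintmxMr.
    by apply: cintmx_eq => z Qz; rewrite -!splice_spliceA// avgmx_splice.
  by apply: cintgmx_ucmx; exact: (@ucmx_section R i j _ _ _ y Qy uFk).
by apply: cintgmx_ucmx; exact: (@ucmx_section R i j _ _ _ y Qy uH).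
Qed.

Lemma avgD N j (f g : pt R N -> C) k : cube R N k -> ucont f -> ucont g ->
  avg j (fun x => f x + g x) k = avg j f k + avg j g k.
Proof.
move=> Qk uf ug; rewrite !avgE -cintD//; apply: cintg_ucont.
  exact: (ucont_section j Qk uf).
exact: (ucont_section j Qk ug).
Qed.

Lemma avgZ N j (c : C) (f : pt R N -> C) k : cube R N k -> ucont f ->
  avg j (fun x => c * f x) k = c * avg j f k.
Proof.
move=> Qk uf; rewrite !avgE -cintZ//; apply: cintg_ucont.
exact: (ucont_section j Qk uf).
Qed.

Lemma avg_sum N j I (r : seq I) (P : pred I) (F : I -> pt R N -> C) k : cube R N k ->
  (forall i, P i -> ucont (F i)) ->
  avg j (fun x => \sum_(i <- r | P i) F i x) k = \sum_(i <- r | P i) avg j (F i) k.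
Proof.
move=> Qk uF; rewrite avgE cint_sum// => i Pi; apply: cintg_ucont.
exact: (ucont_section j Qk (uF i Pi)).
Qed.

Lemma avgmx_col N j p p' q (F : pt R N -> 'M[C]_(p, q)) (G : pt R N -> 'M[C]_(p', q)) k :
  avgmx j (fun x => col_mx (F x) (G x)) k = col_mx (avgmx j F k) (avgmx j G k).
Proof.
apply/matrixP => a b; rewrite -[a](splitK a); case: (fintype.split a) => a' /=.
  rewrite col_mxEu !mxE; congr avg; apply/funext => x; exact: col_mxEu.
rewrite col_mxEd !mxE; congr avg; apply/funext => x; exact: col_mxEd.
Qed.

Lemma ucmx_row n p q q' (F : pt R n -> 'M[C]_(p, q)) (G : pt R n -> 'M[C]_(p, q')) :
  ucmx F -> ucmx G -> ucmx (fun x => row_mx (F x) (G x)).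
Proof.
move=> uF uG a b; rewrite -[b](splitK b); case: (fintype.split b) => b' /=.
  by apply: ucont_eq (uF a b') => x _; rewrite row_mxEl.
by apply: ucont_eq (uG a b') => x _; rewrite row_mxEr.
Qed.

Lemma ucmx_col n p p' q (F : pt R n -> 'M[C]_(p, q)) (G : pt R n -> 'M[C]_(p', q)) :
  ucmx F -> ucmx G -> ucmx (fun x => col_mx (F x) (G x)).
Proof.
move=> uF uG a b; rewrite -[a](splitK a); case: (fintype.split a) => a' /=.
  by apply: ucont_eq (uF a' b) => x _; rewrite col_mxEu.
by apply: ucont_eq (uG a' b) => x _; rewrite col_mxEd.
Qed.

End averages_of_products.

(** * Representations of linear combinations and of compositions *)

Section algebra_of_representations.
Variables (R : realType) (N M : nat).
Local Notation C := (Cplx R).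
Local Notation K := (pt R N).
Implicit Types r s : hrep R N M.

Section linear_combination.
Variables (a b : C) (r s : hrep R N M).

(** Kernels are added by juxtaposing left factors and stacking right factors, so the inner
    dimensions add up. *)
Definition rep_lin : hrep R N M.
Proof.
refine (@Hrep R N M (fun j => rdim r j + rdim s j)%N
  (fun k => a *: rA0 r k + b *: rA0 s k)
  (fun j k => row_mx (a *: rA r j k) (b *: rA s j k))
  (fun j k => col_mx (rB r j k) (rB s j k)) _ _ _ _).
- by move=> j jN; rewrite addn_gt0 rdim_gt0.
- by apply/cont_cube_mxP/ucmxD; apply: ucmxZ; exact: ucmx_rA0.
- by move=> j jN; apply/cont_cube_mxP/ucmx_row; apply: ucmxZ; exact: ucmx_rA.
- by move=> j jN; apply/cont_cube_mxP/ucmx_col; exact: ucmx_rB.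
Defined.

Lemma oper_of_rep_lin (u : vfun R N M) k :
  oper_of rep_lin u k = a *: oper_of r u k + b *: oper_of s u k.
Proof.
rewrite /oper_of /= mulmxDl -!scalemxAl !scalerDr addrACA; congr (_ + _).
rewrite !scaler_sumr -big_split /=; apply: eq_bigr => j _.
rewrite (_ : (fun x => col_mx (rB r j x) (rB s j x) *m u x) =
    fun x => col_mx (rB r j x *m u x) (rB s j x *m u x)); last first.
  by apply/funext => x; rewrite mul_col_mx.
by rewrite avgmx_col mul_row_col -!scalemxAl.
Qed.

Lemma trace_repr_lin :
  calC_eq (trace_repr rep_lin) (fun j k => a * trace_repr r j k + b * trace_repr s j k).
Proof.
move=> j k Qk; rewrite /trace_repr; case: eqP => [_|/eqP j0].
  by rewrite /= mxtraceD !mxtraceZ.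
have jN : (1 <= j <= N)%N by rewrite lt0n j0 -ltnS ltn_ord.
have u1 : ucont (fun x => \tr (rB r j x *m rA r j x)).
  by apply/ucont_tr/ucmxM; [exact: ucmx_rB|exact: ucmx_rA].
have u2 : ucont (fun x => \tr (rB s j x *m rA s j x)).
  by apply/ucont_tr/ucmxM; [exact: ucmx_rB|exact: ucmx_rA].
rewrite -!avgZ// -avgD//; [|exact: ucontZ..].
apply: avg_eq => // x _; rewrite /= mul_col_row mxtrace_block -!scalemxAr.
by rewrite !mxtraceZ.
Qed.

End linear_combination.

Section composition.
Variables r s : hrep R N M.

(* For [j <= i] a factor <.>_j leaves the average <.>_i unchanged on the one side
   ([<f <g>_j>_i = <<f>_j g>_i]), and for [i <= j] it is constant in the variables
   of <.>_i.  Hence the product of the term i of [r] and the term j of [s] is a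
   term of level max(i, j), which keeps the right factor of [s] or the left
   factor of [r]. *)
Definition comp_left l k := rA0 r k *m rA s l k +
  \sum_(1 <= i < l.+1) rA r i k *m avgmx i (fun x => rB r i x *m rA s l x) k.

(** The upper bound is strict because the pair of equal levels is already counted in [comp_left]. *)
Definition comp_right l k := rB r l k *m rA0 s k +
  \sum_(1 <= j < l) avgmx j (fun x => rB r l x *m rA s j x) k *m rB s j k.

Lemma ucmx_comp_left l : (1 <= l <= N)%N -> ucmx (comp_left l).
Proof.
move=> /[dup] lN /andP[l1 lN'].
apply: ucmxD; first by apply: ucmxM; [exact: ucmx_rA0|exact: ucmx_rA].
apply: (@ucmx_eq _ _ _ _ (fun k => \sum_(1 <= i < l.+1 | (1 <= i < l.+1)%N)
    rA r i k *m avgmx i (fun x => rB r i x *m rA s l x) k)).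
  by move=> k _; rewrite -big_nat.
apply: ucmx_sum => i /andP[i1 il].
have iN : (1 <= i <= N)%N by rewrite i1 (leq_trans _ lN').
apply: ucmxM; first exact: ucmx_rA.
by apply: ucmx_avg; apply: ucmxM; [exact: ucmx_rB|exact: ucmx_rA].
Qed.

Lemma ucmx_comp_right l : (1 <= l <= N)%N -> ucmx (comp_right l).
Proof.
move=> /[dup] lN /andP[l1 lN'].
apply: ucmxD; first by apply: ucmxM; [exact: ucmx_rB|exact: ucmx_rA0].
apply: (@ucmx_eq _ _ _ _ (fun k => \sum_(1 <= j < l | (1 <= j < l)%N)
    avgmx j (fun x => rB r l x *m rA s j x) k *m rB s j k)).
  by move=> k _; rewrite -big_nat.
apply: ucmx_sum => j /andP[j1 jl].
have jN : (1 <= j <= N)%N by rewrite j1 (leq_trans (ltnW jl)).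
apply: ucmxM; last exact: ucmx_rB.
by apply: ucmx_avg; apply: ucmxM; [exact: ucmx_rB|exact: ucmx_rA].
Qed.

Definition rep_comp : hrep R N M.
Proof.
refine (@Hrep R N M (fun l => rdim s l + rdim r l)%N
  (fun k => rA0 r k *m rA0 s k)
  (fun l k => row_mx (comp_left l k) (rA r l k))
  (fun l k => col_mx (rB s l k) (comp_right l k)) _ _ _ _).
- by move=> j jN; rewrite addn_gt0 rdim_gt0.
- by apply/cont_cube_mxP/ucmxM; exact: ucmx_rA0.
- by move=> j jN; apply/cont_cube_mxP/ucmx_row; [exact: ucmx_comp_left|exact: ucmx_rA].
- by move=> j jN; apply/cont_cube_mxP/ucmx_col; [exact: ucmx_rB|exact: ucmx_comp_right].
Defined.

(** Groups the pairs of levels by their maximum [l]. *)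
Let sum_triangle (V : zmodType) (f : nat -> nat -> V) :
  \sum_(1 <= i < N.+1) \sum_(1 <= j < N.+1) f i j =
  \sum_(1 <= l < N.+1) (\sum_(1 <= i < l.+1) f i l + \sum_(1 <= j < l) f l j).
Proof.
transitivity (\sum_(1 <= i < N.+1)
    (\sum_(1 <= j < N.+1 | (i <= j)%N) f i j + \sum_(1 <= j < N.+1 | (j < i)%N) f i j)).
  apply: eq_bigr => i _; rewrite (bigID (fun j => i <= j)%N) /=; congr (_ + _).
  by apply: eq_bigl => j; rewrite ltnNge.
rewrite !big_split /=; congr (_ + _).
  under eq_bigr do rewrite big_mkcond /=.
  rewrite exchange_big /= big_nat [RHS]big_nat; apply: eq_bigr => l /andP[l1 lN].
  by rewrite -big_mkcond (big_nat_widen 1 l.+1 N.+1).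
rewrite big_nat [RHS]big_nat; apply: eq_bigr => l /andP[l1 lN].
by rewrite (big_nat_widen 1 l N.+1)// ltnW.
Qed.

Lemma oper_of_rep_comp : oper_eq (oper_of r \o oper_of s) (oper_of rep_comp).
Proof.
move=> u Lu; apply/L2eqE.
(* Levels are written [i.+1] with [i : 'I_N]: over a finite type the exceptional null sets of all
   levels and pairs of levels can be merged before [k] is fixed. *)
have ordN (i : 'I_N) : (1 <= i.+1 <= N)%N by rewrite /= ltn_ord.
have L0 (i : 'I_N) : L2 (fun x => rB r i.+1 x *m (rA0 s x *m u x)).
  have [b0 _ _ _] := bop_mulmx (@ucmx_rA0 _ _ _ s).
  have [b1 _ _ _] := bop_mulmx (@ucmx_rB _ _ _ r _ (ordN i)).
  exact/b1/b0.
have LB (j : 'I_N) : L2 (fun x => rB s j.+1 x *m u x).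
  by have [b1 _ _ _] := bop_mulmx (@ucmx_rB _ _ _ s _ (ordN j)); exact: b1.
have L1 (ij : 'I_N * 'I_N) : L2 (fun x => rB r ij.1.+1 x *m
    (rA s ij.2.+1 x *m avgmx ij.2.+1 (fun x => rB s ij.2.+1 x *m u x) x)).
  have [b1 _ _ _] := bop_mulmx (@ucmx_rB _ _ _ r _ (ordN ij.1)).
  have [b2 _ _ _] := bop_mulmx (@ucmx_rA _ _ _ s _ (ordN ij.2)).
  have [b3 _ _ _] := bop_avg R (rdim s ij.2.+1) (ltn_ord ij.2 : (ij.2.+1 <= N)%N).
  exact/b1/b2/b3/LB.
have uBA (ij : 'I_N * 'I_N) : ucmx (fun x => rB r ij.1.+1 x *m rA s ij.2.+1 x).
  by apply: ucmxM; [exact: ucmx_rB|exact: ucmx_rA].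
have i0 := aec_finType (fun i : 'I_N => L2_section (ltn_ord i : (i.+1 <= N)%N) (L0 i)).
have i1 := aec_finType (fun ij : 'I_N * 'I_N =>
  L2_section (ltn_ord ij.1 : (ij.1.+1 <= N)%N) (L1 ij)).
have L2w (ij : 'I_N * 'I_N) : L2 (fun x =>
    avgmx ij.2.+1 (fun x => rB r ij.1.+1 x *m rA s ij.2.+1 x) x *m (rB s ij.2.+1 x *m u x)).
  by have [b1 _ _ _] := bop_mulmx (ucmx_avg ij.2.+1 (uBA ij)); exact/b1/LB.
have iw := aec_finType (fun ij : 'I_N * 'I_N =>
  L2_section (ltn_ord ij.1 : (ij.1.+1 <= N)%N) (L2w ij)).
have low1 (ij : 'I_N * 'I_N) : aec (fun k => (ij.2.+1 <= ij.1.+1)%N ->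
    avgmx ij.1.+1 (fun x => (rB r ij.1.+1 x *m rA s ij.2.+1 x) *m
        avgmx ij.2.+1 (fun x => rB s ij.2.+1 x *m u x) x) k =
    avgmx ij.1.+1 (fun x => avgmx ij.2.+1 (fun x => rB r ij.1.+1 x *m rA s ij.2.+1 x) x *m
        (rB s ij.2.+1 x *m u x)) k).
  have [ji|ji] := boolP (ij.2.+1 <= ij.1.+1)%N; last first.
    by apply: aecW => k _ h; discriminate h.
  have ijN : (ij.2.+1 <= ij.1.+1 <= N)%N by rewrite ji ltn_ord.
  have := avgmx_mul_avgmx ijN (uBA ij) (LB ij.2).
  apply: aecS => k _ h _; exact: h.
have low := aec_finType low1.
have i1low := aecS2 (fun k _ h h' => conj h h') i1 low.
have i0w := aecS2 (fun k _ h h' => conj h h') i0 iw.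
apply: aecS2 i1low i0w => k Qk [{}i1 {}low] [{}i0 {}iw].
(* In the average of level [i] of [B_i] times [oper_of s u], [p i] comes from the multiplication
   term and [q i j] from the term of level [j]; [w i j] is [q i j] with the inner average moved off
   [u]. *)
pose g j := avgmx j (fun x => rB s j x *m u x).
pose p i := avgmx i (fun x => rB r i x *m (rA0 s x *m u x)) k.
pose q i j := avgmx i (fun x => rB r i x *m (rA s j x *m g j x)) k.
pose w i j := avgmx i (fun x =>
  avgmx j (fun x => rB r i x *m rA s j x) x *m (rB s j x *m u x)) k.
have qE i j : (1 <= i <= N)%N -> (1 <= j <= N)%N ->
    q i j = if (i <= j)%N then avgmx i (fun x => rB r i x *m rA s j x) k *m g j k else w i j.
  case: i => // i iN; case: j => // j jN; case: ifPn => [ij|].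
    rewrite /q avgmxE (_ : avgmx _ _ k = cintmx (fun y : pt R i.+1 =>
      rB r i.+1 (splice y k) *m rA s j.+1 (splice y k)))// -cintmxMr; last first.
      by apply: cintgmx_ucmx; exact: (@ucmx_section R N i.+1 _ _ _ k Qk (uBA (Ordinal iN, Ordinal jN))).
    by apply: cintmx_eq => y _; rewrite mulmxA /g avgmx_splice.
  rewrite -ltnNge => ji; have := low (Ordinal iN, Ordinal jN) (ltnW ji) => /= h.
  rewrite /w -h /q.
  apply: (avgmx_eq _ Qk) => x _.
  by rewrite /g -[RHS]mulmxA.
have step1 i : (1 <= i <= N)%N ->
    avgmx i (fun x => rB r i x *m oper_of s u x) k = p i + \sum_(1 <= j < N.+1) q i j.
  case: i => // i iN.
  transitivity (cintmx (fun y : pt R i.+1 =>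
      rB r i.+1 (splice y k) *m (rA0 s (splice y k) *m u (splice y k)) +
      \sum_(1 <= j < N.+1 | (1 <= j < N.+1)%N)
        rB r i.+1 (splice y k) *m (rA s j (splice y k) *m g j (splice y k)))).
    by apply: cintmx_eq => y _; rewrite /oper_of mulmxDr mulmx_sumr -big_nat.
  rewrite cintmxD; last 2 first.
  - exact: (i0 (Ordinal iN)).
  - by apply: cintgmx_sum => -[//|j] /andP[_ jN]; exact: (i1 (Ordinal iN, Ordinal (jN : (j < N)%N))).
  congr (_ + _); rewrite cintmx_sum; last first.
    by move=> [//|j] /andP[_ jN]; exact: (i1 (Ordinal iN, Ordinal (jN : (j < N)%N))).
  by rewrite -big_nat.
have step2 l : (1 <= l <= N)%N ->
    avgmx l (fun x => comp_right l x *m u x) k = p l + \sum_(1 <= j < l) w l j.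
  case: l => // l lN.
  transitivity (cintmx (fun y : pt R l.+1 =>
      rB r l.+1 (splice y k) *m (rA0 s (splice y k) *m u (splice y k)) +
      \sum_(1 <= j < l.+1 | (1 <= j < l.+1)%N)
        avgmx j (fun x => rB r l.+1 x *m rA s j x) (splice y k) *m
          (rB s j (splice y k) *m u (splice y k)))).
    apply: cintmx_eq => y _; rewrite /comp_right mulmxDl mulmxA -big_nat; congr (_ + _).
    by rewrite mulmx_suml; apply: eq_bigr => j _; rewrite mulmxA.
  have jN j : (j < l)%N -> (j < N)%N by move=> jl; apply: leq_trans lN; exact: ltnW.
  rewrite cintmxD; last 2 first.
  - exact: (i0 (Ordinal lN)).
  - by apply: cintgmx_sum => -[//|j] /andP[_ jl]; exact: (iw (Ordinal lN, Ordinal (jN j jl))).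
  congr (_ + _); rewrite cintmx_sum; last first.
    by move=> [//|j] /andP[_ jl]; exact: (iw (Ordinal lN, Ordinal (jN j jl))).
  by rewrite -big_nat.
transitivity (rA0 r k *m rA0 s k *m u k + \sum_(1 <= l < N.+1) (rA0 r k *m rA s l k *m g l k +
    (\sum_(1 <= i < l.+1) rA r i k *m q i l + \sum_(1 <= j < l) rA r l k *m q l j) +
    rA r l k *m p l)).
  rewrite /= {1}/oper_of {1}/oper_of mulmxDr mulmxA -addrA; congr (_ + _).
  rewrite [in RHS]big_split [X in _ = X + _]big_split /=.
  rewrite -(sum_triangle (fun i j => rA r i k *m q i j)) -!addrA mulmx_sumr; congr (_ + _).
    by apply: eq_bigr => l _; rewrite mulmxA.
  rewrite addrC -big_split /= big_nat [RHS]big_nat; apply: eq_bigr => i iN.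
  by rewrite step1// mulmxDr mulmx_sumr.
rewrite /oper_of /=; congr (_ + _); rewrite big_nat [RHS]big_nat; apply: eq_bigr => l lN.
rewrite (_ : (fun x => col_mx (rB s l x) (comp_right l x) *m u x) =
    fun x => col_mx (rB s l x *m u x) (comp_right l x *m u x)); last first.
  by apply/funext => x; rewrite mul_col_mx.
rewrite (avgmx_col l (fun x => rB s l x *m u x) (fun x => comp_right l x *m u x) k).
rewrite mul_row_col (step2 l lN).
transitivity (comp_left l k *m g l k + rA r l k *m (p l + \sum_(1 <= j < l) w l j)); last first.
  reflexivity.
rewrite mulmxDr [comp_left l k *m _]mulmxDl.
have [l1 lN'] := andP lN.
rewrite -!addrA; congr (_ + _); rewrite mulmx_suml mulmx_sumr; congr (_ + _).
  rewrite big_nat [RHS]big_nat; apply: eq_bigr => i /andP[i1' il].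
  have iN : (1 <= i <= N)%N by rewrite i1' -ltnS (leq_trans il lN').
  by rewrite (qE _ _ iN lN) -ltnS il mulmxA.
rewrite addrC; congr (_ + _); rewrite big_nat [RHS]big_nat; apply: eq_bigr => j /andP[j1 jl].
have jN : (1 <= j <= N)%N by rewrite j1 -ltnS (ltn_trans jl lN').
by rewrite (qE _ _ lN jN) leqNgt jl.
Qed.

End composition.

End algebra_of_representations.

(** * Symmetry of the trace of a composition *)

Section trace_of_compositions.
Variables (R : realType) (N M : nat).
Local Notation C := (Cplx R).
Local Notation K := (pt R N).
Implicit Types r s : hrep R N M.

Let mixed r s l i k := avg l (fun x =>
  \tr (avgmx i (fun x => rB s l x *m rA r i x) x *m
       avgmx i (fun x => rB r i x *m rA s l x) x)) k.

Let pure r s l k := avg l (fun x => \tr (rB s l x *m (rA0 r x *m rA s l x))) k.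

(** Exchanging [r] and [s] permutes all terms on the right except the last; there it swaps the two
    factors under the trace, which cyclicity allows since both are averaged at the same level
    [l]. *)
Let trace_repr_comp_level r s l k : (1 <= l <= N)%N -> cube R N k ->
  avg l (fun x => \tr (rB (rep_comp r s) l x *m rA (rep_comp r s) l x)) k =
  pure r s l k + pure s r l k +
  (\sum_(1 <= i < l) mixed r s l i k + \sum_(1 <= i < l) mixed s r l i k) +
  mixed r s l l k.
Proof.
move=> /[dup] lN /andP[l1 lN'] Qk.
have uP r' s' : ucont (fun x => \tr (rB s' l x *m (rA0 r' x *m rA s' l x))).
  apply/ucont_tr/ucmxM; first exact: ucmx_rB.
  by apply: ucmxM; [exact: ucmx_rA0|exact: ucmx_rA].
have uBA r' s' i j : (1 <= i <= N)%N -> (1 <= j <= N)%N -> ucmx (fun x => rB r' i x *m rA s' j x).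
  by move=> iN jN; apply: ucmxM; [exact: ucmx_rB|exact: ucmx_rA].
have uT r' s' i : (1 <= i <= N)%N ->
    ucont (fun x => \tr ((rB s' l x *m rA r' i x) *m avgmx i (fun x => rB r' i x *m rA s' l x) x)).
  by move=> iN; apply/ucont_tr/ucmxM; [exact: uBA|apply: ucmx_avg; exact: uBA].
have avgT r' s' i : (1 <= i <= l)%N ->
    avg l (fun x => \tr ((rB s' l x *m rA r' i x) *m avgmx i (fun x => rB r' i x *m rA s' l x) x)) k =
    mixed r' s' l i k.
  move=> /andP[i1 il]; have iN : (1 <= i <= N)%N by rewrite i1 (leq_trans il).
  by apply: avg_tr_avgmx => //; exact: uBA.
have avgT' r' s' i : (1 <= i <= l)%N ->
    avg l (fun x => \tr ((rB s' i x *m rA r' l x) *m avgmx i (fun x => rB r' l x *m rA s' i x) x)) k =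
    mixed s' r' l i k.
  move=> /andP[i1 il]; have iN : (1 <= i <= N)%N by rewrite i1 (leq_trans il).
  rewrite avg_tr_avgmx//; [|exact: uBA..].
  by apply: avg_eq => // x _; exact: mxtrace_mulC.
have uT' r' s' i : (1 <= i <= N)%N ->
    ucont (fun x => \tr ((rB s' i x *m rA r' l x) *m avgmx i (fun x => rB r' l x *m rA s' i x) x)).
  by move=> iN; apply/ucont_tr/ucmxM; [exact: uBA|apply: ucmx_avg; exact: uBA].
transitivity (avg l (fun x =>
  (\tr (rB s l x *m (rA0 r x *m rA s l x)) + \tr (rB r l x *m (rA0 s x *m rA r l x))) +
  (\sum_(1 <= i < l.+1 | (1 <= i < l.+1)%N)
     \tr ((rB s l x *m rA r i x) *m avgmx i (fun x => rB r i x *m rA s l x) x) +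
   \sum_(1 <= i < l | (1 <= i < l)%N)
     \tr ((rB s i x *m rA r l x) *m avgmx i (fun x => rB r l x *m rA s i x) x))) k).
  apply: avg_eq => // x _.
  rewrite [LHS](_ : _ = \tr (rB s l x *m comp_left r s l x) + \tr (comp_right r s l x *m rA r l x)); last first.
    by rewrite /= mul_col_row mxtrace_block.
  rewrite mulmxDr mulmxDl !mxtraceD addrACA; congr (_ + _ + (_ + _)).
  - by rewrite mulmxA.
  - rewrite mulmx_sumr raddf_sum -big_nat; apply: eq_bigr => i _.
    by rewrite mulmxA.
  - rewrite mulmx_suml raddf_sum -big_nat; apply: eq_bigr => i _.
    by rewrite -mulmxA mxtrace_mulC.
have uS1 : ucont (fun x => \sum_(1 <= i < l.+1 | (1 <= i < l.+1)%N)
     \tr ((rB s l x *m rA r i x) *m avgmx i (fun x => rB r i x *m rA s l x) x)).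
  by apply: ucont_sum => i /andP[i1 il]; apply: uT; rewrite i1 (leq_trans _ lN').
have uS2 : ucont (fun x => \sum_(1 <= i < l | (1 <= i < l)%N)
     \tr ((rB s i x *m rA r l x) *m avgmx i (fun x => rB r l x *m rA s i x) x)).
  by apply: ucont_sum => i /andP[i1 il]; apply: uT'; rewrite i1 (leq_trans (ltnW il)).
rewrite avgD//; [|exact: ucontD..].
rewrite (avgD _ Qk (uP r s) (uP s r)) (avgD _ Qk uS1 uS2).
rewrite -[RHS]addrA; congr (_ + _).
rewrite avg_sum//; last first.
  by move=> i /andP[i1 il]; apply: uT; rewrite i1 (leq_trans _ lN').
rewrite avg_sum//; last first.
  by move=> i /andP[i1 il]; apply: uT'; rewrite i1 (leq_trans (ltnW il)).
transitivity (\sum_(1 <= i < l.+1) mixed r s l i k + \sum_(1 <= i < l) mixed s r l i k).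
  apply: f_equal2; rewrite [RHS]big_nat; apply: eq_bigr => i /andP[i1 il].
    by apply: avgT; rewrite i1.
  by apply: avgT'; rewrite i1 ltnW.
by rewrite big_nat_recr//= addrAC.
Qed.

Lemma trace_repr_compC r s :
  calC_eq (trace_repr (rep_comp r s)) (trace_repr (rep_comp s r)).
Proof.
move=> j k Qk; rewrite /trace_repr; case: eqP => [_|/eqP j0]; first exact: mxtrace_mulC.
have jN : (1 <= j <= N)%N by rewrite lt0n j0 -ltnS ltn_ord.
rewrite !trace_repr_comp_level// [pure s r j k + _]addrC [\sum_(_ <= _ < _) mixed s r j _ k + _]addrC.
by congr (_ + _); apply: avg_eq => // x _; exact: mxtrace_mulC.
Qed.

End trace_of_compositions.

(** * The trace formula, linearity and the trace property *)

Theorem theorem1p9 (R : realType) (N M : nat) (hN : (1 <= N)%N) (hM : (1 <= M)%N) :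
  (forall (A : oper R N M) (r : hrep R N M), L2_oper A -> represents r A ->
     tau_lim A (tau A) /\ calC_eq (tau A) (trace_repr r)) /\
  (forall (A B : oper R N M) (a b : Cplx R), calH A -> calH B ->
     calC_eq (tau (oper_lin a A b B)) (fun j k => a * tau A j k + b * tau B j k)) /\
  (forall A B : oper R N M, calH A -> calH B ->
     calC_eq (tau (A \o B)) (tau (B \o A))).
Proof.
have comp_rep (A B : oper R N M) r s : L2_oper A -> L2_oper B ->
    represents r A -> represents s B -> represents (rep_comp r s) (A \o B).
  move=> [A1 A2] [B1 B2] rA sB u Lu.
  apply: L2eq_trans (oper_of_rep_comp r s Lu).
  apply: L2eq_trans (rA _ (B1 _ Lu)) _.
  (* [B u] and [oper_of s u] agree almost everywhere only, so [oper_of r] has to respect that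
     equality. *)
  have [_ r2 _ _] := bop_oper_of r; have [s1 _ _ _] := bop_oper_of s.
  by apply: r2 (sB _ Lu); [exact: B1|exact: s1].
have comp_L2 (A B : oper R N M) : L2_oper A -> L2_oper B -> L2_oper (A \o B).
  move=> [A1 A2] [B1 B2]; split; first by move=> u Lu; exact/A1/B1.
  by move=> u v Lu Lv uv; apply: A2; [exact: B1..|exact: B2].
split; [|split].
- by move=> A r LA rA; split; [exact: tau_lim_tau LA rA|exact: tauE LA rA].
- move=> A B a b [LA [r rA]] [LB [s sB]] j k Qk.
  have LAB : L2_oper (oper_lin a A b B).
    have [A1 A2] := LA; have [B1 B2] := LB; split.
      by move=> u Lu; apply: L2_lin; [exact: A1|exact: B1].
    move=> u v Lu Lv uv; apply/L2eqE.
    have /L2eqE := A2 u v Lu Lv uv; have /L2eqE := B2 u v Lu Lv uv.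
    by apply: aecS2 => x _; rewrite /oper_lin => -> ->.
  have rAB : represents (rep_lin a b r s) (oper_lin a A b B).
    move=> u Lu; apply/L2eqE; have /L2eqE := rA u Lu; have /L2eqE := sB u Lu.
    by apply: aecS2 => x _; rewrite /oper_lin oper_of_rep_lin => -> ->.
  rewrite (tauE LAB rAB _ Qk) (tauE LA rA _ Qk) (tauE LB sB _ Qk).
  exact: trace_repr_lin.
- move=> A B [LA [r rA]] [LB [s sB]] j k Qk.
  rewrite (tauE (comp_L2 _ _ LA LB) (comp_rep _ _ _ _ LA LB rA sB) _ Qk).
  rewrite (tauE (comp_L2 _ _ LB LA) (comp_rep _ _ _ _ LB LA sB rA) _ Qk).
  exact: trace_repr_compC.
Qed.
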